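(* Let $\kappa$ be an infinite cardinal, let $n\in\omega$, and let $K\in\mathcal{C}_\kappa^n$, i.e. $K$ is (up to a permutation of the factors) a product $\prod_{i=1}^m K_i$ of finitely many compact lines $K_1,\dots,K_m$ such that for each $i\le m$ one has $\chi(K_i)>\kappa$ if and only if $i\le n$. Then $sp_\kappa(C(K))=n$.
   Context: A compact line is a (nonempty) linearly ordered set that is compact in its order topology. $\chi(F)$ denotes the character of a topological space $F$: the supremum over points $x\in F$ of the least cardinality of a base at $x$. $C(K)$ is the Banach space of real-valued continuous functions on $K$ with the supremum norm. For a Banach space $X$ and an infinite cardinal $\kappa$, put $\kappa X=\{x^{**}\in X^{**}: \text{for every } A\subseteq X^* \text{ with } |A|\le\kappa \text{ there is } x\in X \text{ with } x^{**}|A=x|A\}$ (where $X$ is canonically embedded in $X^{**}$); this is a closed subspace of $X^{**}$ containing $X$. The $\kappa$-Semadeni-Pełczyński derivative is the quotient Banach space $\mathcal{SP}_\kappa(X)=\kappa X/X$. Iterates: $\mathcal{SP}_\kappa^{(0)}(X)=X$, $\mathcal{SP}_\kappa^{(1)}(X)=\mathcal{SP}_\kappa(X)$, $\mathcal{SP}_\kappa^{(j+1)}(X)=\mathcal{SP}_\kappa(\mathcal{SP}_\kappa^{(j)}(X))$. The $\kappa$-Semadeni-Pełczyński dimension $sp_\kappa(X)$ is: $-1$ if $X=\{0\}$; $j\in\omega$ if $\mathcal{SP}_\kappa^{(j+1)}(X)=\{0\}$ and $\mathcal{SP}_\kappa^{(j)}(X)\ne\{0\}$; $\infty$ if $\mathcal{SP}_\kappa^{(j)}(X)\neq\{0\}$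 for all $j\in\omega$.
   Formalization: The condition n ≤ m, implicit in ''the first n factors'', is made explicit: for n > m the literal condition only says that all m lines have character > κ, and then the dimension is m, not n. *)

(* Defs.v *)
From HB Require Import structures.
From mathcomp Require Import all_boot all_order all_algebra.
From mathcomp Require Import perm generic_quotient ring_quotient.
From mathcomp Require Import all_classical all_reals all_analysis.
From mathcomp Require Import lra.

Set Implicit Arguments.
Unset Strict Implicit.
Unset Printing Implicit Defensive.

Import Order.TTheory GRing.Theory Num.Theory.
Import numFieldNormedType.Exports.

Local Open Scope classical_set_scope.
Local Open Scope ring_scope.

(* Minimal sublinear functionals are linear; this yields the Hahn-Banach
   theorem in the form [sublinear_support] below. *)
Section hahn_banach.
Context {R : realType} {X : lmodType R}.
Implicit Types (p q : X -> R) (x y : X).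

Definition sublinear p :=
  (forall x y, p (x + y) <= p x + p y) /\
  (forall a x, 0 <= a -> p (a *: x) = a * p x).

Lemma sublinear0 p : sublinear p -> p 0 = 0.
Proof. by case=> _ /(_ 0 0 (lexx _)); rewrite scale0r mul0r. Qed.

Lemma sublinearN p x : sublinear p -> - p (- x) <= p x.
Proof.
move=> sp; have := sp.1 x (- x); rewrite subrr sublinear0// => h.
by lra.
Qed.

Definition slide p x0 x := inf [set p (x + t *: x0) - t * p x0 | t in [set t | 0 <= t]].

Lemma slide_lbound p x0 x t : sublinear p -> 0 <= t ->
  - p (- x) <= p (x + t *: x0) - t * p x0.
Proof.
move=> sp t0; rewrite -sp.2//.
have := sp.1 (x + t *: x0) (- x); rewrite addrAC subrr add0r => h.
by lra.
Qed.

Lemma slide_le p x0 x t : sublinear p -> 0 <= t ->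
  slide p x0 x <= p (x + t *: x0) - t * p x0.
Proof.
move=> sp t0; apply: ge_inf; last by exists t.
by exists (- p (- x)) => _ [s /= s0 <-]; exact: slide_lbound.
Qed.

Lemma slide_ge p x0 x m :
  (forall t, 0 <= t -> m <= p (x + t *: x0) - t * p x0) -> m <= slide p x0 x.
Proof.
move=> h; apply: lb_le_inf; first by exists (p (x + 0 *: x0) - 0 * p x0); exists 0 => //=.
by move=> _ [s /= s0 <-]; exact: h.
Qed.

Lemma slide_sublinear p x0 : sublinear p -> sublinear (slide p x0).
Proof.
move=> sp.
have slideZ a x : 0 < a -> a * slide p x0 x <= slide p x0 (a *: x).
  move=> a0; apply: slide_ge => t t0.
  rewrite mulrC -ler_pdivlMr//.
  have ta0 : 0 <= a^-1 * t by rewrite mulr_ge0// invr_ge0 ltW.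
  apply: le_trans (slide_le _ _ sp ta0) _.
  have -> : a *: x + t *: x0 = a *: (x + (a^-1 * t) *: x0).
    by rewrite scalerDr scalerA mulrA divff ?gt_eqF// mul1r.
  rewrite sp.2 ?(ltW a0)// mulrBl [a * _]mulrC mulfK ?gt_eqF//.
  by rewrite [a^-1 * t]mulrC mulrAC.
split=> [x y|a x].
  rewrite -lerBlDl; apply: slide_ge => t t0; rewrite lerBlDl -lerBlDr.
  apply: slide_ge => s s0; rewrite lerBlDl.
  have := slide_le x0 (x + y) sp (addr_ge0 s0 t0).
  have := sp.1 (x + s *: x0) (y + t *: x0).
  by rewrite addrACA -scalerDl mulrDl; lra.
rewrite le_eqVlt => /predU1P[<-|a0].
  rewrite scale0r mul0r; apply/eqP; rewrite eq_le; apply/andP; split.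
    by have := slide_le x0 0 sp (lexx 0); rewrite scale0r addr0 (sublinear0 sp) mul0r subr0.
  apply: slide_ge => t t0; rewrite add0r sp.2// subrr//.
apply/eqP; rewrite eq_le slideZ// andbT.
have ai0 : 0 < a^-1 by rewrite invr_gt0.
have := slideZ _ (a *: x) ai0; rewrite scalerA mulVf ?gt_eqF// scale1r.
by rewrite ler_pdivrMl.
Qed.

Lemma slide_id p x0 x : sublinear p -> slide p x0 x <= p x.
Proof.
by move=> sp; have := slide_le x0 x sp (lexx 0); rewrite scale0r mul0r addr0 subr0.
Qed.

Lemma minimal_sublinear p : sublinear p ->
  exists q, [/\ sublinear q, (forall x, q x <= p x) &
    forall r, sublinear r -> (forall x, r x <= q x) -> r = q].
Proof.
move=> sp; pose T := {q : X -> R | sublinear q /\ forall x, q x <= p x}.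
pose Rl (q r : T) := `[< forall x, sval r x <= sval q x >].
have [| | | |[q [sq qp]] qmin] := @Zorn T Rl.
- by move=> t; apply/asboolP.
- move=> r s t /asboolP rs /asboolP st; apply/asboolP => x.
  exact: le_trans (st x) (rs x).
- move=> [s hs] [t ht] /asboolP /= st /asboolP /= ts; apply: eq_exist.
  by apply/funext => x; apply/eqP; rewrite eq_le st ts.
- move=> A totA.
  have [[a Aa]|A0] := pselect (exists a, A a); last first.
    exists (exist _ p (conj sp (fun x => lexx _))) => s As.
    by exfalso; apply: A0; exists s.
  pose m x := inf [set sval s x | s in A].
  have lb (s : T) x : A s -> - p (- x) <= sval s x.
    move=> As; have [ss sle] := svalP s; apply: le_trans (sublinearN _ ss).
    by rewrite lerN2.
  have mle s x : A s -> m x <= sval s x.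
    move=> As; apply: ge_inf; last by exists s.
    by exists (- p (- x)) => _ [t At <-]; exact: lb.
  have mge x c : (forall s, A s -> c <= sval s x) -> c <= m x.
    move=> h; apply: lb_le_inf; first by exists (sval a x); exists a.
    by move=> _ [t At <-]; exact: h.
  have mp x : m x <= p x by apply: le_trans (mle _ _ Aa) _; have [_ ->] := svalP a.
  have sm : sublinear m.
    split=> [x y|c x c0].
      rewrite -lerBlDl; apply: (mge) => s As; rewrite lerBlDl -lerBlDr.
      apply: (mge) => t At; rewrite lerBlDl [leRHS]addrC.
      have [/asboolP st|/asboolP ts] := totA _ _ As At.
        apply: le_trans (mle _ _ At) _; have [[+ _] _] := svalP t => /(_ x y).
        by move=> /le_trans; apply; rewrite lerD2l// st.
      apply: le_trans (mle _ _ As) _; have [[+ _] _] := svalP s => /(_ x y).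
      by move=> /le_trans; apply; rewrite lerD2r// ts.
    move: c0; rewrite le_eqVlt => /orP[/eqP<-|c0].
      rewrite scale0r mul0r; apply/eqP; rewrite eq_le; apply/andP; split.
        by apply: le_trans (mle _ _ Aa) _; have [/sublinear0->] := svalP a.
      by apply: (mge) => s As; have [/sublinear0->] := svalP s.
    apply/eqP; rewrite eq_le; apply/andP; split.
      rewrite -ler_pdivrMl//; apply: (mge) => s As; rewrite ler_pdivrMl//.
      by rewrite -(svalP s).1.2 ?mle// ltW.
    apply: (mge) => s As; by rewrite (svalP s).1.2 ?ler_pM2l ?mle// ltW.
  exists (exist _ m (conj sm mp)) => s As; apply/asboolP => x /=; exact: mle.
exists q; split=> // r sr rq.
have rp x : r x <= p x := le_trans (rq x) (qp x).
by have /(_ _)/(congr1 sval) := qmin (exist _ r (conj sr rp)); apply; apply/asboolP.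
Qed.

Lemma sublinear_support p x0 : sublinear p ->
  exists f : X -> R^o, [/\ linear f, (forall x, f x <= p x) & f x0 = p x0].
Proof.
move=> sp.
have [q [sq qle qmin]] := minimal_sublinear (slide_sublinear x0 sp).
have qD x y : q (x + y) = q x + q y.
  apply/eqP; rewrite eq_le sq.1/=.
  have <- : slide q y = q.
    by apply: qmin; [exact: slide_sublinear|move=> z; exact: slide_id].
  rewrite -lerBrDr; apply: le_trans (slide_le y x sq ler01) _.
  have -> : slide q y = q.
    by apply: qmin; [exact: slide_sublinear|move=> z; exact: slide_id].
  by rewrite scale1r mul1r.
have qN x : q (- x) = - q x.
  by apply/eqP; rewrite -addr_eq0 -qD addNr sublinear0.
have qp x : q x <= p x := le_trans (qle x) (slide_id x0 x sp).
have qZ a x : q (a *: x) = a * q x.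
  have [a0|a0] := leP 0 a; first exact: sq.2.
  by rewrite -[LHS]opprK -qN -scaleNr sq.2 ?oppr_ge0 ?ltW// mulNr opprK.
exists q; split=> [a x y||]; [by rewrite qD qZ|exact: qp|].
apply/eqP; rewrite eq_le qp/=.
have := le_trans (qle (- x0)) (slide_le x0 (- x0) sp ler01).
by rewrite qN scale1r mul1r addNr sublinear0// add0r lerN2.
Qed.

End hahn_banach.

(* Completeness tested on rapidly convergent sequences. *)
Section fast_sequences.
Context {R : realType} {V : normedModType R}.
Implicit Types (u : nat -> V) (l : V).

Definition fast u := forall n, `|u n.+1 - u n| <= 2^-1 ^+ n.

Lemma fast_dist u n k : fast u -> `|u (n + k)%N - u n| <= 2 * 2^-1 ^+ n.
Proof.
move=> fu; suff : `|u (n + k)%N - u n| <= 2 * (2^-1 ^+ n - 2^-1 ^+ (n + k)).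
  move=> /le_trans; apply; rewrite ler_pM2l// gerBl.
  by rewrite exprn_ge0// invr_ge0.
elim: k => [|k ih]; first by rewrite addn0 !subrr normr0 mulr0.
rewrite -(subrKA (u (n + k)%N)); apply: le_trans (ler_normD _ _) _.
rewrite addnS; have := fu (n + k)%N; rewrite exprS.
move: (2^-1 ^+ (n + k)) ih => z; move: (2^-1 ^+ n) => w h1 h2.
by lra.
Qed.

Lemma half_small (e : R) : 0 < e -> exists n, 2 * 2^-1 ^+ n < e.
Proof.
move=> e0.
have : (2^-1 : R) ^+ n @[n --> \oo] --> (0 : R).
  by apply: cvg_expr; rewrite ger0_norm ?invr_ge0// invf_lt1// ltr1n.
have e20 : 0 < e / 2 by rewrite divr_gt0.
move=> /cvgrPdist_lt /(_ _ e20)[N _ /(_ _ (leqnn N))].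
rewrite /= sub0r normrN ger0_norm ?exprn_ge0 ?invr_ge0// => h.
by exists N; rewrite mulrC -ltr_pdivlMr.
Qed.

Lemma fast_lim u l n : fast u -> u @ \oo --> l -> `|l - u n| <= 2 * 2^-1 ^+ n.
Proof.
move=> fu ul; apply/ler_addgt0Pl => e e0.
move: ul => /cvgrPdist_lt /(_ _ e0)[N _ /(_ (n + N)%N)] /=.
rewrite leq_addl => /(_ isT) h.
rewrite -(subrKA (u (n + N)%N)) (le_trans (ler_normD _ _))//.
by rewrite lerD// ?fast_dist// ltW.
Qed.

Lemma fast_complete : (forall u, fast u -> cvgn u) ->
  forall F : set_system V, ProperFilter F -> cauchy F -> cvg F.
Proof.
move=> h F FF /cauchyP cF.
have hp n : (0 : R) < 2^-1 ^+ n.+2 by rewrite exprn_gt0// invr_gt0.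
have {cF} [x xF] := choice (fun n => cF _ (hp n)).
have /h /cvg_ex[l /= xl] : fast x.
  move=> n; have [y []] := @filter_ex _ F _ _ (@filterI _ F _ _ _ (xF n) (xF n.+1)).
  rewrite -!ball_normE /= => h1 h2.
  rewrite -(subrKA y) (le_trans (ler_normD _ _))//.
  rewrite [`|y - _|]distrC; move: h1 h2; rewrite !exprS.
  have : (0 : R) <= 2^-1 ^+ n by rewrite exprn_ge0// invr_ge0.
  by move: (2^-1 ^+ n) => w; lra.
apply/cvg_ex; exists l; apply/cvgrPdist_lt => e e0.
have e20 : 0 < e / 2 by rewrite divr_gt0.
have [n hn] := half_small e20.
move: xl => /cvgrPdist_lt /(_ _ e20)[N _ /(_ (n + N)%N)] /=.
rewrite leq_addl => /(_ isT) h1.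
apply: filterS (xF (n + N)%N) => y; rewrite -ball_normE/= => h2.
rewrite -(subrKA (x (n + N)%N)) (le_lt_trans (ler_normD _ _))//.
rewrite [e]splitr ltrD// (lt_trans h2)// (le_lt_trans _ hn)//.
rewrite -[leLHS]mul1r ler_pM ?exprn_ge0 ?invr_ge0// ?ler1n//.
by rewrite ler_wiXn2l ?invr_ge0// ?invf_le1 ?ler1n// -addn2 -addnA leq_addr.
Qed.

End fast_sequences.

Lemma fast_cvg {R : realType} {V : completeNormedModType R} (u : nat -> V) :
  fast u -> cvgn u.
Proof.
move=> fu; apply: cauchy_cvg; apply: cauchy_exP => e e0.
have [n hn] := half_small e0; exists (u n); exists n => // m /= nm.
rewrite -ball_normE /= distrC (le_lt_trans _ hn)//.
by rewrite -(subnKC nm) fast_dist.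
Qed.

(* The supremum of |f| over a set; it is 0 on the empty set. *)
Section sup_norm.
Context {R : realType} {I : Type} (S : set I).
Implicit Types f g : I -> R.

Definition supnorm f := sup [set `|f i| | i in S].

Definition bounded_on f := exists M, forall i, S i -> `|f i| <= M.

Lemma supnorm_ub f i : bounded_on f -> S i -> `|f i| <= supnorm f.
Proof.
move=> [M fM] Si; apply: ub_le_sup; last by exists i.
by exists M => _ [j Sj <-]; exact: fM.
Qed.

Lemma supnorm_le f M : 0 <= M -> (forall i, S i -> `|f i| <= M) -> supnorm f <= M.
Proof.
move=> M0 fM; rewrite /supnorm.
have [->|/set0P S0] := eqVneq [set `|f i| | i in S] set0; first by rewrite sup0.
by apply: ge_sup => // _ [i Si <-]; exact: fM.
Qed.

Lemma supnorm_ge0 f : bounded_on f -> 0 <= supnorm f.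
Proof.
move=> bf; have [[i Si]|S0] := pselect (exists i, S i).
  exact: le_trans (normr_ge0 (f i)) (supnorm_ub bf Si).
rewrite /supnorm (_ : [set _ | _ in _] = set0) ?sup0//.
by apply/seteqP; split=> // x [i Si _]; case: S0; exists i.
Qed.

Lemma supnormD f g : bounded_on f -> bounded_on g ->
  supnorm (f \+ g) <= supnorm f + supnorm g.
Proof.
move=> bf bg; apply: supnorm_le; first by rewrite addr_ge0// supnorm_ge0.
move=> i Si; rewrite (le_trans (ler_normD _ _))//.
by rewrite lerD// supnorm_ub.
Qed.

Lemma supnormZ a f : bounded_on f -> supnorm (fun i => a * f i) = `|a| * supnorm f.
Proof.
move=> bf.
have le b g : bounded_on g -> supnorm (fun i => b * g i) <= `|b| * supnorm g.
  move=> bg; apply: supnorm_le; first by rewrite mulr_ge0// supnorm_ge0.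
  by move=> i Si; rewrite normrM ler_wpM2l// supnorm_ub.
apply/eqP; rewrite eq_le le//=.
have [->|a0] := eqVneq a 0.
  rewrite normr0 mul0r supnorm_ge0//; exists 0 => i _.
  by rewrite mul0r normr0.
have baf : bounded_on (fun i => a * f i).
  move: bf => [M fM]; exists (`|a| * M) => i Si.
  by rewrite normrM ler_wpM2l// fM.
rewrite -ler_pdivlMl ?normr_gt0//.
apply: le_trans (le_trans (le a^-1 _ baf) _); last by rewrite normfV.
by under [X in _ <= supnorm X]eq_fun do rewrite mulKf//.
Qed.

End sup_norm.

(* The dual space, with the norm sup {|f x| : |x| <= 1}. *)
Section dual.
Context {R : realType} (X : normedModType R).
Implicit Types (x y : X).

Definition dual_pred : {pred X -> R^o} := fun f => `[< linear f /\ continuous f >].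

Lemma dual_pred_closed : submod_closed dual_pred.
Proof.
split=> [|a f g /asboolP[lf cf] /asboolP[lg cg]]; apply/asboolP; split.
- by move=> a x y; rewrite /= scaler0 addr0.
- exact: cst_continuous.
- move=> b x y; rewrite !fctE lf lg !scalerDr !scalerA [a * b]mulrC.
  by rewrite addrACA.
- by move=> x; apply: cvgD; [apply: cvgZr; exact: cf|exact: cg].
Qed.

HB.instance Definition _ :=
  GRing.isSubmodClosed.Build R (X -> R^o) dual_pred dual_pred_closed.

Record dual := Dual { dual_fun :> X -> R^o ; _ : dual_fun \in dual_pred }.

HB.instance Definition _ := [isSub for dual_fun].
HB.instance Definition _ := [Choice of dual by <:].
HB.instance Definition _ := [SubChoice_isSubLmodule of dual by <:].

Implicit Types f g : dual.

Lemma dual_linear f : linear f.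
Proof. by case: f => f /= /asboolP[]. Qed.

Lemma dual_continuous f : continuous f.
Proof. by case: f => f /= /asboolP[]. Qed.

HB.instance Definition _ f := GRing.isLinear.Build R X R^o _ f (dual_linear f).

Lemma dual_ext f g : f =1 g -> f = g.
Proof. by move=> fg; apply/val_inj/funext. Qed.

Lemma dualD f g x : (f + g) x = f x + g x. Proof. by []. Qed.
Lemma dualN f x : (- f) x = - f x. Proof. by []. Qed.
Lemma dualB f g x : (f - g) x = f x - g x. Proof. by []. Qed.
Lemma dualZ a f x : (a *: f) x = a * f x. Proof. by []. Qed.
Lemma dual0 x : (0 : dual) x = 0. Proof. by []. Qed.

Let unit_ball := [set x : X | `|x| <= 1].

Lemma dual_bounded f : bounded_on unit_ball f.
Proof.
have /cvgrPdist_lt /(_ 1 ltr01) := @dual_continuous f 0.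
rewrite linear0 => /nbhs_ballP[d /= d0 fd].
have d20 : 0 < d / 2 by rewrite divr_gt0.
exists (2 / d) => x x1; rewrite /= in x1.
have := fd ((d / 2) *: x); rewrite -ball_normE /= !sub0r !normrN normrZ.
rewrite (gtr0_norm d20) linearZ/= normrM (gtr0_norm d20) => h.
suff : d / 2 * `|f x| < 1.
  move=> /ltW; rewrite -ler_pdivlMl// invf_div mulr1 => /le_trans; apply.
  by [].
by apply: h; rewrite (@le_lt_trans _ _ (d / 2))//; [rewrite ler_piMr// ltW|lra].
Qed.

Definition dual_norm f := supnorm unit_ball f.

Lemma dual_norm_ub f x : `|f x| <= dual_norm f * `|x|.
Proof.
have [->|x0] := eqVneq x 0; first by rewrite linear0 !normr0 mulr0.
rewrite -ler_pdivrMr ?normr_gt0// mulrC.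
have := @supnorm_ub _ _ unit_ball f (`|x|^-1 *: x) (dual_bounded f).
rewrite linearZ/= normrM normfV normr_id; apply.
by rewrite /unit_ball/= normrZ normfV normr_id mulVf// normr_eq0.
Qed.

Lemma dual_normD f g : dual_norm (f + g) <= dual_norm f + dual_norm g.
Proof. exact/supnormD/dual_bounded/dual_bounded. Qed.

Lemma dual_normZ a f : dual_norm (a *: f) = `|a| * dual_norm f.
Proof. exact/supnormZ/dual_bounded. Qed.

Lemma dual_norm0_eq0 f : dual_norm f = 0 -> f = 0.
Proof.
move=> f0; apply/dual_ext => x; apply/normr0_eq0/eqP.
by rewrite eq_le normr_ge0 andbT (le_trans (dual_norm_ub _ _))// f0 mul0r.
Qed.

HB.instance Definition _ :=
  Lmodule_isNormed.Build R dual dual_normD dual_normZ dual_norm0_eq0.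

Lemma dual_ub f x : `|f x| <= `|f| * `|x|.
Proof. exact: dual_norm_ub. Qed.

Lemma dual_norm_le f (M : R) : 0 <= M -> (forall x, `|f x| <= M * `|x|) -> `|f| <= M.
Proof.
move=> M0 fM; apply: supnorm_le => // x x1.
by rewrite (le_trans (fM x))// ler_piMr.
Qed.

Lemma dual_mk (f : X -> R^o) (M : R) : linear f -> (forall x, `|f x| <= M * `|x|) ->
  {g : dual | g = f :> (X -> R^o)}.
Proof.
move=> lf fM; suff fP : f \in dual_pred by exists (Dual fP).
have fB x y : f (x - y) = f x - f y.
  by rewrite addrC -scaleN1r lf scaleN1r addrC.
apply/asboolP; split=> // x; apply/cvgrPdist_lt => e e0.
have M1 : 0 < `|M| + 1 by rewrite ltr_wpDl.
apply/nbhs_normP; exists (e / (`|M| + 1)); first by rewrite /= divr_gt0.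
move=> y /=; rewrite ltr_pdivlMr// => h; rewrite -fB.
rewrite (le_lt_trans (fM _))// (le_lt_trans _ h)// mulrC ler_wpM2l//.
by rewrite (le_trans (ler_norm _))// lerDl.
Qed.

Lemma dual_complete (F : set_system dual) : ProperFilter F -> cauchy F -> cvg F.
Proof.
apply: fast_complete => u fu.
have cu x : cvgn (fun n => u n x : R).
  apply: cauchy_cvg; apply: cauchy_exP => e e0.
  have ex : 0 < e / (`|x| + 1) by rewrite divr_gt0// ltr_wpDl.
  have [n hn] := half_small ex; exists (u n x); exists n => // m /= nm.
  rewrite -ball_normE /= -dualB.
  rewrite (le_lt_trans (dual_ub _ _))//.
  move: hn; rewrite ltr_pdivlMr ?ltr_wpDl// => /(le_lt_trans _); apply.
  rewrite ler_pM ?lerDl// distrC -(subnKC nm); exact: fast_dist.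
have [g ug] := choice (fun x => iffLR (cvg_ex _) (cu x)).
have ug' x n : `|g x - u n x| <= 2 * 2^-1 ^+ n * `|x|.
  apply/ler_addgt0Pl => e e0.
  move: (ug x) => /cvgrPdist_lt /(_ _ e0)[N _ /(_ (n + N)%N)] /=.
  rewrite leq_addl => /(_ isT) h.
  rewrite -(subrKA (u (n + N)%N x)) (le_trans (ler_normD _ _))//.
  rewrite lerD// ?(ltW h)// -dualB (le_trans (dual_ub _ _))// ler_wpM2r//.
  exact: fast_dist.
have lg : linear (g : X -> R^o).
  move=> a x y.
  have : a * u n x + u n y @[n --> \oo] --> a * g x + g y.
    by apply: cvgD; [apply: cvgZr; exact: ug|exact: ug].
  under eq_fun do rewrite -[_ * _]/(_ *: _) -dual_linear.
  move=> h; exact: (cvg_unique _ (ug (a *: x + y)) h).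
have gM x : `|g x| <= (`|u 0%N| + 2) * `|x|.
  rewrite -(subrK (u 0%N x) (g x)) (le_trans (ler_normD _ _))// addrC mulrDl.
  by rewrite lerD ?dual_ub// (le_trans (ug' _ _))// expr0 mulr1.
have [G GE] := dual_mk lg gM.
apply/cvg_ex; exists G; apply/cvgrPdist_lt => e e0.
have [n hn] := half_small e0; exists n => // m /= nm.
rewrite (le_lt_trans _ hn)//; apply: dual_norm_le.
  by rewrite mulr_ge0// exprn_ge0// invr_ge0.
move=> x; rewrite dualB GE (le_trans (ug' _ _))// ler_wpM2r// ler_wpM2l//.
by rewrite ler_wiXn2l ?invr_ge0// ?invf_le1 ?ler1n.
Qed.

HB.instance Definition _ := Uniform_isComplete.Build dual dual_complete.

End dual.

(* The space C(T) of a compact space T, with the supremum norm. *)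
Section continuous_functions.
Context (R : realType) (T : topologicalType) (cT : compact [set: T]).

Definition continuous_pred : {pred T -> R^o} := fun f => `[< continuous f >].

Lemma continuous_pred_closed : submod_closed continuous_pred.
Proof.
split=> [|a f g /asboolP cf /asboolP cg]; apply/asboolP.
  exact: cst_continuous.
by move=> x; apply: cvgD; [apply: cvgZr; exact: cf|exact: cg].
Qed.

HB.instance Definition _ := GRing.isSubmodClosed.Build R (T -> R^o)
  continuous_pred continuous_pred_closed.

Record contfun := ContFun {
  contfun_fun :> T -> R^o ; _ : contfun_fun \in continuous_pred }.

HB.instance Definition _ := [isSub for contfun_fun].
HB.instance Definition _ := [Choice of contfun by <:].
HB.instance Definition _ := [SubChoice_isSubLmodule of contfun by <:].

(* [cT] is a parameter so that the norm below is defined. *)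
Definition Cspace : Type := let _ := cT in contfun.
HB.instance Definition _ := GRing.Lmodule.on Cspace.

Definition Cspace_fun (f : Cspace) : T -> R^o := contfun_fun f.
Coercion Cspace_fun : Cspace >-> Funclass.
Implicit Types f g : Cspace.

Lemma Cspace_continuous f : continuous f.
Proof. by case: f => f /= /asboolP. Qed.

Lemma Cspace_bounded f : bounded_on setT f.
Proof.
have /compact_bounded[M [_ /(_ (M + 1))]] : compact (f @` setT).
  by apply: continuous_compact => //; apply: continuous_subspaceT; exact: Cspace_continuous.
rewrite ltrDl ltr01 => /(_ isT) h; exists (M + 1) => x _.
by apply: h; exists x.
Qed.

Definition Cspace_norm f := supnorm setT f.

Lemma Cspace_normD f g : Cspace_norm (f + g) <= Cspace_norm f + Cspace_norm g.
Proof. exact/supnormD/Cspace_bounded/Cspace_bounded. Qed.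

Lemma Cspace_normZ a f : Cspace_norm (a *: f) = `|a| * Cspace_norm f.
Proof. exact/supnormZ/Cspace_bounded. Qed.

Lemma Cspace_norm0_eq0 f : Cspace_norm f = 0 -> f = 0.
Proof.
move=> f0; apply/val_inj/funext => x; apply/normr0_eq0/eqP.
rewrite eq_le normr_ge0 andbT -f0; exact/supnorm_ub/I/Cspace_bounded.
Qed.

HB.instance Definition _ :=
  Lmodule_isNormed.Build R Cspace Cspace_normD Cspace_normZ Cspace_norm0_eq0.

Lemma Cspace_ub f x : `|f x| <= `|f|.
Proof. exact/supnorm_ub/I/Cspace_bounded. Qed.

Lemma Cspace_complete (F : set_system Cspace) : ProperFilter F -> cauchy F -> cvg F.
Proof.
apply: fast_complete => u fu.
have cu x : cvgn (fun n => u n x : R).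
  apply: cauchy_cvg; apply: cauchy_exP => e e0.
  have [n hn] := half_small e0; exists (u n x); exists n => // m /= nm.
  rewrite -ball_normE /= (le_lt_trans _ hn)//.
  apply: le_trans (Cspace_ub (u n - u m) x) _.
  rewrite distrC -(subnKC nm); exact: fast_dist.
have [g ug] := choice (fun x => iffLR (cvg_ex _) (cu x)).
have ug' x n : `|g x - u n x| <= 2 * 2^-1 ^+ n.
  apply/ler_addgt0Pl => e e0.
  move: (ug x) => /cvgrPdist_lt /(_ _ e0)[N _ /(_ (n + N)%N)] /=.
  rewrite leq_addl => /(_ isT) h.
  rewrite -(subrKA (u (n + N)%N x)) (le_trans (ler_normD _ _))//.
  rewrite lerD// ?(ltW h)//.
  apply: le_trans (Cspace_ub (u (n + N)%N - u n) x) _; exact: fast_dist.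
have gP : (g : T -> R^o) \in continuous_pred.
  apply/asboolP => x; apply/cvgrPdist_lt => e e0.
  have e30 : 0 < e / 3 by rewrite divr_gt0.
  have [n hn] := half_small e30.
  have /cvgrPdist_lt /(_ _ e30) := @Cspace_continuous (u n) x.
  apply: filterS => y h.
  have h1 := le_lt_trans (ug' x n) hn; have h2 := le_lt_trans (ug' y n) hn.
  rewrite distrC in h2.
  rewrite -(subrKA (u n x)) (le_lt_trans (ler_normD _ _))//.
  rewrite -(subrKA (u n y) (u n x)).
  have := ler_normD (u n x - u n y : R) (u n y - g y); lra.
apply/cvg_ex; exists (ContFun gP : Cspace); apply/cvgrPdist_lt => e e0.
have [n hn] := half_small e0; exists n => // m /= nm.
rewrite (le_lt_trans _ hn)//; apply: supnorm_le.
  by rewrite mulr_ge0// exprn_ge0// invr_ge0.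
move=> x _; apply: le_trans (ug' x m) _; rewrite ler_wpM2l//.
by rewrite ler_wiXn2l ?invr_ge0// ?invf_le1 ?ler1n.
Qed.

HB.instance Definition _ := Uniform_isComplete.Build Cspace Cspace_complete.

End continuous_functions.

(* Closed linear subspaces, as normed spaces and as kernels of quotients. *)
Section closed_submodule.
Context {R : realType} (V : normedModType R).

Record closedSubmod := ClosedSubmod {
  csub_set :> set V ;
  csub0 : csub_set 0 ;
  csub_linear : forall a x y, csub_set x -> csub_set y -> csub_set (a *: x + y) ;
  csub_closed : closed csub_set }.

Variable S : closedSubmod.

Definition csub_pred : {pred V} := mem (csub_set S).

Lemma csub_pred_closed : submod_closed csub_pred.
Proof.
split=> [|a x y]; rewrite !inE; first exact: csub0.
exact: csub_linear.
Qed.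

HB.instance Definition _ := GRing.isSubmodClosed.Build R V csub_pred csub_pred_closed.

Record csub := Csub { csub_val : V ; _ : csub_val \in csub_pred }.

HB.instance Definition _ := [isSub for csub_val].
HB.instance Definition _ := [Choice of csub by <:].
HB.instance Definition _ := [SubChoice_isSubLmodule of csub by <:].

Lemma csub_valP (x : csub) : csub_set S (csub_val x).
Proof. by have := valP x; rewrite inE. Qed.

Definition csub_norm (x : csub) := `|csub_val x|.

Lemma csub_normD x y : csub_norm (x + y) <= csub_norm x + csub_norm y.
Proof. exact: ler_normD. Qed.

Lemma csub_normZ a x : csub_norm (a *: x) = `|a| * csub_norm x.
Proof. exact: normrZ. Qed.

Lemma csub_norm0_eq0 x : csub_norm x = 0 -> x = 0.
Proof. by move=> /normr0_eq0 h; exact: val_inj. Qed.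

HB.instance Definition _ :=
  Lmodule_isNormed.Build R csub csub_normD csub_normZ csub_norm0_eq0.

Lemma csub_normE (x : csub) : `|x| = `|csub_val x|. Proof. by []. Qed.

Lemma csub_cvg (u : nat -> csub) (l : csub) :
  (csub_val (u n) @[n --> \oo] --> csub_val l) -> u @ \oo --> l.
Proof.
move=> ul; apply/cvgrPdist_lt => e e0.
by move: ul => /cvgrPdist_lt /(_ _ e0).
Qed.

(* The quotient V / S, with the norm inf {|x| : x in the coset}. *)
Definition quotspace : Type := Quotient.quot csub_pred.
HB.instance Definition _ := GRing.Zmodule.on quotspace.

Definition qproj (x : V) : quotspace := (\pi_(Quotient.quot csub_pred) x)%qT.

Lemma qprojP (q : quotspace) : exists x, qproj x = q.
Proof. by exists (repr q); exact: reprK. Qed.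

Lemma qproj_eq (x y : V) : qproj x = qproj y <-> csub_set S (x - y).
Proof.
have E : (x - y \in csub_pred) = (qproj x == qproj y) := Quotient.idealrBE csub_pred x y.
split; first by move=> /eqP; rewrite -E inE.
by move=> h; apply/eqP; rewrite -E inE.
Qed.

Lemma qprojD x y : qproj (x + y) = qproj x + qproj y.
Proof. exact: (Quotient.pi_add csub_pred). Qed.

Definition qscale (a : R) (q : quotspace) : quotspace := qproj (a *: repr q).

Lemma qscaleE a x : qscale a (qproj x) = qproj (a *: x).
Proof.
apply/qproj_eq; rewrite -scalerBr -[_ *: _]addr0.
apply: csub_linear; last exact: csub0.
by apply/qproj_eq; exact: reprK.
Qed.

Let qscaleA a b q : qscale a (qscale b q) = qscale (a * b) q.
Proof. by have [x <-] := qprojP q; rewrite !qscaleE scalerA. Qed.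

Let qscale1 : left_id 1 qscale.
Proof. by move=> q; have [x <-] := qprojP q; rewrite !qscaleE scale1r. Qed.

Let qscaleDr : right_distributive qscale +%R.
Proof.
move=> a q r; have [x <-] := qprojP q; have [y <-] := qprojP r.
by rewrite -qprojD !qscaleE scalerDr qprojD.
Qed.

Let qscaleDl q : {morph qscale^~ q : a b / a + b}.
Proof. by move=> a b; have [x <-] := qprojP q; rewrite !qscaleE scalerDl qprojD. Qed.

HB.instance Definition _ :=
  GRing.Zmodule_isLmodule.Build R quotspace qscaleA qscale1 qscaleDr qscaleDl.

Lemma qproj_linear : linear qproj.
Proof. by move=> a x y; rewrite qprojD -qscaleE. Qed.

HB.instance Definition _ := GRing.isLinear.Build R V quotspace _ qproj qproj_linear.

Definition quot_norm (q : quotspace) := inf [set `|x| | x in [set x | qproj x = q]].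

Lemma quot_norm_le x : quot_norm (qproj x) <= `|x|.
Proof. by apply: ge_inf; [exists 0 => _ [y _ <-]|exists x]. Qed.

Lemma quot_norm_ge q m : (forall x, qproj x = q -> m <= `|x|) -> m <= quot_norm q.
Proof.
move=> h; apply: lb_le_inf; last by move=> _ [x qx <-]; exact: h.
by have [x qx] := qprojP q; exists `|x|; exists x.
Qed.

Lemma quot_norm_lt q m : quot_norm q < m -> exists2 x, qproj x = q & `|x| < m.
Proof.
move=> qm; apply: contrapT => h.
have : m <= quot_norm q.
  apply: quot_norm_ge => x qx; rewrite leNgt; apply/negP => xm; apply: h.
  by exists x.
by rewrite leNgt qm.
Qed.

Lemma quot_normD q r : quot_norm (q + r) <= quot_norm q + quot_norm r.
Proof.
rewrite -lerBlDr; apply: quot_norm_ge => x <-; rewrite lerBlDr -lerBlDl.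
apply: quot_norm_ge => y <-; rewrite lerBlDl -qprojD.
exact: le_trans (quot_norm_le _) (ler_normD _ _).
Qed.

Lemma quot_normZ a q : quot_norm (a *: q) = `|a| * quot_norm q.
Proof.
have le b r : quot_norm (b *: r) <= `|b| * quot_norm r.
  have [->|b0] := eqVneq b 0.
    by rewrite normr0 mul0r scale0r -(linear0 qproj) (le_trans (quot_norm_le _))// normr0.
  rewrite -ler_pdivrMl ?normr_gt0//; apply: quot_norm_ge => x <-.
  by rewrite ler_pdivrMl ?normr_gt0// -linearZ/= -normrZ quot_norm_le.
apply/eqP; rewrite eq_le le/=.
have [->|a0] := eqVneq a 0.
  by rewrite normr0 mul0r; apply: quot_norm_ge => x.
rewrite -ler_pdivlMl ?normr_gt0// -normfV.
by apply: le_trans (le _ _); rewrite scalerA mulVf// scale1r.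
Qed.

Lemma quot_norm0_eq0 q : quot_norm q = 0 -> q = 0.
Proof.
have [x <-] := qprojP q; rewrite -(linear0 qproj) => x0.
apply/qproj_eq; rewrite subr0; apply: csub_closed => B /nbhs_normP[e /= e0 eB].
have [y yx ye] : exists2 y, qproj y = qproj x & `|y| < e.
  by apply: quot_norm_lt; rewrite x0.
exists (x - y); split; first exact/qproj_eq.
by apply: eB => /=; rewrite opprB addrC subrK.
Qed.

HB.instance Definition _ :=
  Lmodule_isNormed.Build R quotspace quot_normD quot_normZ quot_norm0_eq0.

Lemma qproj_le x : `|qproj x| <= `|x|. Proof. exact: quot_norm_le. Qed.

End closed_submodule.

Section closed_submodule_complete.
Context {R : realType} (V : completeNormedModType R) (S : closedSubmod V).

Lemma csub_complete (F : set_system (csub S)) : ProperFilter F -> cauchy F -> cvg F.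
Proof.
apply: fast_complete => u fu.
have /fast_cvg/cvg_ex[/= l ul] : fast (fun n => csub_val (u n)) by [].
have lS : l \in csub_pred S.
  rewrite inE /=; apply: (@closed_cvg _ _ _ _ (fun n => csub_val (u n)) _ (@csub_closed _ _ S) _ l ul).
  by apply: nearW => n; exact: csub_valP.
by apply/cvg_ex; exists (Csub lS); exact: csub_cvg.
Qed.

HB.instance Definition _ := Uniform_isComplete.Build (csub S) csub_complete.

Lemma quotspace_complete (F : set_system (quotspace S)) :
  ProperFilter F -> cauchy F -> cvg F.
Proof.
apply: fast_complete => u fu.
have [x0 xu0] := qprojP (u 0%N).
have [d dP] : {d : nat -> V & forall n, qproj S (d n) = u n.+1 - u n /\
    `|d n| < 2 * 2^-1 ^+ n}.
  apply: (@choice _ _ (fun n x => qproj S x = u n.+1 - u n /\ `|x| < 2 * 2^-1 ^+ n)).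
  move=> n; have [|x xu xn] := @quot_norm_lt _ _ S (u n.+1 - u n) (2 * 2^-1 ^+ n).
    apply: le_lt_trans (fu n) _.
    by rewrite ltr_pMl ?exprn_gt0 ?invr_gt0// ltr1n.
  by exists x.
pose x n := x0 + \sum_(i < n) d i.
have xS n : x n.+1 = x n + d n by rewrite /x big_ord_recr/= addrA.
have xu n : qproj S (x n) = u n.
  elim: n => [|n ih]; first by rewrite /x big_ord0 addr0.
  by rewrite xS linearD/= ih (dP n).1 addrC subrK.
have /fast_cvg/cvg_ex[/= l xl] : fast (fun n => x n.+1).
  move=> n; rewrite [x n.+2]xS addrC addKr (le_trans (ltW (dP _).2))//.
  by rewrite exprS mulrA divff// mul1r.
apply/cvg_ex; exists (qproj S l); apply/cvgrPdist_lt => e e0.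
move: xl => /cvgrPdist_lt /(_ _ e0)[N _ h]; exists N.+1 => // -[//|n] /= Nn.
by rewrite -xu -linearB (le_lt_trans (qproj_le _ _))// h.
Qed.

HB.instance Definition _ :=
  Uniform_isComplete.Build (quotspace S) quotspace_complete.

End closed_submodule_complete.

Lemma card_leU1 (kappa : Type) T (A : set T) (a : T) :
  infinite_set [set: kappa] -> (A #<= [set: kappa])%card ->
  (A `|` [set a] #<= [set: kappa])%card.
Proof.
elim/Ppointed: kappa => kappa; first by rewrite emptyE_subdef => /(_ (finite_set0 _)).
move=> /infiniteP/pcard_injP[g gI] /pcard_injP[f fI].
have {}gI i j : g i = g j -> i = j by apply: gI; rewrite inE.
pose shift k := if pselect (exists i, k = g i) is left h then g (sval (cid h)).+1 else k.
have shiftg i : shift (g i) = g i.+1.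
  rewrite /shift; case: pselect => [h|[]]; last by exists i.
  by case: cid => j /= e; rewrite (gI _ _ e).
have shiftN k : (forall i, k <> g i) -> shift k = k.
  by move=> kg; rewrite /shift; case: pselect => // h; have [i /kg] := h.
have shiftI : injective shift.
  move=> k l.
  have [[i ->]|ki] := pselect (exists i, k = g i);
  have [[j ->]|lj] := pselect (exists j, l = g j).
  - by rewrite !shiftg => /gI[->].
  - rewrite shiftg shiftN => [le|i' lE]; last by apply: lj; exists i'.
    by case: lj; exists i.+1.
  - rewrite shiftg shiftN => [ke|i' kE]; last by apply: ki; exists i'.
    by case: ki; exists j.+1.
  - by rewrite !shiftN // => i' E; [apply: lj|apply: ki]; exists i'.
have shift0 k : shift k <> g 0%N.
  have [[i ->]|ki] := pselect (exists i, k = g i); first by rewrite shiftg => /gI.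
  have kg i : k <> g i by move=> kE; apply: ki; exists i.
  by rewrite shiftN.
apply/pcard_injP; exists (fun x => if pselect (x = a) then g 0%N else shift (f x)).
move=> x y; rewrite !inE => Ax Ay.
case: pselect => [xa|xa]; case: pselect => [ya|ya] //=; first by rewrite xa ya.
- by move=> /esym/shift0.
- by move=> /shift0.
- by case: Ax => // Ax; case: Ay => // Ay /shiftI; apply: fI; rewrite inE.
Qed.

Lemma fast_closed {R : realType} {V : normedModType R} (S : set V) :
  (forall (u : nat -> V) l, (forall n, S (u n)) -> fast u -> u @ \oo --> l -> S l) ->
  closed S.
Proof.
move=> h l cl.
have hp n : (0 : R) < 2^-1 ^+ n.+2 by rewrite exprn_gt0// invr_gt0.
have [u uP] := choice (fun n => cl _ (nbhsx_ballx l _ (hp n))).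
have {}ul n : `|l - u n| < 2^-1 ^+ n.+2 by have [_] := uP n; rewrite -ball_normE.
apply: (h u) => [n||]; first by have [] := uP n.
- move=> n; have h1 := ul n; have h2 := ul n.+1.
  rewrite -(subrKA l) (le_trans (ler_normD _ _))//.
  move: h1 h2; rewrite [`|u _ - l|]distrC !exprS.
  have : (0 : R) <= 2^-1 ^+ n by rewrite exprn_ge0// invr_ge0.
  by move: (2^-1 ^+ n) => w; lra.
- apply/cvgrPdist_lt => e e0; have [n hn] := half_small e0.
  exists n => // m /= nm; rewrite (lt_trans (ul m))// (le_lt_trans _ hn)//.
  rewrite -[leLHS]mul1r ler_pM ?exprn_ge0 ?invr_ge0// ?ler1n//.
  by rewrite ler_wiXn2l ?invr_ge0// ?invf_le1 ?ler1n// -addn2 (leq_trans nm)// leq_addr.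
Qed.

(* Consequences of the Hahn-Banach theorem. *)
Section separation.
Context {R : realType} {X : normedModType R}.
Implicit Types (x y : X) (f g : dual X).

Lemma dual_support (p : X -> R) x : sublinear p -> (forall y, p y <= `|y|) ->
  exists f : dual X, [/\ `|f| <= 1, forall y, f y <= p y & f x = p x].
Proof.
move=> sp pn; have [f [lf fp fx]] := sublinear_support x sp.
have fN y : f (- y) = - f y.
  have f0 : f 0 = 0 by have := lf (-1) 0 0; rewrite !scaleN1r oppr0 addr0 addNr.
  by have := lf (-1) y 0; rewrite !scaleN1r !addr0 f0 addr0.
have fn y : `|f y| <= 1 * `|y|.
  rewrite mul1r ler_norml (le_trans (fp y))// andbT lerNl -fN.
  by rewrite (le_trans (fp _))// (le_trans (pn _))// normrN.
have [g gf] := dual_mk lf fn; exists g; rewrite gf; split=> //.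
by apply: dual_norm_le => // y; rewrite gf.
Qed.

Lemma norming_functional x : exists2 f : dual X, `|f| <= 1 & f x = `|x|.
Proof.
have sn : sublinear (fun y : X => `|y|).
  by split=> [y z|a y a0]; [exact: ler_normD|rewrite normrZ ger0_norm].
by have [f [? _ ?]] := dual_support x sn (fun y => lexx _); exists f.
Qed.

Lemma distance_functional (S : closedSubmod X) x : exists f : dual X,
  [/\ `|f| <= 1, forall y, csub_set S y -> f y = 0 & f x = `|qproj S x| ].
Proof.
have sn : sublinear (fun y : X => `|qproj S y|).
  split=> [y z|a y a0]; first by rewrite linearD ler_normD.
  by rewrite linearZ/= normrZ ger0_norm.
have [f [f1 fS fx]] := dual_support x sn (qproj_le S).
exists f; split=> // y Sy.
have q0 z : csub_set S z -> `|qproj S z| = 0.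
  move=> Sz; suff -> : qproj S z = 0 by rewrite normr0.
  by rewrite -(linear0 (qproj S)); apply/qproj_eq; rewrite subr0.
have SN : csub_set S (- y).
  by rewrite -scaleN1r -[_ *: _]addr0; apply: csub_linear => //; exact: csub0.
have := fS y; have := fS (- y); rewrite !q0// linearN/=; lra.
Qed.

End separation.

Section canonical_embedding.
Context {R : realType} {X : normedModType R}.
Implicit Types (x y : X) (f g : dual X).

Lemma bidual_subproof x : (fun f : dual X => f x : R^o) \in @dual_pred R (dual X).
Proof.
have lx : linear (fun f : dual X => f x : R^o) by [].
have bx f : `|f x : R^o| <= `|x| * `|f| by rewrite mulrC dual_ub.
by have [g <-] := dual_mk lx bx; exact: valP.
Qed.

Definition bidual x : dual (dual X) := Dual (bidual_subproof x).

Lemma bidual_linear : linear bidual.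
Proof. by move=> a x y; apply: dual_ext => f; rewrite /= linearP. Qed.

HB.instance Definition _ :=
  GRing.isLinear.Build R X (dual (dual X)) _ bidual bidual_linear.

Lemma bidual_norm x : `|bidual x| = `|x|.
Proof.
apply/eqP; rewrite eq_le; apply/andP; split.
  by apply: dual_norm_le => // f; rewrite mulrC; exact: (dual_ub f x).
have [f f1 fx] := norming_functional x.
rewrite -fx (le_trans (ler_norm _))// (le_trans (dual_ub (bidual x) f))//.
by rewrite ler_piMr.
Qed.

End canonical_embedding.

Section semadeni_pelczynski.
Context {R : realType} (kappa : Type).

(* Here and below the cardinal of [kappa] plays the role of the cardinal number. *)
Definition kappa_set (X : normedModType R) : set (dual (dual X)) :=
  [set F | forall A : set (dual X), (A #<= [set: kappa])%card ->
    exists x : X, forall f, A f -> F f = f x].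
Arguments kappa_set X _ : clear implicits.

Lemma kappa_set0 (X : normedModType R) : kappa_set X 0.
Proof. by move=> A _; exists 0 => f _; rewrite linear0. Qed.

Lemma kappa_set_linear (X : normedModType R) a F G :
  kappa_set X F -> kappa_set X G -> kappa_set X (a *: F + G).
Proof.
move=> kF kG A Ak; have [x Fx] := kF A Ak; have [y Gy] := kG A Ak.
by exists (a *: x + y) => f Af; rewrite dualD dualZ Fx// Gy// linearP.
Qed.

Hypothesis kinf : infinite_set [set: kappa].

Section annihilator.
Context (X : normedModType R) (A : set (dual X)).

Definition annihilator_set : set X := [set x | forall f, A f -> f x = 0].

Lemma annihilator0 : annihilator_set 0. Proof. by move=> f _; rewrite linear0. Qed.

Lemma annihilator_linear a x y :
  annihilator_set x -> annihilator_set y -> annihilator_set (a *: x + y).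
Proof. by move=> hx hy f Af; rewrite linearP/= hx// hy// scaler0 addr0. Qed.

Lemma annihilator_closed : closed annihilator_set.
Proof.
move=> x clx f Af; apply/normr0_eq0/eqP; rewrite eq_le normr_ge0 andbT.
apply/ler_addgt0Pl => e e0; rewrite addr0.
have /cvgrPdist_lt /(_ _ e0) /clx [y [/(_ _ Af) /= fy]] := @dual_continuous _ _ f x.
by rewrite /= fy subr0 => /ltW.
Qed.

Definition annihilator :=
  ClosedSubmod annihilator0 annihilator_linear annihilator_closed.

End annihilator.

Lemma kappa_set_small (X : normedModType R) (F : dual (dual X)) (A : set (dual X)) e :
  kappa_set X F -> (A #<= [set: kappa])%card -> `|F| < e ->
  exists x : X, (forall f, A f -> F f = f x) /\ `|x| < e.
Proof.
move=> kF Ak Fe; have [y Fy] := kF A Ak.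
have [g [g1 gA gy]] := distance_functional (annihilator A) y.
have Agk : (A `|` [set g] #<= [set: kappa])%card by exact: card_leU1.
have [z Fz] := kF _ Agk.
have gyz : g y = g z.
  apply/eqP; rewrite -subr_eq0 -linearB/=; apply/eqP/gA => f Af.
  by rewrite linearB/= -Fy// -Fz ?subrr//; left.
have ye : `|qproj (annihilator A) y| < e.
  rewrite -gy gyz -Fz; last by right.
  rewrite (le_lt_trans _ Fe)// (le_trans (ler_norm _))// (le_trans (dual_ub _ _))//.
  by rewrite ler_piMr.
have [x /qproj_eq xy xe] := quot_norm_lt ye; exists x; split=> // f Af.
rewrite (Fy _ Af); apply/esym/eqP; rewrite -subr_eq0 -linearB/=; exact/eqP/xy.
Qed.

Lemma kappa_set_closed (X : completeNormedModType R) : closed (kappa_set X).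
Proof.
apply: fast_closed => u l ku fu ul A Ak.
have [x0 x0u] := ku 0%N A Ak.
have [d dP] : {d : nat -> X & forall n,
    (forall f, A f -> (u n.+1 - u n) f = f (d n)) /\ `|d n| < 2 * 2^-1 ^+ n}.
  apply: (@choice _ _ (fun n x => (forall f, A f -> (u n.+1 - u n) f = f x) /\
    `|x| < 2 * 2^-1 ^+ n)) => n.
  apply: kappa_set_small Ak _.
    by rewrite addrC -scaleN1r; apply: kappa_set_linear; exact: ku.
  by rewrite (le_lt_trans (fu n))// ltr_pMl ?exprn_gt0 ?invr_gt0// ltr1n.
pose x n := x0 + \sum_(i < n) d i.
have xS n : x n.+1 = x n + d n by rewrite /x big_ord_recr/= addrA.
have ux n f : A f -> u n f = f (x n).
  move=> Af; elim: n => [|n ih]; first by rewrite /x big_ord0 addr0 x0u.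
  by rewrite xS linearD/= -ih -(dP n).1// dualB addrC subrK.
have /fast_cvg/cvg_ex[/= y xy] : fast (fun n => x n.+1).
  move=> n; rewrite [x n.+2]xS addrC addKr (le_trans (ltW (dP _).2))//.
  by rewrite exprS mulrA divff// mul1r.
exists y => f Af.
have h1 : u n.+1 f @[n --> \oo] --> l f.
  apply: (@cvg_comp _ _ _ (fun n => u n.+1) (fun F : dual (dual X) => F f) _ (nbhs l)).
    by apply/cvgrPdist_lt => e e0; move: ul => /cvgrPdist_lt /(_ _ e0)[N _ h];
      exists N => // n /= Nn; apply: h; exact: leqW.
  exact: (@dual_continuous _ _ (bidual f) l).
have h2 : u n.+1 f @[n --> \oo] --> f y.
  under eq_fun do rewrite ux//.
  apply: (@cvg_comp _ _ _ (fun n => x n.+1) f _ (nbhs y)) => //.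
  exact: dual_continuous.
exact: (cvg_unique _ h1 h2).
Qed.

Context (X : completeNormedModType R).

Definition kappa_space : closedSubmod (dual (dual X)) :=
  ClosedSubmod (@kappa_set0 X) (@kappa_set_linear X) (@kappa_set_closed X).

(* The canonical copy of [X] inside [kappa_space]. *)
Definition canonical_image : set (csub kappa_space) := [set u | exists x : X, csub_val u = bidual x].

Lemma canonical_image0 : canonical_image 0. Proof. by exists 0; rewrite linear0. Qed.

Lemma canonical_image_linear a u v :
  canonical_image u -> canonical_image v -> canonical_image (a *: u + v).
Proof.
by move=> [x ux] [y vy]; exists (a *: x + y); rewrite linearP/= -ux -vy.
Qed.

Lemma canonical_image_closed : closed canonical_image.
Proof.
apply: fast_closed => u l /choice[x ux] fu ul.
have /fast_cvg/cvg_ex[/= y xy] : fast x.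
  by move=> n; rewrite -bidual_norm linearB/= -!ux; exact: fu.
exists y; apply: (@cvg_unique _ _ (csub_val (u n) @[n --> \oo])) => //.
  by apply/cvgrPdist_lt => e e0; move: ul => /cvgrPdist_lt /(_ _ e0).
apply/cvgrPdist_lt => e e0; move: xy => /cvgrPdist_lt /(_ _ e0)[N _ h].
by exists N => // n /h /=; rewrite ux -linearB/= bidual_norm.
Qed.

Definition canonical_copy : closedSubmod (csub kappa_space) :=
  ClosedSubmod canonical_image0 canonical_image_linear canonical_image_closed.

Definition SP : completeNormedModType R := quotspace canonical_copy.

End semadeni_pelczynski.

Section dimension.
Context {R : realType} {kappa : Type} (kinf : infinite_set [set: kappa]).
Implicit Types X : completeNormedModType R.

Definition trivial_space X := forall x : X, x = 0.

Definition SP_iter j X : completeNormedModType R := iter j (SP kinf) X.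

(* At most one [j] satisfies the condition, see [spdimP]. *)
Definition spdim X : \bar int :=
  if pselect (trivial_space X) then (-1)%:E
  else if pselect (exists j, trivial_space (SP_iter j.+1 X) /\
                             ~ trivial_space (SP_iter j X)) is left h
  then (sval (cid h))%:Z%:E
  else +oo%E.

Lemma SP_trivial X : trivial_space X -> trivial_space (SP kinf X).
Proof.
move=> X0 q; have [u <-] := qprojP q; rewrite -(linear0 (qproj _)).
apply/qproj_eq; exists 0; rewrite subr0 linear0.
apply: dual_ext => f; suff -> : f = 0 by rewrite !linear0.
by apply: dual_ext => x; rewrite (X0 x) linear0.
Qed.

Lemma spdimP X j : trivial_space (SP_iter j.+1 X) -> ~ trivial_space (SP_iter j X) ->
  spdim X = j%:Z%:E.
Proof.
have triv i k : trivial_space (SP_iter i X) -> trivial_space (SP_iter (i + k) X).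
  by move=> h; elim: k => [|k ih]; rewrite ?addn0// addnS; exact: SP_trivial.
move=> j1 j0; rewrite /spdim; case: (pselect (trivial_space X)) => [X0|_] /=.
  by case: j0; exact: (triv 0%N).
case: pselect => [h|[]]; last by exists j.
have [i1 i0] := svalP (cid h); congr (Posz _)%:E.
set i := sval _ in i1 i0 *.
have le a b : trivial_space (SP_iter a.+1 X) -> ~ trivial_space (SP_iter b X) -> (b <= a)%N.
  by move=> a1 b0; rewrite leqNgt; apply/negP => /subnKC ab; apply: b0; rewrite -ab; exact: triv.
by apply/eqP; rewrite eqn_leq !le.
Qed.

End dimension.

(* [character_le T kappa] says that the character of [T], the supremum over x of
   the least cardinality of a base at x, is at most the cardinal of [kappa]. *)
Section character.
Context (T : topologicalType).

Definition local_base (x : T) (B : set (set T)) :=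
  (forall U, B U -> open_nbhs x U) /\
  (forall V, nbhs x V -> exists2 U, B U & U `<=` V).

Definition character_le (kappa : Type) :=
  forall x : T, exists2 B, local_base x B & (B #<= [set: kappa])%card.

End character.

Record compactLine := CompactLine {
  line_disp : Order.disp_t ;
  line_sort :> orderTopologicalType line_disp ;
  line_nonempty : [set: line_sort] !=set0 ;
  line_compact : compact [set: line_sort] }.

Section products_of_lines.
Context {m : nat} (K : 'I_m -> compactLine).

Definition line_product : topologicalType := prod_topology (fun i => K i).

Lemma line_product_compact : compact [set: line_product].
Proof.
have := @tychonoff _ (fun i => K i : topologicalType) _ (fun i => @line_compact (K i)).
by congr compact; apply/seteqP; split.
Qed.

(* The permutation [s] lists first the factors of character larger than kappa. *)
Definition product_class (kappa : Type) (n : nat) :=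
  (n <= m)%N /\
  exists s : 'S_m, forall i : 'I_m, ~ character_le (K (s i)) kappa <-> (i < n)%N.

End products_of_lines.

Arguments line_product_compact {m} K _ _ _.

(* Main.v *)
From HB Require Import structures.
Require Import Defs.
From mathcomp Require Import all_boot all_order all_algebra.
From mathcomp Require Import all_classical all_reals all_analysis.
From mathcomp Require Import perm lra.

Set Implicit Arguments.
Unset Strict Implicit.
Unset Printing Implicit Defensive.

Import Order.TTheory GRing.Theory Num.Theory.
Import numFieldNormedType.Exports.

Local Open Scope classical_set_scope.
Local Open Scope ring_scope.

(** Let kappa X be the space of the elements of X** that agree with elements of
    X on any kappa many functionals, and SP(X) = kappa X / X. Both are functors
    that respect isomorphic embeddings ([emb_kap], [emb_SP]), so C(K) may be
    compared with other spaces. Call a side of a point of a line big if its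
    cofinality exceeds kappa. A compact line has character at most kappa if and
    only if it has no big side; one direction uses that the square of an
    infinite cardinal kappa is kappa ([character_big_line],
    [big_line_character]).

    Upper bound. C(K) embeds into regulated functions on K_1 with values in
    regulated functions on K_2, and so on, down to the scalars ([emb_tower]). A
    function is regulated if it has one-sided limits. For a complete order L and
    a Banach space X let reg(X) be the regulated functions from L to X. The
    evaluations at points and at sides norm kappa(reg(X)) ([reg_hat_norming]),
    because a functional on reg(X) has a total variation, and hence is computed
    from countably many scalar conditions on the values of a function. The
    values of F in kappa(reg(X)) form a regulated function into kappa X; its
    one-sided limits differ from the components of F at the sides only at big
    sides, and these differences, the jumps, form a c_0-family. Therefore
      kappa(reg(X)) embeds into reg(kappa X) + c_0(kappa X),
      SP(reg(X)) embeds into reg(SP(X)) + c_0(kappa X),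
    where c_0 is indexed by the big sides of L ([emb_kap_reg], [emb_SP_reg]). So
    an application of SP to reg(X) is passed on to X, except for a part in which
    X is still to be treated and the order has disappeared. Since kappa X turns
    up as well, the induction runs over all words in the two functors: if every
    word with at least n letters SP annihilates X, then every word with at least
    n such letters, or n + 1 if L has a big side, annihilates reg(X)
    ([killed_reg]). As kappa R = R and SP(R) = 0, one letter SP annihilates the
    scalars, and n + 1 letters annihilate C(K) if n factors have a big side.

    Lower bound. Let K_i have a big side at x, and let P be the product of some
    of the other factors. Consider a continuous bump on K_i that climbs from 0 to
    1 shortly before x and keeps the value 1 from there on. As it moves towards
    x, its products with a fixed v in C(P) are eventually constant on each
    functional: otherwise disjoint differences of bumps would add up to functions
    of bounded norm with unbounded values. The limit is v times the indicator of
    x and the points beyond x; it belongs to kappa C(K_i x P), since the side is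
    big, but it is far from the continuous functions. Thus C(P)
    embeds into SP(C(K_i x P)) ([emb_lower]), and the n-th derivative of C(K) is
    not trivial. *)

(** * Bounded operators and isomorphic embeddings *)

Section bounded_operators.
Context {R : realType}.

Section def.
Context (X Y : normedModType R).

Record bop := Bop {
  bop_fun :> X -> Y ;
  bop_linear : linear bop_fun ;
  bop_bounded : exists M, forall x, `|bop_fun x| <= M * `|x| }.

HB.instance Definition _ (T : bop) := GRing.isLinear.Build R X Y _ T (bop_linear T).

Lemma bop0 (T : bop) : T 0 = 0. Proof. exact: linear0. Qed.
Lemma bopN (T : bop) x : T (- x) = - T x. Proof. exact: linearN. Qed.
Lemma bopD (T : bop) x y : T (x + y) = T x + T y. Proof. exact: linearD. Qed.
Lemma bopB (T : bop) x y : T (x - y) = T x - T y. Proof. exact: linearB. Qed.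
Lemma bopZ (T : bop) a x : T (a *: x) = a *: T x. Proof. exact: linearZ. Qed.

Lemma bop_bound (T : bop) : exists2 M, 0 < M & forall x, `|T x| <= M * `|x|.
Proof.
have [M TM] := bop_bounded T; exists (`|M| + 1); first by rewrite ltr_wpDl.
move=> x; rewrite (le_trans (TM x))// ler_wpM2r//.
by rewrite (le_trans (ler_norm _))// lerDl.
Qed.

End def.

Lemma bop_comp_linear (X Y Z : normedModType R) (T : bop Y Z) (S : bop X Y) :
  linear (T \o S).
Proof. by move=> a x y; rewrite /= !linearP. Qed.

Lemma bop_comp_bounded (X Y Z : normedModType R) (T : bop Y Z) (S : bop X Y) :
  exists M, forall x, `|(T \o S) x| <= M * `|x|.
Proof.
have [M M0 TM] := bop_bound T; have [N N0 SN] := bop_bound S.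
by exists (M * N) => x; rewrite (le_trans (TM _))// -mulrA ler_pM2l// SN.
Qed.

Definition bop_comp (X Y Z : normedModType R) (T : bop Y Z) (S : bop X Y) :=
  Bop (bop_comp_linear T S) (bop_comp_bounded T S).

Section transpose.
Context (X Y : normedModType R) (T : bop X Y).

Lemma transpose_subproof (g : dual Y) : (fun x => g (T x) : R^o) \in @dual_pred R X.
Proof.
have lg : linear (fun x => g (T x) : R^o) by move=> a x y; rewrite !linearP.
have [M M0 TM] := bop_bound T.
have bg x : `|g (T x) : R^o| <= (`|g| * M) * `|x|.
  by rewrite (le_trans (dual_ub g _))// -mulrA ler_wpM2l.
by have [h <-] := dual_mk lg bg; exact: valP.
Qed.

Definition transpose_fun (g : dual Y) : dual X := Dual (transpose_subproof g).

Lemma transpose_linear : linear transpose_fun.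
Proof. by move=> a f g; apply: dual_ext. Qed.

Lemma transpose_bounded : exists M, forall g, `|transpose_fun g| <= M * `|g|.
Proof.
have [M M0 TM] := bop_bound T; exists M => g.
apply: dual_norm_le => [|x]; first by rewrite mulr_ge0// ltW.
by rewrite (le_trans (dual_ub g _))// mulrAC [leRHS]mulrC ler_wpM2l.
Qed.

Definition transpose : bop (dual Y) (dual X) := Bop transpose_linear transpose_bounded.

Lemma transposeE g x : transpose g x = g (T x). Proof. by []. Qed.

End transpose.

Definition emb (X Y : normedModType R) :=
  exists T : bop X Y, exists2 c, 0 < c & forall x, c * `|x| <= `|T x|.

Lemma emb_trivial (X Y : completeNormedModType R) :
  emb X Y -> trivial_space Y -> trivial_space X.
Proof.
move=> [T [c c0 Tc]] Y0 x; apply/normr0_eq0/eqP; rewrite eq_le normr_ge0 andbT.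
by rewrite -(pmulr_rle0 _ c0) (le_trans (Tc x))// (Y0 (T x)) normr0.
Qed.

(** Hahn-Banach: f is read as a functional on T(X). The extension to Y is a linear
    minorant of the functional y |-> inf_x (f x + k |y - T x|), which is
    sublinear and at most f on T(X). *)
Lemma transpose_surj (X Y : normedModType R) (T : bop X Y) c (f : dual X) :
  0 < c -> (forall x, c * `|x| <= `|T x|) ->
  exists2 g : dual Y, transpose T g = f & `|g| <= c^-1 * `|f|.
Proof.
move=> c0 Tc.
pose k := c^-1 * `|f|.
have k0 : 0 <= k by rewrite mulr_ge0// invr_ge0 ltW.
have fk x : `|f x| <= k * `|T x|.
  rewrite (le_trans (dual_ub f x))// /k mulrAC [leRHS]mulrC ler_wpM2l//.
  by rewrite ler_pdivlMl.
pose S y : set R := [set (f x : R) + k * `|y - T x| | x in [set: X]].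
pose p y := inf (S y).
have S0 y : S y !=set0 by exists (f 0 + k * `|y - T 0|), 0.
have Slb y : lbound (S y) (- (k * `|y|)).
  move=> _ [x _ <-]; have := fk x; rewrite ler_norml => /andP[+ _].
  have : k * `|T x| <= k * `|y| + k * `|y - T x|.
    rewrite -mulrDr ler_wpM2l// -{1}(subKr y (T x)).
    by rewrite (le_trans (ler_normB _ _)).
  by lra.
have ple y x : p y <= f x + k * `|y - T x|.
  by apply: ge_inf; [exists (- (k * `|y|))|exists x].
have pge y (m : R) : (forall x, m <= f x + k * `|y - T x|) -> m <= p y.
  by move=> h; apply: lb_le_inf => // _ [x _ <-].
have p0 : p 0 = 0.
  apply/eqP; rewrite eq_le; apply/andP; split.
    by have := ple 0 0; rewrite !linear0 !addr0 normr0 mulr0 addr0.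
  by apply: pge => x; have := Slb 0; rewrite normr0 mulr0 oppr0; apply; exists x.
have sp : sublinear p.
  have pZ a y : 0 < a -> a * p y <= p (a *: y).
    move=> a0; apply: pge => x; rewrite -ler_pdivlMl//.
    apply: le_trans (ple y (a^-1 *: x)) _.
    rewrite linearZ/= -[_ *: _]/(_ * _) mulrDr lerD2l mulrCA ler_wpM2l//.
    rewrite linearZ/= -[X in `|X - _|](scalerK (lt0r_neq0 a0)) -scalerBr normrZ.
    by rewrite gtr0_norm ?invr_gt0// .
  split=> [y z|a y].
    rewrite -lerBlDr; apply: (pge) => x; rewrite lerBlDr -lerBlDl.
    apply: pge => x'; rewrite lerBlDl (le_trans (ple _ (x + x')))//.
    have -> : f (x + x') = f x + f x' :> R by rewrite linearD.
    rewrite [leRHS]addrACA lerD2l -mulrDr ler_wpM2l//.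
    by rewrite linearD/= opprD addrACA ler_normD.
  rewrite le_eqVlt => /predU1P[<-|a0]; first by rewrite scale0r mul0r p0.
  apply/eqP; rewrite eq_le pZ// andbT.
  have ai0 : 0 < a^-1 by rewrite invr_gt0.
  by have := pZ _ (a *: y) ai0; rewrite scalerA mulVf ?gt_eqF// scale1r ler_pdivrMl.
have [g [lg gp _]] := sublinear_support 0 sp.
have g0 : g 0 = 0 by have := lg (-1) 0 0; rewrite !scaleN1r oppr0 addr0 addNr.
have gN y : g (- y) = - g y.
  by have := lg (-1) y 0; rewrite !scaleN1r !addr0 g0 addr0.
have gk y : `|g y| <= k * `|y|.
  have h z : g z <= k * `|z|.
    by rewrite (le_trans (gp z))// (le_trans (ple z 0))// !linear0 add0r addr0.
  by rewrite ler_norml h andbT lerNl -gN (le_trans (h _))// normrN.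
have [h hg] := dual_mk lg gk; exists h; last by apply: dual_norm_le => // y; rewrite hg.
have gT x : g (T x) <= f x.
  by rewrite (le_trans (gp _))// (le_trans (ple _ x))// subrr normr0 mulr0 addr0.
apply: dual_ext => x /=; rewrite hg; apply/eqP; rewrite eq_le gT/=.
by have := gT (- x); rewrite !linearN/= gN lerN2.
Qed.

(** The range of an embedding is closed, so that functionals vanishing on it
    compute the distance to it. *)
Section range.
Context (X : completeNormedModType R) (Y : normedModType R) (T : bop X Y).
Context (c : R) (c0 : 0 < c) (Tc : forall x, c * `|x| <= `|T x|).

Lemma range0 : range T 0. Proof. by exists 0 => //; rewrite linear0. Qed.

Lemma range_linear a x y : range T x -> range T y -> range T (a *: x + y).
Proof.
by move=> [u _ <-] [v _ <-]; exists (a *: u + v) => //; rewrite linearP.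
Qed.

Lemma range_closed : closed (range T).
Proof.
move=> l cl.
have hp n : (0 : R) < c / 4 * 2^-1 ^+ n.
  by rewrite mulr_gt0 ?divr_gt0// exprn_gt0// invr_gt0.
have hx n : exists x, `|l - T x| < c / 4 * 2^-1 ^+ n.
  have [_ [[x _ <-]]] := cl _ (nbhsx_ballx l _ (hp n)).
  by rewrite -ball_normE; exists x.
have [x xl] := choice hx.
have /fast_cvg/cvg_ex[/= y xy] : fast x.
  move=> n; rewrite -(ler_pM2l c0) (le_trans (Tc _))// linearB/=.
  rewrite -(subrKA l) (le_trans (ler_normD _ _))//.
  have := xl n; have := xl n.+1; rewrite [`|T _ - l|]distrC exprS.
  have : 0 <= c * 2^-1 ^+ n by rewrite mulr_ge0 ?(ltW c0)// exprn_ge0// invr_ge0.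
  move: (2^-1 ^+ n) => z; lra.
exists y => //; apply/esym/eqP; rewrite -subr_eq0 -normr_eq0 eq_le normr_ge0 andbT.
have [M M0 TM] := bop_bound T.
apply/ler_addgt0Pl => e e0; rewrite addr0.
have eM : 0 < e / 2 / M by rewrite !divr_gt0.
have /half_small[n1 hn1] : 0 < e * 2 / c by rewrite divr_gt0// mulr_gt0.
move: xy => /cvgrPdist_lt /(_ _ eM)[N _ /(_ (n1 + N)%N)] /=.
rewrite leq_addl => /(_ isT) h1.
have h2 := xl (n1 + N)%N.
have h3 : c / 4 * 2^-1 ^+ (n1 + N) < e / 2.
  have : (2^-1 : R) ^+ (n1 + N) <= 2^-1 ^+ n1.
    by rewrite ler_wiXn2l ?invr_ge0// ?invf_le1 ?ler1n// leq_addr.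
  move: hn1; rewrite ltr_pdivlMr//.
  move: (2^-1 ^+ n1) (2^-1 ^+ (n1 + N)) => w z h4 h5.
  have : z * c <= w * c by rewrite ler_pM2r.
  by lra.
rewrite -(subrKA (T (x (n1 + N)%N))) (le_trans (ler_normD _ _))//.
have : `|T (x (n1 + N)%N) - T y| < e / 2.
  by rewrite -linearB (le_lt_trans (TM _))// distrC mulrC -ltr_pdivlMr.
by lra.
Qed.

Lemma range_dist (y : Y) d : 0 < d ->
  (forall g : dual Y, transpose T g = 0 -> `|g| <= 1 -> `|g y| < d) ->
  exists x, `|y - T x| < d.
Proof.
move=> d0 h.
pose S := ClosedSubmod range0 range_linear range_closed.
have [g [g1 gS gy]] := distance_functional S y.
have : `|qproj S y| < d.
  rewrite -gy (le_lt_trans (ler_norm _))// h//.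
  by apply: dual_ext => x /=; apply: gS; exists x.
move=> /quot_norm_lt[z /qproj_eq[x _ xz] zd]; exists (- x).
by rewrite linearN/= opprK xz subrKC.
Qed.

End range.

End bounded_operators.

(** * The functors X |-> kappa X and X |-> SP(X) on embeddings *)

Section kappa_functor.
Context {R : realType} {kappa : Type} (kinf : infinite_set [set: kappa]).
Implicit Types X Y Z : completeNormedModType R.

Definition kap X : completeNormedModType R := csub (kappa_space kinf X).

Definition kval X (F : kap X) : dual (dual X) := csub_val F.

Lemma kval_agree X (F : kap X) (A : set (dual X)) : (A #<= [set: kappa])%card ->
  exists x, forall f, A f -> kval F f = f x.
Proof. exact: (csub_valP F). Qed.

Lemma kval_linear X : linear (@kval X). Proof. by []. Qed.

HB.instance Definition _ X :=
  GRing.isLinear.Build R (kap X) (dual (dual X)) _ (@kval X) (@kval_linear X).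

Arguments kval : simpl never.

Lemma kval_ext X (F G : kap X) : kval F =1 kval G -> F = G.
Proof. by move=> FG; apply: val_inj; exact: dual_ext. Qed.

Lemma kvalD X (F G : kap X) f : kval (F + G) f = kval F f + kval G f.
Proof. by rewrite linearD dualD. Qed.

Lemma kvalB X (F G : kap X) f : kval (F - G) f = kval F f - kval G f.
Proof. by rewrite linearB dualB. Qed.

Lemma kvalZ X a (F : kap X) f : kval (a *: F) f = a * kval F f.
Proof. by rewrite linearZ dualZ. Qed.

Lemma kval_ub X (F : kap X) f : `|kval F f| <= `|F| * `|f|.
Proof. exact: dual_ub. Qed.

Lemma kap_norm_le X (F : kap X) M :
  0 <= M -> (forall f, `|kval F f| <= M * `|f|) -> `|F| <= M.
Proof. exact: dual_norm_le. Qed.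

Definition kap_mk X (F : dual (dual X)) (kF : kappa_set kappa F) : kap X :=
  Csub (mem_set kF : F \in csub_pred (kappa_space kinf X)).

Lemma kap_mkE X F (kF : @kappa_set R kappa X F) : kval (kap_mk kF) = F.
Proof. by []. Qed.

Lemma kappa_bidual X (x : X) : kappa_set kappa (bidual x).
Proof. by move=> A _; exists x. Qed.

Definition kiota_fun X (x : X) : kap X := kap_mk (kappa_bidual x).

Lemma kiota_linear X : linear (@kiota_fun X).
Proof. by move=> a x y; apply: val_inj; exact: bidual_linear. Qed.

Lemma kiota_bounded X : exists M, forall x : X, `|kiota_fun x| <= M * `|x|.
Proof. by exists 1 => x; rewrite mul1r -[leRHS]bidual_norm. Qed.

Definition kiota X : bop X (kap X) := Bop (@kiota_linear X) (@kiota_bounded X).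

Lemma kiotaE X (x : X) f : kval (kiota X x) f = f x. Proof. by []. Qed.

Lemma kiota_norm X (x : X) : `|kiota X x| = `|x|. Proof. exact: bidual_norm. Qed.

Lemma kappa_transpose X Y (T : bop X Y) (F : kap X) :
  kappa_set kappa (transpose (transpose T) (kval F)).
Proof.
move=> A Ak; have [|x Fx] := @kval_agree X F (transpose T @` A).
  exact: card_le_trans (card_image_le _ _) Ak.
by exists (T x) => f Af; rewrite -[RHS]/(transpose T f x) -Fx//; exists f.
Qed.

Definition kmap_fun X Y (T : bop X Y) (F : kap X) : kap Y := kap_mk (kappa_transpose T F).

Lemma kmap_linear X Y (T : bop X Y) : linear (kmap_fun T).
Proof.
move=> a F G; apply: kval_ext => f.
by rewrite kvalD kvalZ !kap_mkE !transposeE kvalD kvalZ.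
Qed.

Lemma kmap_bounded X Y (T : bop X Y) :
  exists M, forall F, `|kmap_fun T F| <= M * `|F|.
Proof.
by have [M TM] := bop_bounded (transpose (transpose T)); exists M => F; exact: TM.
Qed.

Definition kmap X Y (T : bop X Y) : bop (kap X) (kap Y) :=
  Bop (kmap_linear T) (kmap_bounded T).

Lemma kmapE X Y (T : bop X Y) F f : kval (kmap T F) f = kval F (transpose T f).
Proof. by []. Qed.

Lemma kmap_iota X Y (T : bop X Y) x : kmap T (kiota X x) = kiota Y (T x).
Proof. exact: kval_ext. Qed.

(** Every functional on X comes from a functional on Y of comparable norm, so that
    T** inherits the lower bound of T. *)
Lemma kmap_lower X Y (T : bop X Y) c : 0 < c -> (forall x, c * `|x| <= `|T x|) ->
  forall F, c * `|F| <= `|kmap T F|.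
Proof.
move=> c0 Tc F; rewrite -ler_pdivlMl//; apply: kap_norm_le.
  by rewrite mulr_ge0// invr_ge0 ltW.
move=> f; have [g <- gf] := transpose_surj f c0 Tc.
rewrite -kmapE (le_trans (kval_ub _ _))// mulrAC [leRHS]mulrC ler_wpM2l//.
Qed.

Lemma emb_kap X Y : emb X Y -> emb (kap X) (kap Y).
Proof.
by move=> [T [c c0 Tc]]; exists (kmap T), c => // F; exact: kmap_lower.
Qed.

Lemma kap_trivial X : trivial_space X -> trivial_space (kap X).
Proof.
move=> X0 F; apply: kval_ext => f; rewrite linear0.
suff -> : f = 0 by rewrite linear0.
by apply: dual_ext => x; rewrite (X0 x) linear0.
Qed.

Definition SPproj X : kap X -> SP kinf X := qproj (canonical_copy kinf X).

Lemma SPproj_linear X : linear (@SPproj X). Proof. exact: qproj_linear. Qed.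

Lemma SPproj_bounded X : exists M, forall F : kap X, `|SPproj F| <= M * `|F|.
Proof. by exists 1 => F; rewrite mul1r; exact: qproj_le. Qed.

Definition SPquot X : bop (kap X) (SP kinf X) := Bop (@SPproj_linear X) (@SPproj_bounded X).

Lemma SPquotP X (q : SP kinf X) : exists F, SPquot X F = q.
Proof. exact: qprojP. Qed.

Lemma SPquot_eq0 X (F : kap X) : SPquot X F = 0 <-> exists x, F = kiota X x.
Proof.
rewrite -(bop0 (SPquot X)); split=> [/qproj_eq|[x ->]].
  by rewrite subr0 => -[x Fx]; exists x; apply: val_inj.
by apply/qproj_eq; rewrite subr0; exists x.
Qed.

Lemma SPquot_iota X (x : X) : SPquot X (kiota X x) = 0.
Proof. by apply/SPquot_eq0; exists x. Qed.

Lemma SPquot_lt X (F : kap X) e : `|SPquot X F| < e -> exists x, `|F - kiota X x| < e.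
Proof.
move=> /quot_norm_lt[G /qproj_eq[x GF] Ge]; exists (- x).
rewrite bopN opprK.
suff <- : G = F + kiota X x by [].
apply: val_inj => /=; move: GF => /= <-.
by rewrite addrC -[RHS]/(val (G - F + F)) subrK.
Qed.

(** An operator on kappa X that vanishes on X factors through SP(X), and the factor
    is bounded below if small values of the operator force F to be close to X.
    All embeddings of SP(X) are obtained in this way. *)
Lemma emb_SP_of X (Y : normedModType R) (J : bop (kap X) Y) C :
  0 < C -> (forall x, J (kiota X x) = 0) ->
  (forall F e, `|J F| < e -> exists x, `|F - kiota X x| <= C * e) ->
  emb (SP kinf X) Y.
Proof.
move=> C0 Jiota JC.
have rP (q : SP kinf X) : SPquot X (repr q) = q by exact: reprK.
have JE F G : SPquot X F = SPquot X G -> J F = J G.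
  move=> FG; have : SPquot X (F - G) = 0 by rewrite bopB FG subrr.
  move=> /SPquot_eq0[x FGx]; apply/eqP; rewrite -subr_eq0 -bopB FGx Jiota.
  exact: eqxx.
pose K (q : SP kinf X) := J (repr q).
have KE F : K (SPquot X F) = J F by apply: JE; rewrite rP.
have lK : linear K.
  move=> a p q; have [F <-] := SPquotP p; have [G <-] := SPquotP q.
  by rewrite -bopZ -bopD !KE bopD bopZ.
have bK : exists M, forall q, `|K q| <= M * `|q|.
  have [M M0 JM] := bop_bound J; exists M => q.
  rewrite -ler_pdivrMl//; apply: quot_norm_ge => F Fq.
  by rewrite ler_pdivrMl// -Fq KE JM.
exists (Bop lK bK), C^-1; first by rewrite invr_gt0.
move=> q; have [F <-] := SPquotP q; rewrite -[Bop _ _ _]/(K _) KE ler_pdivrMl//.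
apply/ler_addgt0Pl => e e0.
have [|x Fx] := JC F (`|J F| + e / C); first by rewrite ltrDl divr_gt0.
have -> : SPquot X F = SPquot X (F - kiota X x) by rewrite bopB SPquot_iota subr0.
rewrite (le_trans (qproj_le _ _))// (le_trans Fx)//.
by rewrite mulrDr mulrC addrC [C * (e / C)]mulrC divfK ?gt_eqF// mulrC.
Qed.

(** Let T : X -> Y be the embedding. The functionals that vanish on T(X) vanish at
    T**F. If T**F is within d of some y in Y, they are therefore at most d times
    their norm at y, so that y is within d of T(X), and F is close to X. *)
Lemma emb_SP X Y : emb X Y -> emb (SP kinf X) (SP kinf Y).
Proof.
move=> [T [c c0 Tc]].
apply: (@emb_SP_of X _ (bop_comp (SPquot Y) (kmap T)) (2 / c)).
- by rewrite divr_gt0.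
- by move=> x; rewrite -[bop_comp _ _ _]/(SPquot _ (kmap _ _)) kmap_iota SPquot_iota.
move=> F e /SPquot_lt[y Fy].
have e0 : 0 < e by exact: le_lt_trans Fy.
have [g gT g1|x yx] := range_dist c0 Tc e0 (y := y).
  rewrite (le_lt_trans _ Fy)// distrC.
  have -> : g y = kval (kiota Y y - kmap T F) g.
    by rewrite kvalB kiotaE kmapE gT linear0 subr0.
  by rewrite (le_trans (kval_ub _ _))// ler_piMr.
exists x; rewrite mulrAC ler_pdivlMr// mulrC (le_trans (kmap_lower c0 Tc _))//.
rewrite bopB kmap_iota -(subrKA (kiota Y y)) (le_trans (ler_normD _ _))//.
by rewrite -bopB kiota_norm mulr2n mulrDl mul1r ltW// ltrD.
Qed.

End kappa_functor.

(* Unification is kept from unfolding the subtypes and the quotient. *)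
Opaque kap kval kap_mk kmap kiota SPquot.

(** * Banach spaces of bounded families of vectors *)

Section function_spaces.
Context {R : realType}.

(** A space of families, possibly of vectors of different spaces, is cut out by
    a linear condition that is stable under uniform limits. *)
Record funsys := Funsys {
  fs_index : Type ;
  fs_fam : fs_index -> completeNormedModType R ;
  fs_cond : set (forall t, fs_fam t) ;
  fs_cond0 : fs_cond (fun t => 0) ;
  fs_condP : forall a f g, fs_cond f -> fs_cond g -> fs_cond (fun t => a *: f t + g t) ;
  fs_cond_closed : forall f, (forall e, 0 < e ->
    exists2 g, fs_cond g & forall t, `|f t - g t| <= e) -> fs_cond f }.

Section space.
Variable S : funsys.
Notation T := (fs_index S).

Record fspace := FSpace {
  fs_fun :> forall t : T, fs_fam t ;
  fs_bounded : exists M, forall t, `|fs_fun t| <= M ;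
  fs_mem : fs_cond fs_fun }.

HB.instance Definition _ := gen_eqMixin fspace.
HB.instance Definition _ := gen_choiceMixin fspace.

Implicit Types f g h : fspace.

Lemma fspace_ext f g : (forall t, f t = g t) -> f = g.
Proof.
case: f g => [f bf Pf] [g bg Pg] /= fg.
have E : f = g by exact: functional_extensionality_dep.
by case: _ / E in bg Pg *; congr FSpace; exact: Prop_irrelevance.
Qed.

Lemma fs_lin_bounded (a : R) f g : exists M, forall t, `|a *: f t + g t| <= M.
Proof.
have [M fM] := fs_bounded f; have [N gN] := fs_bounded g.
exists (`|a| * M + N) => t; rewrite (le_trans (ler_normD _ _))// normrZ.
by rewrite lerD ?gN// ler_wpM2l ?fM.
Qed.

Definition fs_lin a f g := FSpace (fs_lin_bounded a f g)
  (fs_condP a (fs_mem f) (fs_mem g)).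

Lemma fs0_bounded : exists M : R, forall t : T, `|0 : fs_fam t| <= M.
Proof. by exists 0 => t; rewrite normr0. Qed.

Definition fs0 := FSpace fs0_bounded (fs_cond0 S).

Let fsD f g := fs_lin 1 f g.
Let fsN f := fs_lin (-1) f fs0.
Let fsZ a f := fs_lin a f fs0.

Let fsDE f g t : fsD f g t = f t + g t. Proof. by rewrite /= scale1r. Qed.
Let fsNE f t : fsN f t = - f t. Proof. by rewrite /= scaleN1r addr0. Qed.
Let fsZE a f t : fsZ a f t = a *: f t. Proof. by rewrite /= addr0. Qed.

Let fsDA : associative fsD.
Proof. by move=> f g h; apply: fspace_ext => t; rewrite !fsDE addrA. Qed.
Let fsDC : commutative fsD.
Proof. by move=> f g; apply: fspace_ext => t; rewrite !fsDE addrC. Qed.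
Let fs0D : left_id fs0 fsD.
Proof. by move=> f; apply: fspace_ext => t; rewrite fsDE add0r. Qed.
Let fsND : left_inverse fs0 fsN fsD.
Proof. by move=> f; apply: fspace_ext => t; rewrite fsDE fsNE addNr. Qed.

HB.instance Definition _ := GRing.isZmodule.Build fspace fsDA fsDC fs0D fsND.

Let fsZA a b f : fsZ a (fsZ b f) = fsZ (a * b) f.
Proof. by apply: fspace_ext => t; rewrite !fsZE scalerA. Qed.
Let fsZ1 : left_id 1 fsZ.
Proof. by move=> f; apply: fspace_ext => t; rewrite fsZE scale1r. Qed.
Let fsZDr : right_distributive fsZ +%R.
Proof. by move=> a f g; apply: fspace_ext => t; rewrite fsDE !fsZE fsDE scalerDr. Qed.
Let fsZDl f : {morph fsZ^~ f : a b / a + b}.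
Proof. by move=> a b; apply: fspace_ext => t; rewrite fsDE !fsZE scalerDl. Qed.

HB.instance Definition _ :=
  GRing.Zmodule_isLmodule.Build R fspace fsZA fsZ1 fsZDr fsZDl.

Lemma fspaceD f g t : (f + g) t = f t + g t. Proof. exact: fsDE. Qed.
Lemma fspaceN f t : (- f) t = - f t. Proof. exact: fsNE. Qed.
Lemma fspaceB f g t : (f - g) t = f t - g t. Proof. by rewrite fspaceD fspaceN. Qed.
Lemma fspaceZ a f t : (a *: f) t = a *: f t. Proof. exact: fsZE. Qed.

Definition fs_norm f := supnorm setT (fun t => `|f t|).

Lemma fs_norm_bounded f : bounded_on setT (fun t => `|f t|).
Proof. by have [M fM] := fs_bounded f; exists M => t _; rewrite normr_id. Qed.

Let fs_norm_ub f t : `|f t| <= fs_norm f.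
Proof.
rewrite -[leLHS]normr_id.
by apply: (@supnorm_ub _ _ setT (fun t => `|f t|)) => //; exact: fs_norm_bounded.
Qed.

Let fs_norm_le f M : 0 <= M -> (forall t, `|f t| <= M) -> fs_norm f <= M.
Proof. by move=> M0 fM; apply: supnorm_le => // t _; rewrite normr_id. Qed.

Let fs_norm_ge0 f : 0 <= fs_norm f.
Proof. exact/supnorm_ge0/fs_norm_bounded. Qed.

Lemma fs_normD f g : fs_norm (f + g) <= fs_norm f + fs_norm g.
Proof.
apply: fs_norm_le => [|t]; first by rewrite addr_ge0 ?fs_norm_ge0.
by rewrite fspaceD (le_trans (ler_normD _ _))// lerD ?fs_norm_ub.
Qed.

Lemma fs_normZ a f : fs_norm (a *: f) = `|a| * fs_norm f.
Proof.
have le b h : fs_norm (b *: h) <= `|b| * fs_norm h.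
  apply: fs_norm_le => [|t]; first by rewrite mulr_ge0 ?fs_norm_ge0.
  by rewrite fspaceZ normrZ ler_wpM2l ?fs_norm_ub.
apply/eqP; rewrite eq_le le/=.
have [->|a0] := eqVneq a 0; first by rewrite normr0 mul0r.
rewrite -ler_pdivlMl ?normr_gt0// -normfV.
by apply: le_trans (le _ _); rewrite scalerA mulVf// scale1r.
Qed.

Lemma fs_norm0_eq0 f : fs_norm f = 0 -> f = 0.
Proof.
move=> f0; apply: fspace_ext => t; apply/normr0_eq0/eqP.
by rewrite eq_le normr_ge0 andbT -f0 fs_norm_ub.
Qed.

HB.instance Definition _ :=
  Lmodule_isNormed.Build R fspace fs_normD fs_normZ fs_norm0_eq0.

Lemma fspace_ub f t : `|f t| <= `|f|. Proof. exact: fs_norm_ub. Qed.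

Lemma fspace_le f M : 0 <= M -> (forall t, `|f t| <= M) -> `|f| <= M.
Proof. exact: fs_norm_le. Qed.

Lemma fspace_complete (F : set_system fspace) : ProperFilter F -> cauchy F -> cvg F.
Proof.
apply: fast_complete => u fu.
have cu t : exists l : fs_fam t, (fun n => u n t) @ \oo --> l.
  have /fast_cvg/cvg_ex[l ul] : fast (fun n => u n t).
    by move=> n; rewrite -fspaceB (le_trans (fspace_ub _ _)).
  by exists l.
pose g t := sval (cid (cu t)).
have gu t n : `|g t - u n t| <= 2 * 2^-1 ^+ n.
  apply: (@fast_lim _ _ (fun n => u n t)); last exact: (svalP (cid (cu t))).
  by move=> k; rewrite -fspaceB (le_trans (fspace_ub _ _)).
have bg : exists M, forall t, `|g t| <= M.
  exists (2 + `|u 0%N|) => t; rewrite -(subrK (u 0%N t) (g t)).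
  rewrite (le_trans (ler_normD _ _))// lerD ?fspace_ub//.
  by rewrite (le_trans (gu _ _))// expr0 mulr1.
have Pg : fs_cond g.
  apply: fs_cond_closed => e /half_small[n hn]; exists (u n); first exact: fs_mem.
  by move=> t; rewrite (le_trans (gu t n))// ltW.
apply/cvg_ex; exists (FSpace bg Pg); apply/cvgrPdist_lt => e e0.
have [n hn] := half_small e0; exists n => // m /= nm.
rewrite (le_lt_trans _ hn)//; apply: fspace_le => [|t].
  by rewrite mulr_ge0// exprn_ge0// invr_ge0.
rewrite fspaceB (le_trans (gu t m))// ler_wpM2l//.
by rewrite ler_wiXn2l ?invr_ge0// ?invf_le1 ?ler1n.
Qed.

HB.instance Definition _ := Uniform_isComplete.Build fspace fspace_complete.

Lemma fs_eval_linear t : linear (fun f : fspace => f t).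
Proof. by move=> a f g; rewrite fspaceD fspaceZ. Qed.

Lemma fs_eval_bounded t : exists M, forall f : fspace, `|f t| <= M * `|f|.
Proof. by exists 1 => f; rewrite mul1r fspace_ub. Qed.

Definition fs_eval t : bop fspace (fs_fam t) :=
  Bop (fs_eval_linear t) (fs_eval_bounded t).

Lemma fs_evalE t f : fs_eval t f = f t. Proof. by []. Qed.

End space.

End function_spaces.

Section hat.
Context {R : realType} {kappa : Type} (kinf : infinite_set [set: kappa]).
Variable S : @funsys R.
Implicit Types (F : kap kinf (fspace S)) (f : fspace S).

(** The evaluations compare an element of the kappa-space of a space of families
    with families. *)
Definition hat F t : kap kinf (fs_fam t) := kmap kinf (fs_eval t) F.

Lemma hat_linear t : linear (hat^~ t).
Proof. by move=> a F G; rewrite /hat bopD bopZ. Qed.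

Lemma hatB F G t : hat (F - G) t = hat F t - hat G t.
Proof. by rewrite /hat bopB. Qed.

Lemma hat_iota f t : hat (kiota kinf _ f) t = kiota kinf _ (f t).
Proof. by rewrite /hat kmap_iota. Qed.

Lemma hat_le F t : `|hat F t| <= `|F|.
Proof.
apply: kap_norm_le => // p; rewrite kmapE (le_trans (kval_ub _ _))// ler_wpM2l//.
by apply: dual_norm_le => // f; rewrite transposeE (le_trans (dual_ub _ _))// ler_wpM2l// fspace_ub.
Qed.

Lemma hatE F t p : kval (hat F t) p = kval F (transpose (fs_eval t) p).
Proof. exact: kmapE. Qed.

(** In general an element of the kappa-space may be invisible to all evaluations;
    this property excludes it. *)
Definition hat_norming := forall F s, 0 <= s -> (forall t, `|hat F t| <= s) -> `|F| <= s.

End hat.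

Lemma infinite_injection T (A : set T) : infinite_set A ->
  exists g : nat -> T, injective g /\ forall n, A (g n).
Proof.
elim/Ppointed: T => T in A *; first by rewrite emptyE => /(_ (finite_set0 _)).
move=> /infiniteP/ppcard_leP[g]; exists g; split; last by move=> n; exact: funS.
by move=> m n; apply: (@inj _ _ _ g); rewrite inE.
Qed.

Section countable_conditions.
Context {R : realType} {kappa : Type} (kinf : infinite_set [set: kappa]).
Implicit Types X : completeNormedModType R.

Lemma countable_card_le T (A : set T) : countable A -> (A #<= [set: kappa])%card.
Proof. by move=> cA; apply: card_le_trans cA _; exact/infiniteP. Qed.

Lemma kval_agree_countable X (F : kap kinf X) (A : set (dual X)) : countable A ->
  exists x, forall f, A f -> kval F f = f x.
Proof. by move=> /countable_card_le; exact: kval_agree. Qed.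

Lemma kap_norm_gt X (F : kap kinf X) e : 0 <= e -> e < `|F| ->
  exists f, e * `|f| < `|kval F f|.
Proof.
move=> e0 eF; apply: contrapT => h; move: eF; rewrite ltNge => /negP; apply.
by apply: kap_norm_le => // f; rewrite leNgt; apply/negP => ef; apply: h; exists f.
Qed.

Lemma dual_norm_gt X (f : dual X) e : e < `|f| -> exists2 x, `|x| <= 1 & e < f x.
Proof.
move=> ef; apply: contrapT => h.
have fx x : `|x| <= 1 -> f x <= e.
  by move=> x1; rewrite leNgt; apply/negP => efx; apply: h; exists x.
have e0 : 0 <= e by rewrite (le_trans _ (fx 0 _)) ?linear0 ?normr0.
move: ef; rewrite ltNge => /negP; apply; apply: dual_norm_le => // x.
have [->|x0] := eqVneq x 0; first by rewrite linear0 !normr0 mulr0.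
have g (y : X) : `|y| = `|x| -> f y <= e * `|x|.
  move=> yx; have := fx (`|x|^-1 *: y).
  rewrite normrZ normfV normr_id yx mulVf ?normr_eq0// lexx => /(_ isT).
  by rewrite linearZ/= -[_ *: _]/(_ * _) ler_pdivrMl ?normr_gt0// mulrC.
by rewrite ler_norml lerNl g// -linearN/= g// normrN.
Qed.

End countable_conditions.

(** * c_0-sums *)

Section c0_sum.
Context {R : realType} (I : choiceType) (X : I -> completeNormedModType R).

Definition c0_cond (f : forall t, X t) :=
  forall e : R, 0 < e -> finite_set [set t | e < `|f t|].

Lemma c0_cond0 : c0_cond (fun t => 0).
Proof.
move=> e e0; apply: sub_finite_set (finite_set0 I) => t /=.
by rewrite normr0 ltNge (ltW e0).
Qed.

Lemma c0_condP a f g : c0_cond f -> c0_cond g -> c0_cond (fun t => a *: f t + g t).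
Proof.
move=> cf cg e e0; have a0 : 0 < `|a| + 1 by rewrite ltr_wpDl.
have e1 : 0 < e / 2 / (`|a| + 1) by rewrite !divr_gt0.
have e2 : 0 < e / 2 by rewrite divr_gt0.
apply: (@sub_finite_set _ _ ([set t | e / 2 / (`|a| + 1) < `|f t|] `|`
  [set t | e / 2 < `|g t|])); last by rewrite finite_setU; split; [exact: cf|exact: cg].
move=> t /= et; apply: contrapT => /not_orP[/negP + /negP].
rewrite -!leNgt ler_pdivlMr// => h1 h2; move: et; apply/negP; rewrite -leNgt.
rewrite (le_trans (ler_normD _ _))// normrZ.
have : `|a| * `|f t| <= (`|a| + 1) * `|f t| by rewrite ler_wpM2r// lerDl.
by lra.
Qed.

Lemma c0_cond_closed f :
  (forall e : R, 0 < e -> exists2 g, c0_cond g & forall t, `|f t - g t| <= e) -> c0_cond f.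
Proof.
move=> h e e0; have e2 : 0 < e / 2 by rewrite divr_gt0.
have [g cg fg] := h _ e2; apply: sub_finite_set (cg _ e2) => t /= et.
have := ler_normD (f t - g t) (g t); rewrite subrK; have := fg t; lra.
Qed.

Definition c0_sys := Funsys c0_cond0 c0_condP c0_cond_closed.

Definition c0 : completeNormedModType R := fspace c0_sys.

Lemma c0_mem (f : c0) e : 0 < e -> finite_set [set t | e < `|f t|].
Proof. exact: (fs_mem f). Qed.

End c0_sum.

Section c0_dual.
Context {R : realType} (I : choiceType) (X : I -> completeNormedModType R).
Implicit Types (t : I) (p : dual (c0 X)).

Definition c0_single_fun t (v : X t) : forall s, X s :=
  fun s => if eqP : reflect (t = s) (t == s) is ReflectT e then ecast z (X z) e v else 0.

Lemma c0_singleE t (v : X t) : c0_single_fun v t = v.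
Proof. by rewrite /c0_single_fun; case: eqP => // e; rewrite (eq_axiomK e). Qed.

Lemma c0_singleN t s (v : X t) : t != s -> c0_single_fun v s = 0.
Proof. by rewrite /c0_single_fun; case: eqP. Qed.

Lemma c0_single_linear t (s : I) : linear (fun v : X t => c0_single_fun v s).
Proof.
move=> a v w; have [e|ts] := eqVneq t s; last by rewrite !c0_singleN// scaler0 addr0.
by case: _ / e; rewrite !c0_singleE.
Qed.

Lemma c0_single_norm t (v : X t) s : `|c0_single_fun v s| <= `|v|.
Proof.
have [e|ts] := eqVneq t s; last by rewrite c0_singleN// normr0.
by case: _ / e; rewrite c0_singleE.
Qed.

Lemma c0_single_cond t (v : X t) : c0_cond (c0_single_fun v).
Proof.
move=> e e0; apply: sub_finite_set (finite_set1 t) => s /=.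
have [st _|ts] := eqVneq s t; first exact: st.
by rewrite c0_singleN 1?eq_sym// normr0 => /(lt_trans e0); rewrite ltxx.
Qed.

Lemma c0_single_bd t (v : X t) : exists M, forall s, `|c0_single_fun v s| <= M.
Proof. by exists `|v| => s; exact: c0_single_norm. Qed.

Definition c0_single_el t (v : X t) : c0 X :=
  @FSpace R (c0_sys X) _ (c0_single_bd v) (c0_single_cond v).

Lemma c0_single_el_linear t : linear (@c0_single_el t).
Proof.
move=> a v w; apply: fspace_ext => s; rewrite fspaceD fspaceZ.
exact: c0_single_linear.
Qed.

Lemma c0_single_el_bounded t : exists M, forall v : X t, `|c0_single_el v| <= M * `|v|.
Proof.
by exists 1 => v; rewrite mul1r; apply: fspace_le => // s; exact: c0_single_norm.
Qed.

Definition c0_single t : bop (X t) (c0 X) :=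
  Bop (@c0_single_el_linear t) (@c0_single_el_bounded t).

Definition c0_part p t : dual (X t) := transpose (c0_single t) p.

Lemma c0_sum_single (r : seq I) (v : forall t, X t) s : uniq r ->
  (\sum_(t <- r) c0_single t (v t) : c0 X) s = if s \in r then v s else 0.
Proof.
elim: r => [|t r ih] /=; first by rewrite big_nil.
case/andP => tr ur; rewrite big_cons fspaceD ih// in_cons.
have [e|st] := eqVneq s t.
  by case: _ / e in tr *; rewrite (negbTE tr) addr0; exact: c0_singleE.
by rewrite [X in X + _]c0_singleN 1?eq_sym// add0r.
Qed.

Lemma c0_part_sum p (r : seq I) : uniq r -> \sum_(t <- r) `|c0_part p t| <= `|p|.
Proof.
move=> ur; apply/ler_addgt0Pl => e e0.
pose d := e / (size r).+1%:R.
have d0 : 0 < d by rewrite divr_gt0.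
have hv t : exists v, `|v| <= 1 /\ `|c0_part p t| - d < c0_part p t v.
  have [|v v1 vd] := @dual_norm_gt _ _ (c0_part p t) (`|c0_part p t| - d).
    by rewrite ltrBlDr ltrDl.
  by exists v.
pose v t := sval (cid (hv t)).
have v1 t : `|v t| <= 1 := (svalP (cid (hv t))).1.
have vd t : `|c0_part p t| - d < c0_part p t (v t) := (svalP (cid (hv t))).2.
have : p (\sum_(t <- r) c0_single t (v t)) <= `|p|.
  rewrite (le_trans (ler_norm _))// (le_trans (dual_ub _ _))// ler_piMr//.
  apply: fspace_le => // s; rewrite c0_sum_single//.
  by case: ifP; rewrite ?normr0// => _; exact: v1.
rewrite linear_sum/= => h.
have : \sum_(t <- r) (`|c0_part p t| - d) <= \sum_(t <- r) c0_part p t (v t).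
  by apply: ler_sum => t _; exact/ltW/vd.
rewrite sumrB big_const_seq count_predT iter_addr_0.
have : d *+ size r <= e.
  rewrite -mulr_natr /d mulrAC ler_pdivrMr// ler_pM2l// ler_nat; exact: leqnSn.
by move: h; rewrite /c0_part /=; lra.
Qed.

Lemma c0_part_countable p : countable [set t | c0_part p t != 0].
Proof.
have fin n : finite_set [set t | (n.+1%:R)^-1 < `|c0_part p t|].
  apply: contrapT => /(infinite_set_fset (Num.truncn (n.+1%:R * `|p|)).+1)[B BA sB].
  have {BA}BA t : t \in finmap.enum_fset B -> n.+1%:R^-1 < `|c0_part p t| by exact: BA.
  have n0 : 0 < n.+1%:R :> R by [].
  have : \sum_(t <- finmap.enum_fset B) (n.+1%:R^-1 : R) <= `|p|.
    rewrite (le_trans _ (c0_part_sum p (finmap.fset_uniq B)))//.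
    by rewrite big_seq [leRHS]big_seq; apply: ler_sum => t /BA/ltW.
  rewrite big_const_seq count_predT iter_addr_0 -[leLHS]mulr_natl ler_pdivrMr//.
  rewrite leNgt => /negP; apply; rewrite mulrC.
  by rewrite (lt_le_trans (Num.Theory.truncnS_gt _))// ler_nat.
apply: (@sub_countable _ _ _ (\bigcup_n [set t | (n.+1%:R)^-1 < `|c0_part p t|])).
  apply: subset_card_le => t /= pt0; have pt : 0 < `|c0_part p t| by rewrite normr_gt0.
  exists (Num.truncn (`|c0_part p t|^-1)) => //=.
  by rewrite invf_plt ?posrE// Num.Theory.truncnS_gt.
by apply: bigcup_countable => // n _; exact: finite_set_countable.
Qed.

End c0_dual.

Section c0_kappa.
Context {R : realType} {kappa : Type} (kinf : infinite_set [set: kappa]).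
Context (I : choiceType) (X : I -> completeNormedModType R).

Let chat (F : kap kinf (c0 X)) t : kap kinf (X t) := @hat _ _ kinf (c0_sys X) F t.

Let chat_le F t : `|chat F t| <= `|F|. Proof. exact (@hat_le R kappa kinf (c0_sys X) F t). Qed.

Let chat_linear t : linear (chat^~ t). Proof. exact (@hat_linear R kappa kinf (c0_sys X) t). Qed.

Let chatB F G t : chat (F - G) t = chat F t - chat G t. Proof. exact (@hatB R kappa kinf (c0_sys X) F G t). Qed.

Let chat_iota f t : chat (kiota kinf _ f) t = kiota kinf _ (f t).
Proof. exact (@hat_iota R kappa kinf (c0_sys X) f t). Qed.

(** A functional p on a c_0-sum is the sum of its components, countably many of
    which are nonzero, and the norms of the components add up to at most |p|. So
    F p is computed from an element of the sum that agrees with F on p and on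
    these components. *)
Lemma c0_hat_norming : hat_norming kinf (c0_sys X).
Proof.
move=> F s s0 Fs; apply: kap_norm_le => // p.
pose A := [set transpose (@fs_eval R (c0_sys X) t) (c0_part p t) | t in
  [set t | c0_part p t != 0]].
have [f Ff] : exists f, forall q, (A `|` [set p]) q -> kval F q = q f.
  apply/kval_agree/card_leU1/countable_card_le => //.
  exact: card_le_trans (card_image_le _ _) (c0_part_countable p).
have pf : kval F p = p f by apply: Ff; right.
have Fp t : kval (chat F t) (c0_part p t) = c0_part p t (f t).
  have [->|pt] := eqVneq (c0_part p t) 0; first by rewrite linear0.
  by rewrite hatE Ff//; left; exists t.
rewrite pf; apply/ler_addgt0Pl => e e0.
have p0 : 0 < `|p| + 1 by rewrite ltr_wpDl.
have e1 : 0 < e / (`|p| + 1) by rewrite divr_gt0.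
have /finite_seqP[r' rE] := c0_mem f e1.
pose r := undup r'; pose g : c0 X := \sum_(t <- r) c0_single X t (f t).
have gE t : g t = if t \in r then f t else 0 by rewrite /g c0_sum_single// undup_uniq.
have fg : `|f - g| <= e / (`|p| + 1).
  apply: fspace_le => [|t]; first exact: ltW.
  rewrite fspaceB gE mem_undup; case: ifPn => [_|tr]; first by rewrite subrr normr0 ltW.
  rewrite subr0 leNgt; apply/negP => ft; move/negP: tr; apply.
  have : [set t | e / (`|p| + 1) < `|f t|] t by [].
  by rewrite rE.
have -> : p f = p (f - g) + p g by rewrite -linearD subrK.
rewrite (le_trans (ler_normD _ _))// lerD//.
  rewrite (le_trans (dual_ub _ _))// (le_trans (ler_wpM2l _ fg))//.
  by rewrite mulrA ler_pdivrMr// mulrC ler_wpM2l ?(ltW e0)// lerDl.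
rewrite /g linear_sum/= (le_trans (ler_norm_sum _ _ _))//.
apply: (@le_trans _ _ (\sum_(t <- r) s * `|c0_part p t|)).
  apply: ler_sum => t _; rewrite -[X in `|X|]/(c0_part p t (f t)) -Fp.
  by rewrite (le_trans (kval_ub _ _))// ler_wpM2r.
by rewrite -mulr_sumr ler_wpM2l// c0_part_sum// undup_uniq.
Qed.

(** Infinitely many large components of F, witnessed by countably many
    functionals, would be shared by an element of the c_0-sum. *)
Lemma c0_hat_cond F : @c0_cond R I (fun t => kap kinf (X t)) (chat F).
Proof.
move=> e e0; apply: contrapT => /infinite_injection[g [gI hg]].
pose p n := sval (cid (kap_norm_gt (ltW e0) (hg n))).
have pF n : e * `|p n| < `|kval (hat F (g n)) (p n)|.
  exact: (svalP (cid (kap_norm_gt (ltW e0) (hg n)))).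
have : countable (range (fun n => transpose (@fs_eval R (c0_sys X) (g n)) (p n))).
  by apply: card_le_trans (card_image_le _ _) _; exact: card_lexx.
move=> /(kval_agree_countable F)[f Ff].
have fg n : e < `|f (g n)|.
  have := pF n; rewrite hatE Ff; last by exists n.
  rewrite transposeE fs_evalE => /lt_le_trans/(_ (dual_ub _ _)).
  have [p0|p0] := eqVneq `|p n| 0; first by rewrite p0 mulr0 mul0r ltxx.
  by rewrite mulrC ltr_pM2l// lt0r p0 normr_ge0.
apply: infinite_nat; apply: sub_finite_set (finite_preimage _ (c0_mem f e0)) => [n _|].
  exact: fg.
by move=> m n _ _; exact: gI.
Qed.

Lemma emb_kap_c0 : emb (kap kinf (c0 X)) (c0 (fun t => kap kinf (X t))).
Proof.
have bd F : exists M, forall t, `|chat F t| <= M.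
  by exists `|F| => t; exact: chat_le.
pose T F : c0 (fun t => kap kinf (X t)) :=
  @FSpace R (c0_sys (fun t => kap kinf (X t))) _ (bd F) (c0_hat_cond F).
have lT : linear T.
  move=> a F G; apply: fspace_ext => t; rewrite fspaceD fspaceZ.
  exact: (@chat_linear t a F G).
have bT : exists M, forall F, `|T F| <= M * `|F|.
  by exists 1 => F; rewrite mul1r; apply: fspace_le => // t; exact: chat_le.
exists (Bop lT bT), 1 => // F; rewrite mul1r; apply: c0_hat_norming => // t.
exact: (fspace_ub (T F)).
Qed.

Lemma emb_SP_c0 : emb (SP kinf (c0 X)) (c0 (fun t => SP kinf (X t))).
Proof.
have le F t : `|SPquot kinf _ (chat F t)| <= `|chat F t|.
  exact: qproj_le.
have bd F : exists M, forall t, `|SPquot kinf _ (chat F t)| <= M.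
  by exists `|F| => t; rewrite (le_trans (le F t))// chat_le.
have cT F : c0_cond (fun t => SPquot kinf _ (chat F t)).
  move=> e e0; apply: sub_finite_set (c0_hat_cond F e0) => t /= /lt_le_trans; apply.
  exact: le.
pose T F : c0 (fun t => SP kinf (X t)) :=
  @FSpace R (c0_sys (fun t => SP kinf (X t))) _ (bd F) (cT F).
have lT : linear T.
  move=> a F G; apply: fspace_ext => t; rewrite fspaceD fspaceZ.
  rewrite -[LHS]/(SPquot kinf _ (chat (a *: F + G) t)).
  by rewrite (@chat_linear t) bopD bopZ.
have bT : exists M, forall F, `|T F| <= M * `|F|.
  exists 1 => F; rewrite mul1r; apply: fspace_le => // t.
  by rewrite (le_trans (le F t))// chat_le.
apply: (@emb_SP_of _ _ kinf (c0 X) _ (Bop lT bT) 1) => //.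
  move=> f; apply: fspace_ext => t;
  rewrite -[LHS]/(SPquot kinf _ (chat (kiota kinf _ f) t)).
  by rewrite chat_iota SPquot_iota.
move=> F e TFe; have e0 : 0 < e by exact: le_lt_trans TFe.
have hx t : exists x : X t, `|chat F t - kiota kinf _ x| < e.
  by apply: SPquot_lt; exact: le_lt_trans (fspace_ub (T F) t) TFe.
(* F is approximated by a finitely supported family: where F is small, 0 will do. *)
pose f t := if e < `|chat F t| then sval (cid (hx t)) else 0.
have fF t : `|chat F t - kiota kinf _ (f t)| <= e.
  rewrite /f; case: ltP => [_|h]; last by rewrite bop0 subr0.
  by have := svalP (cid (hx t)) => /ltW.
have bf : exists M, forall t, `|f t| <= M.
  exists (`|F| + e) => t; rewrite -(kiota_norm kinf).
  rewrite -[kiota _ _ _](subKr (chat F t)).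
  by apply: (le_trans (ler_normB _ _)); apply: lerD; [exact: chat_le|exact: fF].
have cf : c0_cond f.
  move=> d d0; apply: sub_finite_set (c0_hat_cond F e0) => t /=.
  by rewrite /f; case: ifP => // _; rewrite normr0 ltNge (ltW d0).
exists (@FSpace R (c0_sys X) _ bf cf : c0 X); rewrite mul1r.
apply: c0_hat_norming => [|t]; first exact: ltW.
rewrite -[X in `|X|]/(chat _ t) chatB chat_iota; exact: fF.
Qed.

End c0_kappa.

(** * Complete linear orders, sides of points *)

Section sides.
Context {d : Order.disp_t} {L : orderType d}.
Implicit Types (a b x y z : L) (s : bool).

(** Left and right are treated at once: the side s = true of a point x consists
    of the points below x, the side s = false of the points above x, and
    slt s a y means that on that side y is nearer to x than a. *)
Definition slt s a b := if s then (a < b)%O else (b < a)%O.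

Lemma slt_irr s x : slt s x x = false.
Proof. by case: s; rewrite /slt ltxx. Qed.

Lemma slt_trans s : transitive (slt s).
Proof. by case: s => y x z; rewrite /slt; [exact: lt_trans|move=> /[swap]; exact: lt_trans]. Qed.

Lemma slt_total s x y : [|| slt s x y, x == y | slt s y x].
Proof. by case: s; rewrite /slt; case: (ltgtP x y). Qed.

Lemma slt_neg s x y : slt (~~ s) x y = slt s y x. Proof. by case: s. Qed.

Lemma slt_asym s x y : slt s x y -> ~~ slt s y x.
Proof. by move=> xy; apply/negP => /(slt_trans xy); rewrite slt_irr. Qed.

Lemma sltN_trans s x y z : ~~ slt s y x -> slt s y z -> slt s x z.
Proof.
move=> yx yz; have /or3P[xy|/eqP->//|] := slt_total s x y; last by rewrite (negbTE yx).
exact: slt_trans xy yz.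
Qed.

Lemma slt_transN s x y z : slt s x y -> ~~ slt s z y -> slt s x z.
Proof.
move=> xy zy; have /or3P[yz|/eqP<-//|] := slt_total s y z; last by rewrite (negbTE zy).
exact: slt_trans xy yz.
Qed.

Definition smax s a b := if slt s a b then b else a.

Lemma smax_lt s a b x : slt s (smax s a b) x = slt s a x && slt s b x.
Proof.
rewrite /smax; case: ifPn => ab.
  by case bx: (slt s b x); rewrite ?andbF// (slt_trans ab bx).
by case ax: (slt s a x); rewrite //= (sltN_trans ab ax).
Qed.

Lemma lt_smax s a b x : slt s a x -> slt s b x -> slt s (smax s a b) x.
Proof. by rewrite smax_lt => -> ->. Qed.

Definition side_limit s x :=
  (exists a, slt s a x) /\ forall a, slt s a x -> exists2 y, slt s a y & slt s y x.

Definition side_nbhs s x : set_system L :=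
  filter_from [set a | slt s a x] (fun a => [set y | slt s a y /\ slt s y x]).

Lemma side_nbhs_filter s x : (exists a, slt s a x) -> Filter (side_nbhs s x).
Proof.
move=> [a0 a0x]; apply: filter_from_filter; first by exists a0.
move=> a b ax bx; exists (smax s a b); first exact: lt_smax.
by move=> y [+ yx]; rewrite smax_lt => /andP[ay By].
Qed.

Lemma side_nbhs_proper s x : side_limit s x -> ProperFilter (side_nbhs s x).
Proof.
move=> [ex dx]; apply: Build_ProperFilter_ex; last exact: side_nbhs_filter.
by move=> A [a /dx[y ay yx] aA]; exists y; apply: aA.
Qed.

Definition complete_order := forall A : set L, exists m,
  (forall a, A a -> (a <= m)%O) /\ forall u, (forall a, A a -> (a <= u)%O) -> (m <= u)%O.

Hypothesis Lc : complete_order.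

Lemma complete_inf (A : set L) : exists m,
  (forall a, A a -> (m <= a)%O) /\ forall u, (forall a, A a -> (u <= a)%O) -> (u <= m)%O.
Proof.
have [m [mub mleast]] := Lc [set u | forall a, A a -> (u <= a)%O].
by exists m; split=> [a Aa|u]; [apply: mleast => u; exact|exact: mub].
Qed.

Lemma complete_side s (A : set L) : exists m,
  (forall a, A a -> ~~ slt s m a) /\
  forall u, (forall a, A a -> ~~ slt s u a) -> ~~ slt s u m.
Proof.
case: s; rewrite /slt.
  have [m [mub ml]] := Lc A; exists m; split=> [a Aa|u hu]; rewrite -leNgt ?mub//.
  by apply: ml => a Aa; rewrite leNgt hu.
have [m [mub ml]] := complete_inf A; exists m; split=> [a Aa|u hu]; rewrite -leNgt ?mub//.
by apply: ml => a Aa; rewrite leNgt hu.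
Qed.

(** The point z is the supremum of the sequence in the direction of the side. *)
Lemma side_seq s (a : nat -> L) x : (forall n, slt s (a n) (a n.+1)) ->
  (forall n, slt s (a n) x) -> exists z,
  [/\ side_limit s z, forall n, slt s (a n) z & forall b, slt s b z -> exists n, slt s b (a n)].
Proof.
move=> aS ax; have [z [zub zl]] := complete_side s (range a).
have az n : slt s (a n) z.
  by apply: slt_transN (aS n) _; apply: zub; exists n.+1.
have cof b : slt s b z -> exists n, slt s b (a n).
  move=> bz; apply: contrapT => h; suff : ~~ slt s b z by rewrite bz.
  by apply: zl => _ [n _ <-]; apply/negP => ban; apply: h; exists n.
exists z; split=> //; split; first by exists (a 0%N).
by move=> b /cof[n ban]; exists (a n).
Qed.

(** * Initial segments *)

Record downset := Downset {
  ds_set :> L -> Prop ;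
  ds_down : forall a b, ds_set b -> (a <= b)%O -> ds_set a }.

Implicit Types (C D E : downset).

Definition ds_sub D E := forall x, D x -> E x.

Lemma downset_total D E : ds_sub D E \/ ds_sub E D.
Proof.
have [DE|/existsNP[x /not_implyP[Dx Ex]]] := pselect (forall x, D x -> E x); first by left.
right=> y Ey; have [yx|xy] := leP y x; first exact: ds_down Dx yx.
by case: Ex; exact: ds_down Ey (ltW xy).
Qed.

Definition ds0 := @Downset (fun _ => False) (fun a b H _ => H).

Definition dsT := @Downset (fun _ => True) (fun a b _ _ => I).

Lemma ds_lt_subproof x : forall a b : L, (b < x)%O -> (a <= b)%O -> (a < x)%O.
Proof. by move=> a b + ab; exact: le_lt_trans. Qed.

Definition ds_lt x := @Downset (fun y => (y < x)%O) (@ds_lt_subproof x).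

Lemma ds_le_subproof x : forall a b : L, (b <= x)%O -> (a <= b)%O -> (a <= x)%O.
Proof. by move=> a b + ab; exact: le_trans. Qed.

Definition ds_le x := @Downset (fun y => (y <= x)%O) (@ds_le_subproof x).

(** This replaces covering arguments: P is carried from the left end of the line
    across each point and a bit beyond it, and completeness leaves no place at
    which the process could stop. *)
Lemma downset_ind (P : downset -> Prop) :
  (forall x, (forall y, (x <= y)%O) -> P (ds_lt x)) ->
  (forall x, P (ds_lt x) -> P (ds_le x)) ->
  (forall x y, (y < x)%O -> exists2 a, (a < x)%O & P (ds_le a) -> P (ds_lt x)) ->
  (forall x y, (x < y)%O -> exists2 b, (x < b)%O &
     forall z, (x < z)%O -> (z <= b)%O -> P (ds_le x) -> P (ds_lt z)) ->
  exists2 x, (forall y, (y <= x)%O) & P (ds_le x).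
Proof.
move=> Pbot Pstep Pleft Pright.
have [m [mub ml]] := Lc [set x | forall y, (y <= x)%O -> P (ds_le y)].
have below y : (y < m)%O -> P (ds_le y).
  move=> ym; apply: contrapT => Py; move: ym; rewrite ltNge => /negP; apply.
  by apply: ml => x Ax; rewrite leNgt; apply/negP => yx; apply: Py; apply: Ax (ltW yx).
have Pm : P (ds_le m).
  apply: Pstep; have [[y ym]|h] := pselect (exists y, (y < m)%O).
    by have [a am] := Pleft _ _ ym; apply; exact: below.
  by apply: Pbot => y; rewrite leNgt; apply/negP => ym; apply: h; exists y.
exists m => // y; rewrite leNgt; apply/negP => my.
have [b mb Pb] := Pright _ _ my.
suff /mub : [set x | forall y, (y <= x)%O -> P (ds_le y)] b by rewrite leNgt mb.
move=> z zb; have [zm|mz] := leP z m.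
  by move: zm; rewrite le_eqVlt => /predU1P[->//|]; exact: below.
by apply: Pstep; exact: Pb.
Qed.

End sides.

(** * Regulated functions on a linear order *)

Section regulated.
Context {R : realType} {d : Order.disp_t} (L : orderType d).

Section space.
Variable X : completeNormedModType R.
Implicit Types (a b x y z : L) (s : bool) (t : L * option bool).

(** A function with one-sided limits is recorded together with its limits: the
    index (x, None) holds the value at x and (x, Some s) the limit at x from the
    side s, or 0 if x is not a limit from that side. *)
Definition reg_cond (f : L * option bool -> X) := forall x s,
  (side_limit s x -> f (y, None) @[y --> side_nbhs s x] --> f (x, Some s)) /\
  (~ side_limit s x -> f (x, Some s) = 0).

Lemma reg_cond0 : reg_cond (fun=> 0).
Proof.
by move=> x s; split=> // sx; have PF := side_nbhs_proper sx; exact: cvg_cst.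
Qed.

Lemma reg_condP (a : R) (f g : L * option bool -> X) :
  reg_cond f -> reg_cond g -> reg_cond (fun t => a *: f t + g t).
Proof.
move=> rf rg x s; split=> sx; last by rewrite (rf x s).2// (rg x s).2// scaler0 addr0.
have PF := side_nbhs_proper sx.
by apply: cvgD; [apply: cvgZr; exact: (rf x s).1|exact: (rg x s).1].
Qed.

Lemma reg_cond_closed (f : L * option bool -> X) :
  (forall e : R, 0 < e -> exists2 g, reg_cond g & forall t, `|f t - g t| <= e) ->
  reg_cond f.
Proof.
move=> h x s; split=> sx; last first.
  apply/normr0_eq0/eqP; rewrite eq_le normr_ge0 andbT.
  apply/ler_addgt0Pl => e e0; rewrite addr0; have [g rg fg] := h e e0.
  by have := fg (x, Some s); rewrite (rg x s).2// subr0.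
have PF := side_nbhs_proper sx.
apply/cvgrPdist_le => e e0; have e3 : 0 < e / 3 by rewrite divr_gt0.
have [g rg fg] := h _ e3.
have /cvgrPdist_le /(_ _ e3) := (rg x s).1 sx.
apply: filterS => y gy.
have h1 := fg (x, Some s); have h2 := fg (y, None).
rewrite -(subrKA (g (x, Some s))) (le_trans (ler_normD _ _))//.
rewrite -(subrKA (g (y, None)) (g (x, Some s))).
have := ler_normD (g (x, Some s) - g (y, None)) (g (y, None) - f (y, None)).
rewrite [`|g (y, None) - _|]distrC; lra.
Qed.

Definition regsys := Funsys reg_cond0 reg_condP reg_cond_closed.

Definition reg : completeNormedModType R := fspace regsys.

Implicit Types (f g : reg).

Lemma reg_near f x s e : side_limit s x -> 0 < e -> exists2 a, slt s a x &
  forall y, slt s a y -> slt s y x -> `|f (y, None) - f (x, Some s)| <= e.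
Proof.
move=> sx e0; have PF := side_nbhs_proper sx.
have /cvgrPdist_le /(_ _ e0)[a ax aP] := (fs_mem f x s).1 sx.
by exists a => // y ay yx; rewrite distrC; exact: aP.
Qed.

Lemma reg_nlim f x s : ~ side_limit s x -> f (x, Some s) = 0.
Proof. exact: (fs_mem f x s).2. Qed.

Lemma reg_lim_le f x s b (c : X) (e : R) : side_limit s x -> slt s b x ->
  (forall y, slt s b y -> slt s y x -> `|f (y, None) - c| <= e) ->
  `|f (x, Some s) - c| <= e.
Proof.
move=> sx bx h; apply/ler_addgt0Pl => e' e'0.
have [a ax aP] := reg_near f sx e'0.
have [y] := sx.2 _ (lt_smax ax bx); rewrite smax_lt => /andP[ay By] yx.
rewrite -(subrKA (f (y, None))) (le_trans (ler_normD _ _))// lerD ?h//.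
by rewrite distrC aP.
Qed.

Lemma reg_norm_le f e : 0 <= e -> (forall y, `|f (y, None)| <= e) -> `|f| <= e.
Proof.
move=> e0 fe; apply: fspace_le => // -[x [s|]]; last exact: fe.
have [sx|sx] := pselect (side_limit s x); last by rewrite reg_nlim// normr0.
have [[a ax] _] := sx; rewrite -[f _]subr0.
by apply: reg_lim_le sx ax _ => y _ _; rewrite subr0.
Qed.

Lemma reg_ext f g : (forall y, f (y, None) = g (y, None)) -> f = g.
Proof.
move=> fg; apply/eqP; rewrite -subr_eq0 -normr_eq0 eq_le normr_ge0 andbT.
by apply: reg_norm_le => // y; rewrite fspaceB fg subrr normr0.
Qed.

Lemma reg_mk (v : L -> X) M : (forall y, `|v y| <= M) ->
  (forall x s, side_limit s x -> exists l : X, v y @[y --> side_nbhs s x] --> l) ->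
  {f : reg | forall y, f (y, None) = v y}.
Proof.
move=> vM vl.
pose l x s := if pselect (side_limit s x) is left h then sval (cid (vl x s h)) else 0.
have lP x s : side_limit s x -> v y @[y --> side_nbhs s x] --> l x s.
  by move=> sx; rewrite /l; case: pselect => // h; exact: (svalP (cid (vl x s h))).
have l0 x s : ~ side_limit s x -> l x s = 0 by rewrite /l; case: pselect.
pose f t := if t.2 is Some s then l t.1 s else v t.1.
have rf : reg_cond f by move=> x s; split=> sx; [exact: lP|exact: l0].
have bf : exists M, forall t, `|f t| <= M.
  exists (`|M|) => -[x [s|]]; rewrite /f /=; last by rewrite (le_trans (vM _))// ler_norm.
  have [sx|/l0->] := pselect (side_limit s x); last by rewrite normr0.
  have PF := side_nbhs_proper sx; apply/ler_addgt0Pl => e e0.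
  have /cvgrPdist_le /(_ _ e0) /filter_ex[y ye] := lP _ _ sx.
  rewrite -(subrK (v y) (l x s)) (le_trans (ler_normD _ _))// lerD//.
  by rewrite (le_trans (vM _))// ler_norm.
by exists (@FSpace _ regsys f bf rf).
Qed.

Lemma reg_cst_lim (c : X) x s : side_limit s x ->
  exists l : X, (fun=> c) y @[y --> side_nbhs s x] --> l.
Proof. by move=> sx; have PF := side_nbhs_proper sx; exists c; exact: cvg_cst. Qed.

Definition cst_fun (c : X) : reg :=
  sval (@reg_mk (fun=> c) `|c| (fun=> lexx _) (@reg_cst_lim c)).

Lemma cst_funE c y : cst_fun c (y, None) = c.
Proof. by rewrite /cst_fun; case: reg_mk. Qed.

Lemma cst_fun_linear : linear cst_fun.
Proof.
by move=> a v w; apply: reg_ext => y; rewrite fspaceD fspaceZ !cst_funE.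
Qed.

Lemma cst_fun_bounded : exists M, forall c, `|cst_fun c| <= M * `|c|.
Proof.
by exists 1 => c; rewrite mul1r; apply: reg_norm_le => // y; rewrite cst_funE.
Qed.

Definition cst : bop X reg := Bop cst_fun_linear cst_fun_bounded.

Lemma cstE c y : cst c (y, None) = c. Proof. exact: cst_funE. Qed.

Implicit Types (C D E : downset (L := L)).

Definition cut_val D f y : X := if pselect (D y) then f (y, None) else 0.

Lemma cut_val_in D f y : D y -> cut_val D f y = f (y, None).
Proof. by rewrite /cut_val; case: (pselect (D y)). Qed.

Lemma cut_val_out D f y : ~ D y -> cut_val D f y = 0.
Proof. by rewrite /cut_val; case: (pselect (D y)). Qed.

Lemma cut_val_le D f y : `|cut_val D f y| <= `|f|.
Proof.
have [Dy|Dy] := pselect (D y); last by rewrite cut_val_out// normr0.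
by rewrite cut_val_in// fspace_ub.
Qed.

Lemma downset_side D s x : (exists a, slt s a x) ->
  exists2 a, slt s a x & (forall y, slt s a y -> slt s y x -> D y) \/
                         (forall y, slt s a y -> slt s y x -> ~ D y).
Proof.
move=> [a0 a0x]; case: s a0x; rewrite /slt => a0x.
  have [h|/existsNP[a /not_implyP[ax Da]]] := pselect (forall a, (a < x)%O -> D a).
    by exists a0 => //; left=> y _; exact: h.
  by exists a => //; right=> y ay _ Dy; apply: Da; exact: ds_down Dy (ltW ay).
have [[a xa Da]|h] := pselect (exists2 a, (x < a)%O & D a).
  by exists a => //; left=> y ya _; exact: ds_down Da (ltW ya).
by exists a0 => //; right=> y _ xy Dy; apply: h; exists y.
Qed.

Lemma cut_val_lim D f x s : side_limit s x ->
  exists l : X, cut_val D f y @[y --> side_nbhs s x] --> l.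
Proof.
move=> sx; have PF := side_nbhs_proper sx.
have [a ax [aD|aD]] := downset_side D sx.1.
  exists (f (x, Some s)); apply: cvg_trans ((fs_mem f x s).1 sx).
  by apply: near_eq_cvg; exists a => // y [ay yx]; rewrite cut_val_in//; exact: aD.
have cvg0 : (0 : X) @[_ --> side_nbhs s x] --> (0 : X) by exact: cvg_cst.
exists 0; apply: cvg_trans cvg0; apply: near_eq_cvg; exists a => // y [ay yx].
by rewrite cut_val_out//; exact: aD.
Qed.

Definition cut_fun D f : reg := sval (reg_mk (cut_val_le D f) (@cut_val_lim D f)).

Lemma cut_funE D f y : cut_fun D f (y, None) = cut_val D f y.
Proof. by rewrite /cut_fun; case: reg_mk. Qed.

Lemma cut_fun_linear D : linear (cut_fun D).
Proof.
move=> a f g; apply: reg_ext => y; rewrite fspaceD fspaceZ !cut_funE.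
have [Dy|Dy] := pselect (D y); first by rewrite !cut_val_in// fspaceD fspaceZ.
by rewrite !cut_val_out// scaler0 addr0.
Qed.

Lemma cut_fun_bounded D : exists M, forall f, `|cut_fun D f| <= M * `|f|.
Proof.
exists 1 => f; rewrite mul1r; apply: reg_norm_le => // y.
by rewrite cut_funE cut_val_le.
Qed.

Definition cut D : bop reg reg := Bop (@cut_fun_linear D) (@cut_fun_bounded D).

Lemma cut_in D f y : D y -> cut D f (y, None) = f (y, None).
Proof. by move=> Dy; rewrite [LHS]cut_funE cut_val_in. Qed.

Lemma cut_out D f y : ~ D y -> cut D f (y, None) = 0.
Proof. by move=> Dy; rewrite [LHS]cut_funE cut_val_out. Qed.

(** The pieces of the line are the differences of two initial segments. *)
Definition osc D E f (c : X) (e : R) := forall y, E y -> ~ D y -> `|f (y, None) - c| <= e.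

Hypothesis Lc : @complete_order _ L.

(** Near each point, and on either side of it, a regulated function is almost
    constant; by completeness finitely many pieces of small oscillation cover the
    line. The statement is the induction along these pieces. *)
Lemma regulated_ind f e (P : downset -> Prop) : 0 < e ->
  (forall D, (forall y, ~ D y) -> P D) ->
  (forall D E c, ds_sub D E -> osc D E f c e -> P D -> P E) ->
  P (dsT (L := L)).
Proof.
move=> e0 P0 PS.
have [||||x xT Px] := @downset_ind _ _ Lc P.
- by move=> x xb; apply: P0 => y; apply/negP; rewrite -leNgt.
- move=> x; apply: (PS _ _ (f (x, None))) => [y|y /= yx /negP]; first exact: ltW.
  rewrite -leNgt => xy; suff -> : y = x by rewrite subrr normr0 ltW.
  by apply/eqP; rewrite eq_le yx.
- move=> x y yx; have [sx|nx] := pselect (side_limit true x).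
    have [a ax fa] := reg_near f sx e0; exists a => //.
    apply: (PS _ _ (f (x, Some true))) => [z /= za|z /= zx /negP].
      exact: le_lt_trans ax.
    by rewrite -ltNge => az; exact: fa.
  have [a ax aP] : exists2 a, (a < x)%O & forall z, (z < x)%O -> (z <= a)%O.
    apply: contrapT => h; apply: nx; split; first by exists y.
    move=> a ax; apply: contrapT => h'; apply: h; exists a => // z zx.
    by rewrite leNgt; apply/negP => az; apply: h'; exists z.
  exists a => //; apply: (PS _ _ 0) => [z /= za|z /= /aP za /(_ za)//].
  exact: le_lt_trans ax.
- move=> x y xy; have [sx|nx] := pselect (side_limit false x).
    have [b xb fb] := reg_near f sx e0; exists b => // z xz zb.
    apply: (PS _ _ (f (x, Some false))) => [w /= wx|w /= wz /negP].
      exact: le_lt_trans xz.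
    by rewrite -ltNge => xw; apply: fb => //; exact: lt_le_trans zb.
  have [b xb bP] : exists2 b, (x < b)%O & forall z, (x < z)%O -> (b <= z)%O.
    apply: contrapT => h; apply: nx; split; first by exists y.
    move=> b xb; apply: contrapT => h'; apply: h; exists b => // z xz.
    by rewrite leNgt; apply/negP => zb; apply: h'; exists z.
  exists b => // z xz zb; apply: (PS _ _ 0) => [w /= wx|w /= wz /negP].
    exact: le_lt_trans xz.
  rewrite -ltNge => /bP bw; suff : (w < w)%O by rewrite ltxx.
  by rewrite (lt_le_trans wz)// (le_trans zb).
by apply: (PS _ _ 0 _ _ Px) => // y _ /(_ (xT y)).
Qed.

End space.

End regulated.

(** * Functionals on regulated functions *)

Section mass.
Context {R : realType} {d : Order.disp_t} (L : orderType d).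
Context (X : completeNormedModType R).
Implicit Types (f g : reg L X) (C D E : downset (L := L)).

Lemma dual_norm_le1 (Y : completeNormedModType R) (q : dual Y) M :
  (forall y, `|y| <= 1 -> q y <= M) -> `|q| <= M.
Proof.
move=> h; rewrite leNgt; apply/negP => /dual_norm_gt[y y1].
by rewrite ltNge h.
Qed.

Lemma cut_piece_in D E f y : ds_sub D E -> E y -> ~ D y ->
  (cut X E f - cut X D f) (y, None) = f (y, None).
Proof. by move=> DE Ey Dy; rewrite fspaceB cut_in// cut_out// subr0. Qed.

Lemma cut_piece_out D E f y : ds_sub D E -> ~ E y \/ D y ->
  (cut X E f - cut X D f) (y, None) = 0.
Proof.
move=> DE; have [Dy _|Dy [|]//] := pselect (D y).
  by rewrite fspaceB !cut_in ?subrr//; exact: DE.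
by move=> Ey; rewrite fspaceB !cut_out ?subrr.
Qed.

Lemma osc_piece D E f c e : ds_sub D E -> 0 <= e -> osc D E f c e ->
  `|cut X E (f - cst L X c) - cut X D (f - cst L X c)| <= e.
Proof.
move=> DE e0 h; apply: reg_norm_le => // y.
have [Dy|Dy] := pselect (D y); first by rewrite cut_piece_out ?normr0//; right.
have [Ey|Ey] := pselect (E y); last by rewrite cut_piece_out ?normr0//; left.
by rewrite cut_piece_in// fspaceB cstE h.
Qed.

Lemma cut_cut D E f : ds_sub D E -> cut X E (cut X D f) = cut X D f.
Proof.
move=> DE; apply: reg_ext => y; have [Ey|Ey] := pselect (E y).
  by rewrite cut_in.
by rewrite !cut_out// => /DE.
Qed.

Lemma cut_cutr D E f : ds_sub D E -> cut X D (cut X E f) = cut X D f.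
Proof.
move=> DE; apply: reg_ext => y; have [Dy|Dy] := pselect (D y).
  by rewrite !cut_in//; exact: DE.
by rewrite !cut_out.
Qed.

Lemma cut_dsT f : cut X (dsT (L := L)) f = f.
Proof. by apply: reg_ext => y; rewrite cut_in. Qed.

Variable p : dual (reg L X).

Definition part D : dual (reg L X) := transpose (cut X D) p.

Lemma partE D f : part D f = p (cut X D f). Proof. by []. Qed.

(** The distribution function of the total variation of p. *)
Definition mass D : R := `|part D|.

Lemma mass_dsT : mass (dsT (L := L)) = `|p|.
Proof. by congr (`|_|); apply: dual_ext => f; rewrite partE cut_dsT. Qed.

Lemma mass_piece D E : ds_sub D E -> mass D + `|part E - part D| <= mass E.
Proof.
move=> DE.
(* Functions living on disjoint pieces of the line do not add their norms up. *)
have key f g : `|f| <= 1 -> `|g| <= 1 -> part D f + (part E - part D) g <= mass E.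
  move=> f1 g1; pose h := cut X D f + (cut X E g - cut X D g).
  have hE : cut X E h = h.
    by rewrite /h bopD bopB !cut_cut//; exact: (fun _ => id).
  have -> : part D f + (part E - part D) g = part E h.
    by rewrite dualB !partE hE /h linearD linearB.
  rewrite (le_trans (ler_norm _))// (le_trans (dual_ub _ _))// ler_piMr//.
  apply: reg_norm_le => // y; rewrite fspaceD.
  have [Dy|Dy] := pselect (D y).
    rewrite cut_in// cut_piece_out//; last by right.
    by rewrite addr0 (le_trans (fspace_ub _ _)).
  rewrite cut_out// add0r; have [Ey|Ey] := pselect (E y).
    by rewrite cut_piece_in// (le_trans (fspace_ub _ _)).
  by rewrite cut_piece_out ?normr0//; left.
rewrite -lerBrDr; apply: dual_norm_le1 => f f1; rewrite lerBrDl -lerBrDr.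
by apply: dual_norm_le1 => g g1; rewrite lerBrDr addrC key.
Qed.

Lemma mass_mono D E : ds_sub D E -> mass D <= mass E.
Proof. by move=> /mass_piece; apply: le_trans; rewrite lerDl. Qed.

Lemma mass_dist D E : `|part E - part D| <= `|mass E - mass D|.
Proof.
have [DE|ED] := downset_total D E.
  have := mass_piece DE; have := ler_norm (mass E - mass D); lra.
rewrite distrC; have := mass_piece ED; rewrite distrC.
have := ler_norm (mass D - mass E); rewrite [`|mass E - _|]distrC; lra.
Qed.

Lemma part_cut D E g : ds_sub D E ->
  (part E - part D) g = (part E - part D) (cut X E g - cut X D g).
Proof.
move=> DE; have EE : ds_sub E E by [].
have DD : ds_sub D D by [].
rewrite !dualB !partE !bopB (cut_cut g EE) (cut_cut g DE) (cut_cutr g DE).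
by rewrite (cut_cut g DD) subrr linear0 subr0 linearB.
Qed.

Lemma part_piece D E f c e : ds_sub D E -> 0 <= e -> osc D E f c e ->
  `|(part E - part D) (f - cst L X c)| <= e * (mass E - mass D).
Proof.
move=> DE e0 h; rewrite part_cut//.
rewrite (le_trans (dual_ub _ _))// mulrC.
rewrite ler_pM//; first exact: osc_piece e0 h.
by have := mass_piece DE; lra.
Qed.

(** All that matters about a point, or a side of a point, of a piece is that a
    function obeys there its bounds on the piece. *)
Definition tag D E (t : L * option bool) := forall f (c : X) (e : R),
  osc D E f c e -> `|f t - c| <= e.

Lemma tag_sub C D E C' t : ds_sub C D -> ds_sub E C' -> tag D E t -> tag C C' t.
Proof.
by move=> CD EC' h f c e o; apply: h => y Ey Dy; apply: o; [exact: EC'|move=> /CD].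
Qed.

Hypothesis Lc : @complete_order _ L.

(** The supremum of C, or its left side if it is not attained, is a tag of each
    piece that ends where C ends. *)
Lemma tag_left C : exists t, forall D, (exists2 y, C y & ~ D y) -> tag D C t.
Proof.
have [m [mub ml]] := Lc [set y | C y].
have [Cm|Cm] := pselect (C m).
  exists (m, None) => D [y Cy Dy] f c e; apply=> // Dm; apply: Dy.
  by apply: ds_down Dm _; exact: mub.
exists (m, Some true) => D [y Cy Dy] f c e o.
have lt_m z : C z -> (z < m)%O.
  move=> Cz; rewrite lt_neqAle mub// andbT; apply/eqP => zm; apply: Cm.
  by rewrite -zm.
have below z : (z < m)%O -> exists2 w, C w & (z < w)%O.
  move=> zm; apply: contrapT => h; move: zm; rewrite ltNge => /negP; apply.
  by apply: ml => w Cw; rewrite leNgt; apply/negP => zw; apply: h; exists w.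
have sm : side_limit true m.
  split; first by exists y; exact: lt_m.
  by move=> a /below[w Cw aw]; exists w => //; exact: lt_m.
apply: (reg_lim_le sm (lt_m _ Cy)) => z yz /below[w Cw zw]; apply: o.
  exact: ds_down Cw (ltW zw).
by move=> Dz; apply: Dy; exact: ds_down Dz (ltW yz).
Qed.

(** Likewise for the infimum of the complement of C. *)
Lemma tag_right C : exists t, forall E, (exists2 y, E y & ~ C y) -> tag C E t.
Proof.
have [m [mlb mg]] := complete_inf Lc [set y | ~ C y].
have [Cm|Cm] := pselect (C m); last first.
  exists (m, None) => E [y Ey Cy] f c e; apply=> //.
  by apply: ds_down Ey _; exact: mlb.
exists (m, Some false) => E [y Ey Cy] f c e o.
have gt_m z : ~ C z -> (m < z)%O.
  move=> Cz; rewrite lt_neqAle mlb// andbT; apply/eqP => zm; apply: Cz.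
  by rewrite -zm.
have above z : (m < z)%O -> exists2 w, ~ C w & (w < z)%O.
  move=> zm; apply: contrapT => h; move: zm; rewrite ltNge => /negP; apply.
  by apply: mg => w Cw; rewrite leNgt; apply/negP => zw; apply: h; exists w.
have sm : side_limit false m.
  split; first by exists y; exact: gt_m.
  by move=> a /above[w Cw aw]; exists w => //; exact: gt_m.
apply: (reg_lim_le sm (gt_m _ Cy)) => z yz /above[w Cw zw]; apply: o.
  exact: ds_down Ey (ltW yz).
by move=> Cz; apply: Cw; exact: ds_down Cz (ltW zw).
Qed.

(** If q is a rational between the masses of D and E, then the union of the initial
    segments of mass at most q lies between D and E; the upper end of this union
    or the lower end of its complement is a tag of the piece. *)
Lemma countable_tags : exists T : rat * bool -> L * option bool, forall D E,
  ds_sub D E -> mass D < mass E -> exists i, tag D E (T i).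
Proof.
have down (q : rat) a b : (exists2 D, mass D <= ratr q & D b) -> (a <= b)%O ->
    exists2 D, mass D <= ratr q & D a.
  by move=> [D Dq Db] ab; exists D => //; exact: ds_down Db ab.
pose C q := Downset (@down q).
have [t1 t1P] := choice (fun q => tag_left (C q)).
have [t2 t2P] := choice (fun q => tag_right (C q)).
exists (fun i => if i.2 then t1 i.1 else t2 i.1) => D E DE mDE.
have [q] := rat_in_itvoo mDE; rewrite in_itv/= => /andP[Dq qE].
have DC : ds_sub D (C q) by move=> y Dy; exists D => //; exact: ltW.
have CE : ds_sub (C q) E.
  move=> y [D' D'q D'y]; have [D'E|ED'] := downset_total D' E; first exact: D'E.
  by have := mass_mono ED'; rewrite leNgt (le_lt_trans D'q).
have [h|h] := pselect (exists2 y, C q y & ~ D y).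
  exists (q, true) => /=; have := t1P q D h; exact: tag_sub.
have [k|k] := pselect (exists2 y, E y & ~ C q y).
  exists (q, false) => /=; have := t2P q E k; exact: tag_sub.
suff /mass_mono : ds_sub E D by rewrite leNgt mDE.
move=> y Ey; apply: contrapT => Dy; apply: h; exists y => //.
by apply: contrapT => Cy; apply: k; exists y.
Qed.

(** For every rational interval that contains a mass, one initial segment with a
    mass in that interval is chosen. *)
Lemma countable_cuts : exists T : rat * rat -> downset (L := L), forall D e,
  0 < e -> exists i, `|mass (T i) - mass D| <= e.
Proof.
have h (i : rat * rat) : exists D0, (exists D, ratr i.1 < mass D < ratr i.2) ->
    ratr i.1 < mass D0 < ratr i.2.
  have [[D Di]|hD] := pselect (exists D, ratr i.1 < mass D < ratr i.2).
    by exists D.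
  by exists (ds0 (L := L)) => /hD.
have [T TP] := choice h; exists T => D e e0.
have e2 : 0 < e / 2 by rewrite divr_gt0.
have [|q] := @rat_in_itvoo R (mass D - e / 2) (mass D); first by lra.
rewrite in_itv/= => /andP[q1 q2].
have [|r] := @rat_in_itvoo R (mass D) (mass D + e / 2); first by lra.
rewrite in_itv/= => /andP[r1 r2].
exists (q, r); have /andP[] := TP (q, r) (ex_intro _ D (introT andP (conj q2 r1))).
by rewrite /= ler_distl => h1 h2; apply/andP; split; lra.
Qed.

End mass.

Section regulated_norming.
Context {R : realType} {kappa : Type} (kinf : infinite_set [set: kappa]).
Context {d : Order.disp_t} (L : orderType d) (Lc : @complete_order _ L).
Context (X : completeNormedModType R).

(** A functional p can be computed, up to a given error, from countably many
    scalar conditions on the values: on each piece of a partition into pieces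
    of small oscillation f is replaced by its value at a tag from the countable
    supply, and the end points of the piece by cuts from the countable supply. *)
Lemma reg_hat_norming : hat_norming kinf (regsys L X).
Proof.
move=> F s s0 Fs; apply: kap_norm_le => // p.
have [T TP] := countable_tags p Lc; have [E EP] := countable_cuts p.
pose psi D : dual X := transpose (cst L X) (part p D).
have psi_dist C D : `|psi C - psi D| <= `|mass p C - mass p D|.
  rewrite (le_trans _ (mass_dist p D C))// /psi -bopB.
  apply: dual_norm_le => // x; rewrite transposeE (le_trans (dual_ub _ _))//.
  rewrite ler_wpM2l//; apply: reg_norm_le => // y.
  by rewrite cstE.
pose A := range (fun i : (rat * rat) * (rat * bool) =>
  transpose (@fs_eval R (regsys L X) (T i.2)) (psi (E i.1))).
have [f Ff] : exists f, forall q, (A `|` [set p]) q -> kval F q = q f.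
  apply/kval_agree/card_leU1/countable_card_le => //.
  exact: card_le_trans (card_image_le _ _) (countableP _).
have Fp : kval F p = p f by apply: Ff; right.
have Fpsi i j : kval (hat F (T i)) (psi (E j)) = psi (E j) (f (T i)).
  by rewrite hatE Ff//; left; exists (j, i).
rewrite Fp -(mass_dsT p) -[f in p f](cut_dsT f) -partE.
apply/ler_addgt0Pl => e e0.
have m0 D : 0 <= mass p D by exact: normr_ge0.
pose k := e / (2 * (mass p (dsT (L := L)) + 1)).
have k0 : 0 < k by rewrite divr_gt0// mulr_gt0// ltr_wpDl.
suff : `|part p (dsT (L := L)) f| <= (s + 2 * k) * mass p (dsT (L := L)).
  move=> /le_trans; apply; rewrite mulrDl addrC lerD2r /k.
  rewrite mulrA mulrAC ler_pdivrMr ?mulr_gt0 ?ltr_wpDl//.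
  rewrite [2 * e]mulrC -!mulrA ler_pM2l// ler_pM2l// lerDl//.
apply: (@regulated_ind _ _ L X Lc f k (fun D => `|part p D f| <= (s + 2 * k) * mass p D)) => //.
  move=> D D0; have -> : part p D f = 0.
    rewrite partE (_ : cut X D f = 0) ?linear0//.
    by apply: reg_ext => y; rewrite cut_out.
  by rewrite normr0 mulr_ge0// addr_ge0// mulr_ge0// ltW.
move=> D D' c DD' o ih.
have -> : part p D' f = (part p D' - part p D) f + part p D f by rewrite dualB subrK.
rewrite (le_trans (ler_normD _ _))//.
suff : `|(part p D' - part p D) f| <= (s + 2 * k) * (mass p D' - mass p D) by move: ih; lra.
have := mass_mono p DD'; rewrite le_eqVlt => /predU1P[mE|mlt].
  have := mass_piece p DD'; rewrite mE subrr mulr0 gerDl => h.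
  rewrite (le_trans (dual_ub _ _))//.
  have -> : `|part p D' - part p D| = 0 by apply/eqP; rewrite eq_le h normr_ge0.
  by rewrite mul0r.
have [i /(_ f c k o) tagi] := TP _ _ DD' mlt.
set v := f (T i) in tagi.
have o2 : osc D D' f v (2 * k).
  move=> y D'y Dy; rewrite -(subrKA c) (le_trans (ler_normD _ _))//.
  by have := o y D'y Dy; rewrite [`|c - v|]distrC; lra.
have k20 : 0 <= 2 * k by rewrite mulr_ge0// ltW.
have pc := part_piece p DD' k20 o2.
suff h2 : `|(part p D' - part p D) (cst L X v)| <= s * (mass p D' - mass p D).
  rewrite -[f](subrK (cst L X v)) linearD (le_trans (ler_normD _ _))// mulrDl addrC.
  by rewrite lerD.
have -> : (part p D' - part p D) (cst L X v) = (psi D' - psi D) v by [].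
apply/ler_addgt0Pl => e' e'0.
pose l := e' / (2 * (s + `|v| + 1)).
have sv : 0 < s + `|v| + 1 by rewrite ltr_wpDl// addr_ge0.
have l0 : 0 < l by rewrite divr_gt0// mulr_gt0.
have [j1 h1] := EP D' _ l0; have [j2 h2] := EP D _ l0.
have -> : (psi D' - psi D) v =
    ((psi D' - psi (E j1)) v + (psi (E j2) - psi D) v) +
    kval (hat F (T i)) (psi (E j1) - psi (E j2)).
  have -> : kval (hat F (T i)) (psi (E j1) - psi (E j2)) =
      kval (hat F (T i)) (psi (E j1)) - kval (hat F (T i)) (psi (E j2)).
    exact: linearB.
  rewrite !Fpsi !dualB -/v; lra.
have b1 : `|(psi D' - psi (E j1)) v| <= l * `|v|.
  rewrite (le_trans (dual_ub _ _))// ler_wpM2r// (le_trans (psi_dist _ _))//.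
  by rewrite distrC.
have b2 : `|(psi (E j2) - psi D) v| <= l * `|v|.
  by rewrite (le_trans (dual_ub _ _))// ler_wpM2r// (le_trans (psi_dist _ _)).
have b3 : `|kval (hat F (T i)) (psi (E j1) - psi (E j2))| <=
    s * (mass p D' - mass p D + 2 * l).
  rewrite (le_trans (kval_ub _ _))// ler_pM// (le_trans (psi_dist _ _))//.
  move: h1 h2; rewrite !ler_distl => /andP[h1 h2] /andP[h3 h4].
  by apply/andP; split; lra.
have := ler_normD ((psi D' - psi (E j1)) v + (psi (E j2) - psi D) v)
  (kval (hat F (T i)) (psi (E j1) - psi (E j2))).
have := ler_normD ((psi D' - psi (E j1)) v) ((psi (E j2) - psi D) v).
have : 2 * l * (s + `|v|) <= e'.
  have := divfK (lt0r_neq0 (mulr_gt0 (ltr0Sn R 1) sv)) e'; rewrite -/l.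
  move: l0; clear; lra.
move: b1 b2 b3; rewrite !mulrDr; lra.
Qed.

End regulated_norming.

(** * The kappa-space of a space of regulated functions *)

Section big_sides.
Context {d : Order.disp_t} {L : orderType d} (kappa : Type).

(** The cofinality of the side s of x exceeds kappa. *)
Definition big_side s (x : L) := forall B : set L, (B #<= [set: kappa])%card ->
  (forall b, B b -> slt s b x) -> exists2 a, slt s a x & forall b, B b -> slt s b a.

End big_sides.

Section regulated_map.
Context {R : realType} {d : Order.disp_t} (L : orderType d).
Context (X Y : completeNormedModType R) (T : bop X Y).

Lemma reg_map_cond (f : reg L X) : reg_cond (fun t => T (f t)).
Proof.
move=> x s; split=> sx; last by rewrite reg_nlim// bop0.
have PF := side_nbhs_proper sx; have [M M0 TM] := bop_bound T.
apply/cvgrPdist_le => e e0; have eM : 0 < e / M by rewrite divr_gt0.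
have /cvgrPdist_le /(_ _ eM) := (fs_mem f x s).1 sx.
apply: filterS => y fy; rewrite -bopB (le_trans (TM _))//.
by rewrite mulrC -ler_pdivlMr.
Qed.

Lemma reg_map_bd (f : reg L X) : exists M, forall t, `|T (f t)| <= M.
Proof.
have [M M0 TM] := bop_bound T; exists (M * `|f|) => t.
by rewrite (le_trans (TM _))// ler_pM2l// fspace_ub.
Qed.

Definition reg_map_fun (f : reg L X) : reg L Y :=
  @FSpace R (regsys L Y) _ (reg_map_bd f) (reg_map_cond f).

Lemma reg_map_linear : linear reg_map_fun.
Proof.
move=> a f g; apply: fspace_ext => t; rewrite fspaceD fspaceZ.
by rewrite -[LHS]/(T ((a *: f + g) t)) fspaceD fspaceZ bopD bopZ.
Qed.

Lemma reg_map_bounded : exists M, forall f, `|reg_map_fun f| <= M * `|f|.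
Proof.
have [M M0 TM] := bop_bound T; exists M => f; apply: fspace_le => [|t].
  by rewrite mulr_ge0// ltW.
by rewrite (le_trans (TM _))// ler_pM2l// fspace_ub.
Qed.

Definition reg_map : bop (reg L X) (reg L Y) := Bop reg_map_linear reg_map_bounded.

Lemma reg_mapE f t : reg_map f t = T (f t). Proof. by []. Qed.

End regulated_map.

Section kappa_regulated.
Context {R : realType} {kappa : Type} (kinf : infinite_set [set: kappa]).
Context {d : Order.disp_t} (L : orderType d) (Lc : @complete_order _ L).
Context (X : completeNormedModType R).
Implicit Types (F : kap kinf (reg L X)) (f : reg L X) (t : L * option bool).

Definition rhat F t : kap kinf X := @hat _ _ kinf (regsys L X) F t.

Lemma rhat_le F t : `|rhat F t| <= `|F|.
Proof. exact (@hat_le R kappa kinf (regsys L X) F t). Qed.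

Lemma rhat_linear t : linear (rhat^~ t).
Proof. exact (@hat_linear R kappa kinf (regsys L X) t). Qed.

Lemma rhatB F G t : rhat (F - G) t = rhat F t - rhat G t.
Proof. exact (@hatB R kappa kinf (regsys L X) F G t). Qed.

Lemma rhat_iota f t : rhat (kiota kinf _ f) t = kiota kinf _ (f t).
Proof. exact (@hat_iota R kappa kinf (regsys L X) f t). Qed.

Lemma rhatE F t p : kval (rhat F t) p = kval F (transpose (@fs_eval R (regsys L X) t) p).
Proof. exact: kmapE. Qed.

Lemma rhat_norming F s : 0 <= s -> (forall t, `|rhat F t| <= s) -> `|F| <= s.
Proof. exact: reg_hat_norming. Qed.

Lemma rhat_nlim F x s : ~ side_limit s x -> rhat F (x, Some s) = 0.
Proof.
move=> sx; apply: kval_ext => p; rewrite rhatE linear0.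
suff -> : transpose (@fs_eval R (regsys L X) (x, Some s)) p = 0 by rewrite linear0.
by apply: dual_ext => f; rewrite transposeE fs_evalE reg_nlim// linear0.
Qed.

(** By definition of the kappa-space, at most kappa many functionals that witness
    the lower bounds do not distinguish F from some regulated function. *)
Lemma rhat_realize F (I : Type) (A : set I) (t u : I -> L * option bool) (e : R) :
  (A #<= [set: kappa])%card -> 0 <= e ->
  (forall i, A i -> e < `|rhat F (t i) - rhat F (u i)|) ->
  exists f, forall i, A i -> e < `|f (t i) - f (u i)|.
Proof.
move=> Ak e0 h.
have hp i : exists p : dual X, A i ->
    e * `|p| < `|kval (rhat F (t i) - rhat F (u i)) p|.
  have [Ai|] := pselect (A i); last by exists 0.
  by have [p pF] := kap_norm_gt e0 (h i Ai); exists p.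
have [p pP] := choice hp.
pose ev v : bop (reg L X) X := @fs_eval R (regsys L X) v.
pose q i : dual (reg L X) := transpose (ev (t i)) (p i) - transpose (ev (u i)) (p i).
have [f Ff] : exists f, forall g, (q @` A) g -> kval F g = g f.
  exact/kval_agree/(card_le_trans (card_image_le _ _)).
exists f => i Ai; have := pP i Ai.
have -> : kval (rhat F (t i) - rhat F (u i)) (p i) = p i (f (t i) - f (u i)).
  have qE : kval F (q i) =
      kval F (transpose (ev (t i)) (p i)) - kval F (transpose (ev (u i)) (p i)).
    exact: linearB.
  rewrite kvalB !rhatE -qE Ff; last by exists i.
  by rewrite dualB !transposeE !fs_evalE linearB.
move=> /lt_le_trans/(_ (dual_ub _ _)).
have [p0|p0] := eqVneq `|p i| 0; first by rewrite p0 mulr0 mul0r ltxx.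
by rewrite mulrC ltr_pM2l// lt0r p0 normr_ge0.
Qed.

Definition valid t := if t.2 is Some s then side_limit s t.1 else True.

Lemma reg_loc (Y : completeNormedModType R) (f : reg L Y) s a x (c : Y) (e : R) t :
  (forall y, slt s a y -> slt s y x -> `|f (y, None) - c| <= e) ->
  valid t -> slt s a t.1 -> slt s t.1 x -> `|f t - c| <= e.
Proof.
case: t => y [s'|] h /= sy ay yx; last exact: h.
have [E|E] := eqVneq s' s.
  by case: _ / E in h ay yx *; apply: reg_lim_le sy ay _ => z az zy;
    apply: h => //; exact: slt_trans zy yx.
have {}E : s' = ~~ s by case: s' s E {h ay yx sy} => -[].
rewrite E in sy *; apply: (@reg_lim_le _ _ _ _ _ _ _ x) => // [|z]; rewrite ?slt_neg//.
move=> zx yz; apply: h => //; exact: slt_trans ay yz.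
Qed.

(** The values of F have one-sided limits: otherwise countably many oscillations
    would accumulate at some point, for some regulated function. *)
Lemma rhat_cauchy F x s e : (exists a, slt s a x) -> 0 < e ->
  exists2 a, slt s a x & forall t u, valid t -> valid u ->
    slt s a t.1 -> slt s t.1 x -> slt s a u.1 -> slt s u.1 x ->
    `|rhat F t - rhat F u| <= e.
Proof.
move=> [a0 a0x] e0; apply: contrapT => h.
have step a : exists v : (L * option bool) * (L * option bool), slt s a x ->
    [/\ valid v.1 /\ valid v.2, slt s a v.1.1 /\ slt s v.1.1 x,
        slt s a v.2.1 /\ slt s v.2.1 x & e < `|rhat F v.1 - rhat F v.2|].
  have [ax|//] := pselect (slt s a x); last by exists ((x, None), (x, None)).
  apply: contrapT => h'; apply: h; exists a => // t u vt vu t1 t2 u1 u2.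
  rewrite leNgt; apply/negP => etu; apply: h'; exists (t, u) => _ //.
have [v vP] := choice step.
pose next a := smax s (v a).1.1 (v a).2.1.
pose a n := iter n next a0.
have ax n : slt s (a n) x.
  by elim: n => // n /vP[_ [_ h1] [_ h2] _]; exact: lt_smax.
have aS n : slt s (a n) (a n.+1).
  have [_ [h1 _] [h2 _] _] := vP _ (ax n).
  by rewrite /a iterS -/(a n) /next /smax; case: ifP.
have [z [sz az cof]] := side_seq Lc aS ax.
have vz n : slt s (v (a n)).1.1 z /\ slt s (v (a n)).2.1 z.
  by have := az n.+1; rewrite /a iterS -/(a n) /next smax_lt => /andP[].
have [f fP] : exists f, forall n, setT n -> e < `|f (v (a n)).1 - f (v (a n)).2|.
  apply: (@rhat_realize F) => [||n _]; last by have [] := vP _ (ax n).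
    exact: countable_card_le.
  exact: ltW.
have e2 : 0 < e / 2 by rewrite divr_gt0.
have [b bz fb] := reg_near f sz e2.
have [n ban] := cof _ bz.
have [[v1 v2] [h1 _] [h2 _] _] := vP _ (ax n).
have := reg_loc fb v1 (slt_trans ban h1) (vz n).1.
have := reg_loc fb v2 (slt_trans ban h2) (vz n).2.
have := fP n I; rewrite -(subrKA (f (z, Some s))) => h3.
have := lt_le_trans h3 (ler_normD _ _); rewrite [`|f (z, Some s) - _|]distrC.
by lra.
Qed.

Lemma rhat_lim F x s : side_limit s x -> exists l : kap kinf X, rhat F (y, None) @[y --> side_nbhs s x] --> l.
Proof.
move=> sx; have PF := side_nbhs_proper sx.
apply/cvg_ex; apply: cauchy_cvg; apply: cauchy_exP => e e0.
have e2 : 0 < e / 2 by rewrite divr_gt0.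
have [a ax aP] := rhat_cauchy F sx.1 e2.
have [y ay yx] := sx.2 _ ax; exists (rhat F (y, None)); exists a => // z [az zx].
rewrite /= -ball_normE /= (le_lt_trans (aP _ _ _ _ _ _ _ _))//.
by lra.
Qed.

Definition kreg_fun F : reg L (kap kinf X) :=
  sval (reg_mk (fun y => rhat_le F (y, None)) (@rhat_lim F)).

Lemma kreg_funE F y : kreg_fun F (y, None) = rhat F (y, None).
Proof. by rewrite /kreg_fun; case: reg_mk. Qed.

Lemma kreg_linear : linear kreg_fun.
Proof.
move=> a F G; apply: reg_ext => y; rewrite fspaceD fspaceZ !kreg_funE.
exact: rhat_linear.
Qed.

Lemma kreg_bounded : exists M, forall F, `|kreg_fun F| <= M * `|F|.
Proof.
exists 1 => F; rewrite mul1r; apply: reg_norm_le => // y.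
by rewrite kreg_funE rhat_le.
Qed.

(** The values of F form a regulated function, whose one-sided limits may differ
    from the components of F at the sides: the differences are the jumps. *)
Definition kreg : bop (kap kinf (reg L X)) (reg L (kap kinf X)) :=
  Bop kreg_linear kreg_bounded.

Lemma kregE F y : kreg F (y, None) = rhat F (y, None). Proof. exact: kreg_funE. Qed.

Lemma kreg_iota f : kreg (kiota kinf _ f) = reg_map L (kiota kinf X) f.
Proof. by apply: reg_ext => y; rewrite kregE rhat_iota reg_mapE. Qed.

Definition jump F (i : L * bool) : kap kinf X :=
  rhat F (i.1, Some i.2) - kreg F (i.1, Some i.2).

Lemma jump_linear i : linear (jump^~ i).
Proof.
move=> a F G; rewrite /jump rhat_linear bopD bopZ fspaceD fspaceZ.
by rewrite scalerBr addrACA opprD.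
Qed.

Lemma jump_le F i : `|jump F i| <= 2 * `|F|.
Proof.
rewrite /jump (le_trans (ler_normB _ _))// mulr2n mulrDl mul1r lerD ?rhat_le//.
apply: (le_trans (@fspace_ub _ (regsys L (kap kinf X)) (kreg F) _)).
by apply: reg_norm_le => // y; rewrite kregE rhat_le.
Qed.

Lemma jump_iota f i : jump (kiota kinf _ f) i = 0.
Proof. by rewrite /jump rhat_iota kreg_iota reg_mapE subrr. Qed.

Lemma jump_nlim F x s : ~ side_limit s x -> jump F (x, s) = 0.
Proof. by move=> sx; rewrite /jump rhat_nlim// reg_nlim// subrr. Qed.

Lemma jump_near F x s e : (exists a, slt s a x) -> 0 < e ->
  exists2 a, slt s a x & forall i, slt s a i.1 -> slt s i.1 x -> `|jump F i| <= e.
Proof.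
move=> sx e0; have [a ax aP] := rhat_cauchy F sx e0; exists a => // -[y s'] ay yx.
have [sy|/jump_nlim->] := pselect (side_limit s' y); last by rewrite normr0 ltW.
rewrite /jump distrC; apply: (reg_loc (s := s) (a := a) (x := x)) => // z az zx.
by rewrite kregE; exact: aP.
Qed.

(** By [jump_near] the large jumps do not accumulate anywhere. *)
Lemma jump_finite F e : 0 < e -> finite_set [set i | e < `|jump F i|].
Proof.
move=> e0.
pose P (D : downset (L := L)) := finite_set [set i | D i.1 /\ e < `|jump F i|].
have sub (D E : downset (L := L)) : (forall i, E i.1 -> e < `|jump F i| -> D i.1) -> P D -> P E.
  by move=> DE; apply: sub_finite_set => i /= [Ei ei]; split=> //; exact: DE.
have [||||x xT Px] := @downset_ind _ _ Lc P.
- move=> x xb; apply: sub_finite_set (finite_set0 _) => i [/= ix _].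
  by move: ix; rewrite ltNge xb.
- move=> x Px; apply: (@sub_finite_set _ _ ([set i | (i.1 < x)%O /\ e < `|jump F i|] `|`
    [set (x, true); (x, false)])).
    move=> [y s] [/=]; rewrite le_eqVlt => /predU1P[->|yx] ei; last by left.
    by right; case: s ei; [left|right].
  by rewrite finite_setU; split => //; exact: finite_set2.
- move=> x y yx; have [|a ax aP] := @jump_near F x true e _ e0; first by exists y.
  exists a => //; apply: sub => i /= ix ei; rewrite leNgt; apply/negP => ai.
  by move: ei; rewrite ltNge aP.
- move=> x y xy; have [|b xb bP] := @jump_near F x false e _ e0; first by exists y.
  exists b => // z xz zb; apply: sub => i /= iz ei; rewrite leNgt; apply/negP => xi.
  by move: ei; rewrite ltNge bP// /slt (lt_le_trans iz).
by apply: sub_finite_set Px => i /= ei; split.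
Qed.

(** A small cofinal set would give points near x at which the values of F stay away
    from the component of F at the side, and so would the values of a regulated
    function that shares these differences with F; but these values converge. *)
Lemma jump_small F x s : ~ big_side kappa s x -> jump F (x, s) = 0.
Proof.
have [sx|/jump_nlim->//] := pselect (side_limit s x).
move=> /existsNP[B /not_implyP[Bk /not_implyP[Bx Bcof]]].
apply/normr0_eq0/eqP; rewrite eq_le normr_ge0 andbT leNgt; apply/negP => j0.
pose e := `|jump F (x, s)| / 2.
have e0 : 0 < e by rewrite divr_gt0.
have [a ax aP] := reg_near (kreg F) sx e0.
have hy b : exists y, B b -> [/\ slt s b y, slt s a y & slt s y x].
  have [/Bx bx|] := pselect (B b); last by exists b.
  have [y] := sx.2 _ (lt_smax ax bx); rewrite smax_lt => /andP[ay By] yx.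
  by exists y.
have [y yP] := choice hy.
have [|b Bb|f fP] := @rhat_realize F L B (fun b => (y b, None)) (fun=> (x, Some s)) (e / 2) Bk.
- by rewrite divr_ge0// ltW.
- have [_ ay yx] := yP _ Bb; have := aP _ ay yx; rewrite kregE => h1.
  have := ler_normB (rhat F (y b, None) - kreg F (x, Some s))
    (rhat F (y b, None) - rhat F (x, Some s)).
  have -> : rhat F (y b, None) - kreg F (x, Some s) -
      (rhat F (y b, None) - rhat F (x, Some s)) = jump F (x, s).
    by rewrite opprB addrC addrA subrK.
  move: j0 h1; rewrite /e; clear.
  move: (`|jump F (x, s)|) (`|rhat F (y b, None) - kreg F (x, Some s)|) => j k.
  by move: (`|rhat F (y b, None) - rhat F (x, Some s)|) => l; lra.
have e4 : 0 < e / 2 by rewrite divr_gt0.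
have [c cx cP] := reg_near f sx e4.
have [b Bb cb] : exists2 b, B b & ~~ slt s b c.
  apply: contrapT => h; apply: Bcof; exists c => // b Bb.
  by apply/negP => /negP cb; apply: h; exists b => //; apply/negP.
have [By _ yx] := yP _ Bb.
have := cP _ (sltN_trans cb By) yx.
by rewrite leNgt => /negP; apply; exact: fP.
Qed.

End kappa_regulated.

(** The indices of the jumps, together with one more index for a regulated
    function. *)
Section jump_index.
Context (kappa : Type) {d : Order.disp_t} (L : orderType d).

Definition jump_index := option {i : L * bool | big_side kappa i.2 i.1}.

HB.instance Definition _ := gen_eqMixin jump_index.
HB.instance Definition _ := gen_choiceMixin jump_index.

End jump_index.

Definition jump_fam {R : realType} (kappa : Type) {d : Order.disp_t} (L : orderType d)
    (Y Z : completeNormedModType R) (i : jump_index kappa L) : completeNormedModType R :=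
  if i is Some _ then Z else Y.

Section embeddings.
Context {R : realType} {kappa : Type} (kinf : infinite_set [set: kappa]).
Context {d : Order.disp_t} (L : orderType d) (Lc : @complete_order _ L).
Context (X : completeNormedModType R).
Implicit Types (F : kap kinf (reg L X)) (f : reg L X).

Notation kregX := (kreg kinf Lc X).
Notation jumpX := (@jump _ _ kinf _ _ Lc X).

Section decomposition.
Context (Y : completeNormedModType R) (S : bop (reg L (kap kinf X)) Y).

Definition jump_val F (i : jump_index kappa L) : jump_fam Y (kap kinf X) i :=
  match i with Some p => jumpX F (sval p) | None => S (kregX F) end.

Lemma jump_val_bd F : exists M, forall i, `|jump_val F i| <= M.
Proof.
exists (`|S (kregX F)| + 2 * `|F|) => -[p|] /=; last by rewrite lerDl mulr_ge0.
by rewrite (le_trans (jump_le _ _ _))// lerDr.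
Qed.

Lemma jump_val_cond F : c0_cond (jump_val F).
Proof.
move=> e e0; pose g (i : jump_index kappa L) : option (L * bool) := omap sval i.
have gI : injective g.
  by move=> [[i hi]|] [[j hj]|] //= [ij]; congr Some; exact: eq_exist.
apply: (@sub_finite_set _ _ (g @^-1` ([set None] `|` Some @` [set i | e < `|jumpX F i|]))).
  by move=> [p|] /= ep; [right; exists (sval p)|left].
apply: finite_preimage; first by move=> i j _ _; exact: gI.
rewrite finite_setU; split; first exact: finite_set1.
exact/finite_image/jump_finite.
Qed.

Definition decomp_fun F : c0 (jump_fam (kappa := kappa) (L := L) Y (kap kinf X)) :=
  @FSpace R (c0_sys (jump_fam Y (kap kinf X))) _ (jump_val_bd F) (jump_val_cond F).

Lemma decomp_linear : linear decomp_fun.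
Proof.
move=> a F G; apply: fspace_ext => i; rewrite fspaceD fspaceZ.
case: i => [p|]; first exact: jump_linear.
by rewrite -[LHS]/(S (kregX (a *: F + G))) !bopD !bopZ.
Qed.

Lemma decomp_bounded : exists M, forall F, `|decomp_fun F| <= M * `|F|.
Proof.
have [M M0 SM] := bop_bound (bop_comp S kregX); exists (M + 2) => F.
apply: fspace_le => [|[p|]]; first by rewrite mulr_ge0// addr_ge0// ltW.
  rewrite mulrDl (le_trans (jump_le _ _ _))// lerDr mulr_ge0// ltW//.
by rewrite mulrDl (le_trans (SM F))// lerDl mulr_ge0.
Qed.

Definition decomp : bop (kap kinf (reg L X))
    (c0 (jump_fam (kappa := kappa) (L := L) Y (kap kinf X))) :=
  Bop decomp_linear decomp_bounded.

Lemma decomp_jump F i : `|jumpX F i| <= `|decomp F|.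
Proof.
have [bi|si] := pselect (big_side kappa i.2 i.1).
  exact: (fspace_ub (decomp_fun F) (Some (exist _ i bi))).
by rewrite [jumpX F i](_ : _ = 0) ?normr0//; case: i si => x s; exact: jump_small.
Qed.

Lemma decomp_reg F : `|S (kregX F)| <= `|decomp F|.
Proof. exact: (fspace_ub (decomp_fun F) None). Qed.

End decomposition.

(** The component of F at a side is the sum of the one-sided limit of the values
    and of the jump. *)
Lemma emb_kap_reg : emb (kap kinf (reg L X))
  (c0 (jump_fam (kappa := kappa) (L := L) (reg L (kap kinf X)) (kap kinf X))).
Proof.
have lI : linear (@id (reg L (kap kinf X))) by [].
have bI : exists M, forall g : reg L (kap kinf X), `|g| <= M * `|g|.
  by exists 1 => g; rewrite mul1r.
pose S : bop (reg L (kap kinf X)) (reg L (kap kinf X)) := Bop lI bI.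
exists (decomp S), (1 / 2); first by lra.
move=> F; suff : `|F| <= 2 * `|decomp S F| by lra.
have h1 : `|kregX F| <= `|decomp S F| := decomp_reg S F.
apply: (rhat_norming Lc) => [|[x [s|]]]; first by rewrite mulr_ge0.
  rewrite -[rhat _ _](subrK (kregX F (x, Some s))) (le_trans (ler_normD _ _))//.
  have h2 : `|rhat F (x, Some s) - kregX F (x, Some s)| <= `|decomp S F|.
    exact: decomp_jump S F (x, s).
  have := @fspace_ub _ (regsys L (kap kinf X)) (kregX F) (x, Some s).
  by move: h1 h2; lra.
have := @fspace_ub _ (regsys L (kap kinf X)) (kregX F) (x, None).
rewrite kregE; have := normr_ge0 (decomp S F); move: h1; lra.
Qed.

(** On a piece of small oscillation a vector of X that is close to one value is
    close to all of them. *)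
Lemma reg_approx F e : 0 < e -> (forall y, `|SPquot kinf X (kregX F (y, None))| < e) ->
  exists f, `|kregX F - reg_map L (kiota kinf X) f| <= 3 * e.
Proof.
move=> e0 Fe; have e3 : e + (e + e) <= 3 * e by lra.
have hv y : exists v : X, `|kregX F (y, None) - kiota kinf X v| < e by exact: SPquot_lt.
pose P (D : downset (L := L)) := exists f, forall y,
  (D y -> `|kregX F (y, None) - kiota kinf X (f (y, None))| <= 3 * e) /\
  (~ D y -> f (y, None) = 0).
have [||f fP] := @regulated_ind _ _ L _ Lc (kregX F) e P e0.
- by move=> D D0; exists 0 => y; split=> // /D0.
- move=> D E c DE o [f fP].
  have [[y0 Ey0 Dy0]|h] := pselect (exists2 y, E y & ~ D y); last first.
    exists f => y; have [Dy|Dy] := pselect (D y).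
      by split=> [_|Ey]; [exact: (fP y).1|case: Ey; exact: DE].
    split=> [Ey|_]; last exact: (fP y).2.
    by exfalso; apply: h; exists y.
  have [v hv0] := hv y0.
  exists (f + (cut X E (cst L X v) - cut X D (cst L X v))) => y; rewrite fspaceD.
  split=> [Ey|Ey]; last first.
    rewrite (fP y).2; last by move=> /DE.
    by rewrite cut_piece_out ?addr0//; left.
  have [Dy|Dy] := pselect (D y).
    by rewrite cut_piece_out; [rewrite addr0; exact: (fP y).1|by []|right].
  rewrite (fP y).2// cut_piece_in// cstE add0r.
  have h1 := o _ Ey Dy; have h2 := o _ Ey0 Dy0.
  rewrite -(subrKA c) (le_trans (ler_normD _ _))//.
  have h3 := ler_normD (c - kregX F (y0, None)) (kregX F (y0, None) - kiota kinf X v).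
  rewrite subrKA in h3; rewrite distrC in h2.
  by rewrite (le_trans (lerD h1 (le_trans h3 (lerD h2 (ltW hv0)))))//.
exists f; apply: reg_norm_le => [|y]; first by rewrite mulr_ge0// ltW.
by rewrite fspaceB reg_mapE; exact: (fP y).1.
Qed.

(** Modulo regulated functions into X the values of F count modulo X only, while
    the jumps, which vanish for regulated functions, count in full. *)
Lemma emb_SP_reg : emb (SP kinf (reg L X))
  (c0 (jump_fam (kappa := kappa) (L := L) (reg L (SP kinf X)) (kap kinf X))).
Proof.
pose S := reg_map L (SPquot kinf X).
apply: (@emb_SP_of _ _ kinf (reg L X) _ (decomp S) 4) => [//|f|F e Fe].
  apply: fspace_ext => -[p|].
    exact: jump_iota.
  rewrite -[LHS]/(S (kregX (kiota kinf _ f))) kreg_iota.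
  by apply: fspace_ext => t; rewrite !reg_mapE SPquot_iota.
have e0 : 0 < e by exact: le_lt_trans Fe.
have [|f fF] := @reg_approx F e e0.
  move=> y; rewrite -reg_mapE (le_lt_trans _ Fe)//.
  apply: le_trans (decomp_reg S F).
  exact: (@fspace_ub _ (regsys L (SP kinf X)) (S (kregX F))).
exists f; apply: (rhat_norming Lc) => [|t]; first by rewrite mulr_ge0// ltW.
have fFt t' : `|kregX F t' - kiota kinf X (f t')| <= 3 * e.
  by rewrite -reg_mapE -fspaceB (le_trans (fspace_ub _ _)).
case: t => x [s|]; rewrite rhatB rhat_iota; last first.
  by rewrite -(kregE Lc) (le_trans (fFt (x, None)))// ler_wpM2r ?(ltW e0)// ler_nat.
rewrite -(subrKA (kregX F (x, Some s))) (le_trans (ler_normD _ _))//.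
have h1 : `|rhat F (x, Some s) - kregX F (x, Some s)| <= `|decomp S F|.
  exact: decomp_jump S F (x, s).
rewrite (le_trans (lerD (le_trans h1 (ltW Fe)) (fFt (x, Some s))))//.
by rewrite -{1}[e]mul1r -mulrDl nat1r.
Qed.

End embeddings.

(** * Words in the two functors *)

Section words.
Context {R : realType} {kappa : Type} (kinf : infinite_set [set: kappa]).
Implicit Types (X Y : completeNormedModType R) (w : seq bool).

(** A word is applied from its head on; true stands for SP, false for kappa. *)
Fixpoint app w X : completeNormedModType R :=
  if w is b :: w' then app w' (if b then SP kinf X else kap kinf X) else X.

Definition kills w X := trivial_space (app w X).

Lemma emb_app w X Y : emb X Y -> emb (app w X) (app w Y).
Proof.
elim: w X Y => [//|[] w ih] X Y XY /=; apply: ih; first exact: emb_SP.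
exact: emb_kap.
Qed.

Lemma emb_kills w X Y : emb X Y -> kills w Y -> kills w X.
Proof. by move=> /(emb_app w); exact: emb_trivial. Qed.

Lemma trivial_kills w X : trivial_space X -> kills w X.
Proof.
elim: w X => [//|[] w ih] X X0 /=; apply: ih; first exact: SP_trivial.
exact: kap_trivial.
Qed.

Lemma kills_c0 (I : choiceType) (X : I -> completeNormedModType R) w :
  (forall i, kills w (X i)) -> kills w (c0 X).
Proof.
elim: w X => [|[] w ih] X Xw.
- by move=> f; apply: fspace_ext => i; exact: (Xw i).
- by apply: emb_kills (emb_SP_c0 kinf X) _; exact: ih.
- by apply: emb_kills (emb_kap_c0 kinf X) _; exact: ih.
Qed.

(** In contrast to the condition that SP_iter n X is trivial, this condition passes
    from X to kap X, as is needed for induction. *)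
Definition killed n X := forall w, (n <= count id w)%N -> kills w X.

Lemma killed_emb n X Y : emb X Y -> killed n Y -> killed n X.
Proof. by move=> XY Yn w /Yn; exact: emb_kills. Qed.

Lemma killed_kap n X : killed n X -> killed n (kap kinf X).
Proof. by move=> Xn w wn; exact: (Xn (false :: w)). Qed.

Lemma killed_SP n X : killed n.+1 X -> killed n (SP kinf X).
Proof. by move=> Xn w wn; exact: (Xn (true :: w)). Qed.

(** In the decompositions of kap (reg L X) and SP (reg L X) the letter SP is passed
    on to X in the regulated part; in the c_0-part, which is present only if
    there is a big side, one letter SP is lost and the order disappears. *)
Lemma killed_reg {d : Order.disp_t} (L : orderType d) (Lc : @complete_order _ L) n X :
  killed n X ->
  killed (n + `[< exists s (x : L), big_side kappa s x >]) (reg L X).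
Proof.
move=> Xn w; elim: w n X Xn => [|b w ih] n X Xn wn.
  have n0 : n = 0%N by move: wn; rewrite leqn0 addn_eq0 => /andP[/eqP].
  have X0 : trivial_space X by apply: (Xn [::]); rewrite n0.
  by move=> f; apply: reg_ext => y; exact: X0.
have big (p : {i : L * bool | big_side kappa i.2 i.1}) :
    `[< exists s (x : L), big_side kappa s x >] = true.
  by apply/asboolP; have [[x s] xs] := p; exists s, x.
case: b wn => /= wn.
  case: n Xn wn => [|n] Xn wn.
    apply: (@trivial_kills (true :: w)) => f; apply: reg_ext => y.
    exact: (Xn [::]).
  apply: emb_kills (emb_SP_reg kinf Lc X) _; apply: kills_c0 => -[p|] /=.
    by apply: (Xn (false :: w)) => /=; move: wn; rewrite (big p) addn1 add1n.
  by apply: (ih n); [exact: killed_SP|move: wn; rewrite addSn add1n].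
apply: emb_kills (emb_kap_reg kinf Lc X) _; apply: kills_c0 => -[p|] /=.
  apply: (Xn (false :: w)) => /=; move: wn; rewrite (big p) addn1 add0n.
  exact: ltnW.
by apply: (ih n); [exact: killed_kap|].
Qed.

Lemma dual_scalar (f : dual R^o) (x : R^o) : f x = f 1 * x.
Proof. by rewrite -[in LHS](mulr1 x) -[x * 1]/(x *: 1) linearZ/= mulrC. Qed.

(** The dual of the scalars is spanned by one functional, so that every element of
    the bidual comes from a scalar. *)
Lemma killed_scalars : killed 1 R^o.
Proof.
have lid : linear (@id R^o) by [].
have bid : forall x : R^o, `|x| <= 1 * `|x| by move=> x; rewrite mul1r.
have [e eE] := dual_mk lid bid.
have fE (f : dual R^o) : f = f 1 *: e.
  by apply: dual_ext => x; rewrite dualZ eE dual_scalar.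
have FE (F : kap kinf R^o) f : kval F f = f 1 * kval F e.
  by rewrite [in LHS](fE f) linearZ.
have SP0 : trivial_space (SP kinf R^o).
  move=> q; have [F <-] := SPquotP q; apply/SPquot_eq0; exists (kval F e).
  by apply: kval_ext => f; rewrite FE kiotaE [RHS]dual_scalar.
have kE : emb (kap kinf R^o) R^o.
  pose T (F : kap kinf R^o) : R^o := kval F e.
  have lT : linear T by move=> a F G; rewrite /T kvalD kvalZ.
  have bT : exists M, forall F, `|T F| <= M * `|F|.
    by exists `|e| => F; rewrite mulrC; exact: kval_ub.
  exists (Bop lT bT), 1 => // F; rewrite mul1r; apply: kap_norm_le => // f.
  rewrite FE normrM mulrC ler_wpM2l// (le_trans (dual_ub _ _))//.
  by rewrite normr1 mulr1.
elim=> [//|[] w ih] wn; first exact: (@trivial_kills w _ SP0).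
by apply: (emb_kills kE); exact: ih.
Qed.

End words.

(** * Continuous functions on products of compact lines *)

Lemma compact_line_complete (L : compactLine) : @complete_order _ L.
Proof.
move=> A.
pose F := if pselect (A !=set0) then filter_from A (fun a => [set y : L | A y /\ (a <= y)%O])
  else filter_from setT (fun a => [set y : L | (y <= a)%O]).
have FF : ProperFilter F.
  rewrite /F; case: pselect => /= [[a0 Aa0]|_]; apply: filter_from_proper.
  - apply: filter_from_filter; first by exists a0.
    move=> a b Aa Ab; exists (Order.max a b); first by (rewrite /Order.max; case: ifP => _; [exact: Ab|exact: Aa]).
    by move=> y [Ay]; rewrite ge_max => /andP[].
  - by move=> a Aa; exists a; split.
  - have [x0 _] := @line_nonempty L.
    apply: filter_from_filter; first by exists x0.
    move=> a b _ _; exists (Order.min a b) => //.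
    by move=> y /=; rewrite le_min => /andP[].
  - by move=> a _; exists a => /=.
have [m [_ mF]] := @line_compact L F FF filterT.
exists m; have [A0|A0] := pselect (A !=set0); last first.
  split=> [a Aa|u _]; first by case: A0; exists a.
  rewrite leNgt; apply/negP => um.
  have [||y [/= yu uy]] := mF [set y | (y <= u)%O] `]u, +oo[%classic _ _.
  - by rewrite /F; case: pselect => //= _; exists u.
  - by apply: open_nbhs_nbhs; split; [exact: rray_open|rewrite /= in_itv/= um].
  by move: uy; rewrite in_itv/= andbT ltNge yu.
have FA a : A a -> F [set y : L | A y /\ (a <= y)%O].
  by move=> Aa; rewrite /F; case: pselect => //= _; exists a.
split=> [a Aa|u uA].
  rewrite leNgt; apply/negP => ma.
  have [|y [[_ /= ay] ya]] := mF _ `]-oo, a[%classic (FA _ Aa) _.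
    by apply: open_nbhs_nbhs; split; [exact: lray_open|rewrite /= in_itv/= ma].
  by move: ya; rewrite /= in_itv/= ltNge ay.
rewrite leNgt; apply/negP => um; have [a Aa] := A0.
have [|y [[Ay _] uy]] := mF _ `]u, +oo[%classic (FA _ Aa) _.
  by apply: open_nbhs_nbhs; split; [exact: rray_open|rewrite /= in_itv/= um].
by move: uy; rewrite /= in_itv/= andbT ltNge uA.
Qed.

Lemma side_nbhs_le {d} (L : orderTopologicalType d) s (x : L) :
  side_limit s x -> side_nbhs s x `=>` nbhs x.
Proof.
move=> [[a0 a0x] _] A; rewrite itv_nbhsE => -[[l u] [/= oi xi] iA].
have [a ax aA] : exists2 a : L, slt s a x & forall y, slt s a y -> slt s y x -> y \in Interval l u.
  move: xi; rewrite itv_boundlr => /andP[lx xu]; case: s a0x; rewrite /slt => a0x.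
    have yu y : (y < x)%O -> (BRight y <= u)%O.
      by move=> yx; apply: le_trans xu; rewrite bnd_simp ltW.
    case: l oi iA lx => [[] a|[]] oi iA lx //.
    - exists a; first by move: lx; rewrite bnd_simp.
      by move=> y ay yx; rewrite itv_boundlr bnd_simp ay yu.
    - by exists a0 => // y _ yx; rewrite itv_boundlr yu.
  have ly y : (x < y)%O -> (l <= BLeft y)%O.
    by move=> xy; apply: le_trans lx _; rewrite bnd_simp ltW.
  case: u oi iA xu => [[] b|[]] oi iA xu //.
  - exists b; first by move: xu; rewrite bnd_simp.
    by move=> y yb xy; rewrite itv_boundlr bnd_simp yb ly.
  - by move: oi => /itv_open_ends_rside.
  - by exists a0 => // y _ xy; rewrite itv_boundlr ly.
by exists a => // y [ay yx]; apply: iA; exact: aA.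
Qed.

Section towers.
Context {R : realType} {m : nat} (K : 'I_m -> compactLine).
Notation CK := (Cspace R (line_product_compact K)).

Lemma line_product_cvg (F : set_system (line_product K)) (p : line_product K) :
  Filter F -> (forall i, q i @[q --> F] --> p i) -> F --> p.
Proof.
move=> FF h; apply/cvg_sup => i U.
have /= -> := @nbhsE (initial_topology (fun f : forall i, K i => f i)) p.
case=> B [[C oC <- ?]] /filterS; apply; apply: (h i).
by apply: open_nbhs_nbhs.
Qed.

Lemma line_product_proj i : continuous (fun p : line_product K => p i).
Proof. exact: (@proj_continuous _ (fun i => K i : topologicalType) i). Qed.

Lemma dfwith_cvg (p : line_product K) i (x : K i) :
  (dfwith q.2 i q.1 : line_product K) @[q --> (x, p)] --> (dfwith p i x : line_product K).
Proof.
apply: line_product_cvg => j; have [ij|ij] := eqVneq i j.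
  case: _ / ij; rewrite dfwithin.
  have E : (fun q : K i * line_product K => dfwith q.2 i q.1 i) = fst.
    by apply/funext => q; rewrite dfwithin.
  have : (fun q : K i * line_product K => dfwith q.2 i q.1 i) @ nbhs (x, p) --> x.
    by rewrite E; exact: cvg_fst.
  exact.
rewrite dfwithout//.
have E : (fun q : K i * line_product K => dfwith q.2 i q.1 j) = (fun q => q.2 j).
  by apply/funext => q; rewrite dfwithout.
have : (fun q : K i * line_product K => dfwith q.2 i q.1 j) @ nbhs (x, p) --> p j.
  rewrite E; apply: (@cvg_comp _ _ _ snd (fun q : line_product K => q j) _ (nbhs p)).
    exact: cvg_snd.
  exact: line_product_proj.
exact.
Qed.

(** Uniform continuity in the parameter, by compactness of one factor. *)
Lemma section_near (Z : normedModType R) (h : line_product K -> Z) i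
    (p : line_product K) (e : R) :
  continuous h -> 0 < e -> \forall q \near p, forall x : K i,
    `|h (dfwith q i x) - h (dfwith p i x)| <= e.
Proof.
move=> ch e0; have e2 : 0 < e / 2 by rewrite divr_gt0.
have cov := iffLR (compact_near_coveringP _) (@line_compact (K i)).
pose P (q : line_product K) (x : K i) := `|h (dfwith q i x) - h (dfwith p i x)| <= e.
suff near_x (x : K i) : \forall x' \near x & q \near p, P q x'.
  apply: (@filterS _ (nbhs p) (nbhs_filter p) (fun q => setT `<=` P q)) => [q Pq x|].
    exact: Pq.
  exact: (cov _ (nbhs p) P _ (fun x _ => near_x x)).
have hx : h (dfwith q.2 i q.1) @[q --> (x, p)] --> h (dfwith p i x).
  by apply: (@cvg_comp _ _ _ (fun q => dfwith q.2 i q.1 : line_product K) h _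
    (nbhs (dfwith p i x : line_product K))); [exact: dfwith_cvg|exact: ch].
have hp : h (dfwith p i y) @[y --> x] --> h (dfwith p i x).
  apply: (@cvg_comp _ _ _ (dfwith p i) h _ (nbhs (dfwith p i x : line_product K))).
    exact: (@dfwith_continuous _ (fun i => K i : topologicalType)).
  exact: ch.
have h1 : \forall q \near (x, p), `|h (dfwith p i x) - h (dfwith q.2 i q.1)| <= e / 2.
  by move/cvgrPdist_le : hx => /(_ _ e2).
have h2 : \forall q \near (x, p), `|h (dfwith p i x) - h (dfwith p i q.1)| <= e / 2.
  have : \forall y \near x, `|h (dfwith p i x) - h (dfwith p i y)| <= e / 2.
    by move/cvgrPdist_le : hp => /(_ _ e2).
  exact: cvg_fst.
apply: filterS2 h1 h2 => -[y q] /= h1 h2.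
rewrite /P -(subrKA (h (dfwith p i x))) (le_trans (ler_normD _ _))//.
by rewrite [e]splitr lerD// distrC.
Qed.

Fixpoint tower (l : seq 'I_m) : completeNormedModType R :=
  if l is i :: l' then reg (K i) (tower l') else R^o.

(** Phi f p is f as an iterated function of the coordinates in l, with the other
    coordinates taken from p. Uniform continuity in p is part of the induction, as
    it makes the next partial function regulated. *)
Lemma tower_map (l : seq 'I_m) : exists Phi : CK -> line_product K -> tower l,
  [/\ forall p, linear (Phi^~ p), forall f, continuous (Phi f),
      forall f p, `|Phi f p| <= `|f| &
      forall (f : CK) (p q : line_product K), (forall j, j \notin l -> p j = q j) -> `|f q| <= `|Phi f p| ].
Proof.
elim: l => [|i l [Phi [lPhi cPhi Phif fPhi]]].
  exists (fun f p => f p); split => //=.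
  - by move=> f; exact: Cspace_continuous.
  - by move=> f p; exact: Cspace_ub.
  - move=> f p q pq; suff -> : q = p by [].
    by apply: functional_extensionality_dep => j; rewrite pq.
have lim f (p : line_product K) (x : K i) s : side_limit s x -> exists l' : tower l,
    Phi f (dfwith p i y) @[y --> side_nbhs s x] --> l'.
  move=> sx; exists (Phi f (dfwith p i x)).
  have cy : Phi f (dfwith p i y) @[y --> x] --> Phi f (dfwith p i x).
    apply: (@cvg_comp _ _ _ (dfwith p i) (Phi f) _ (nbhs (dfwith p i x : line_product K))).
      exact: (@dfwith_continuous _ (fun i => K i : topologicalType)).
    exact: cPhi.
  by move=> A /cy; exact: side_nbhs_le.
have Phi_le f (p : line_product K) (x : K i) : `|Phi f (dfwith p i x)| <= `|f| by exact: Phif.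
pose Psi f (p : line_product K) : reg (K i) (tower l) := sval (reg_mk (Phi_le f p) (lim f p)).
have PsiE f p y : Psi f p (y, None) = Phi f (dfwith p i y).
  exact: (svalP (reg_mk (Phi_le f p) (lim f p))).
exists Psi; split.
- by move=> p a f g; apply: reg_ext => y; rewrite fspaceD fspaceZ !PsiE lPhi.
- move=> f p; apply/(@cvgrPdist_le _ _ _ (nbhs p) (nbhs_filter p)) => e e0.
  apply: (@filterS _ (nbhs p) (nbhs_filter p)) (section_near i p (cPhi f) e0) => q h.
  apply: reg_norm_le => [|y]; first exact: ltW.
  by rewrite fspaceB !PsiE distrC; exact: h.
- by move=> f p; apply: reg_norm_le => // y; rewrite PsiE.
- move=> f p q pq.
  have := fPhi f (dfwith p i (q i)) q; rewrite -PsiE => h.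
  apply: le_trans (h _) (fspace_ub _ _) => j jl.
  have [ij|ij] := eqVneq i j; first by case: _ / ij; rewrite dfwithin.
  by rewrite dfwithout//; apply: pq; rewrite in_cons negb_or eq_sym ij.
Qed.

Lemma emb_tower : emb CK (tower (enum 'I_m)).
Proof.
have [Phi [lPhi _ Phif fPhi]] := tower_map (enum 'I_m).
pose p : line_product K := fun i => sval (cid (@line_nonempty (K i))).
have bPhi : exists M, forall f, `|Phi f p| <= M * `|f|.
  by exists 1 => f; rewrite mul1r.
exists (Bop (lPhi p) bPhi), 1 => // f; rewrite mul1r; apply: supnorm_le => // q _.
by apply: fPhi => j; rewrite mem_enum.
Qed.

End towers.

Definition big_line (kappa : Type) (L : compactLine) := exists s (x : L), big_side kappa s x.

Section upper_bound.
Context {R : realType} {kappa : Type} (kinf : infinite_set [set: kappa]).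
Context {m : nat} (K : 'I_m -> compactLine).

Lemma killed_tower (l : seq 'I_m) :
  killed kinf (count (fun i => `[< big_line kappa (K i) >]) l).+1 (tower (R := R) K l).
Proof.
elim: l => [|i l ih] /=; first exact: killed_scalars.
rewrite addnC -addSn; exact: (killed_reg (@compact_line_complete (K i)) ih).
Qed.

Lemma killed_Cspace : killed kinf (count (fun i => `[< big_line kappa (K i) >]) (enum 'I_m)).+1
  (Cspace R (line_product_compact K)).
Proof. exact: killed_emb (emb_tower K) (@killed_tower _). Qed.

End upper_bound.

(** * The square of an infinite cardinal *)

Section injections.
Context {T : Type} (x0 : T).
Implicit Types A B : set T.

Definition inj_into A B (f : T -> T) :=
  (forall a, A a -> B (f a)) /\ forall a b, A a -> A b -> f a = f b -> a = b.

(** A maximal partial injection exhausts one of the sets. *)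
Lemma inj_into_total A B : (exists f, inj_into A B f) \/ (exists f, inj_into B A f).
Proof.
pose P (G : set (T * T)) := [/\ forall p, G p -> A p.1 /\ B p.2,
  forall p q, G p -> G q -> p.1 = q.1 -> p = q &
  forall p q, G p -> G q -> p.2 = q.2 -> p = q].
have [F FP Ftot|G [[GAB G1 G2] Gmax]] := @Zorn_bigcup _ P.
  have both p q : (\bigcup_(X in F) X) p -> (\bigcup_(X in F) X) q ->
      exists2 X, F X & X p /\ X q.
    move=> [X FX Xp] [Y FY Yq]; have [XY|YX] := Ftot _ _ FX FY.
      by exists Y => //; split=> //; exact: XY.
    by exists X => //; split=> //; exact: YX.
  split=> [p [X /FP[h _ _] /h]//|p q hp hq|p q hp hq].
    by have [X /FP[_ h _] [Xp Xq]] := both _ _ hp hq; exact: h.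
  by have [X /FP[_ _ h] [Xp Xq]] := both _ _ hp hq; exact: h.
have [Adom|/existsNP[a /not_implyP[Aa aG]]] :=
    pselect (forall a, A a -> exists b, G (a, b)).
  have /choice[f fG] : forall a, exists b, A a -> G (a, b).
    by move=> a; have [/Adom[b]|] := pselect (A a); [exists b|exists x0].
  left; exists f; split=> [a /fG/GAB[]//|a b Aa Ab fab].
  by have [] := G2 _ _ (fG _ Aa) (fG _ Ab) fab.
have [Bdom|/existsNP[b /not_implyP[Bb bG]]] :=
    pselect (forall b, B b -> exists a, G (a, b)).
  have /choice[f fG] : forall b, exists a, B b -> G (a, b).
    by move=> b; have [/Bdom[c]|] := pselect (B b); [exists c|exists x0].
  right; exists f; split=> [c /fG/GAB[]//|c c' Bc Bc' fcc].
  by have [] := G1 _ _ (fG _ Bc) (fG _ Bc') fcc.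
suff : (G `|` [set (a, b)]) (a, b) -> False by move=> h; exfalso; apply: h; right.
suff -> : G `|` [set (a, b)] = G by move=> Gab; apply: aG; exists b.
have aG' p : G p -> p.1 <> a by case: p => c c' Gc /= ca; apply: aG; exists c'; rewrite -ca.
have bG' p : G p -> p.2 <> b by case: p => c c' Gc /= cb; apply: bG; exists c; rewrite -cb.
apply: contrapT => GG; apply: (Gmax (G `|` [set (a, b)])); last first.
  split=> [p [/GAB//|->//]|p q [Gp|->] [Gq|->] //= pq|p q [Gp|->] [Gq|->] //= pq].
  - exact: G1.
  - by case: (aG' _ Gp).
  - by case: (aG' _ Gq).
  - exact: G2.
  - by case: (bG' _ Gp).
  - by case: (bG' _ Gq).
split; first by move=> p Gp; left.
by move=> h; apply: GG; apply/seteqP; split=> [|p Gp]; [exact: h|left].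
Qed.

(** The value outside A x A is fixed in order that pairings with the same
    restriction be equal. *)
Definition pairing A (f : T -> T -> T) := [/\ forall a b, A a -> A b -> A (f a b),
  forall a b c d, A a -> A b -> A c -> A d -> f a b = f c d -> a = c /\ b = d &
  forall a b, ~ (A a /\ A b) -> f a b = x0].

Hypothesis Tinf : infinite_set [set: T].

Lemma pairing_nat : exists g : nat -> T, injective g /\ exists f, pairing (range g) f.
Proof.
have [g [gI _]] := infinite_injection Tinf; exists g; split=> //.
pose idx a := if pselect (exists n, g n = a) is left h then sval (cid h) else 0%N.
have idxE n : idx (g n) = n.
  rewrite /idx; case: pselect => [h|[]]; last by exists n.
  exact/gI/(svalP (cid h)).
exists (fun a b => if pselect (range g a /\ range g b) is left _
  then g (pickle (idx a, idx b)) else x0); split.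
- move=> a b ga gb; case: (pselect (range g a /\ range g b)) => [_|[]//].
  by exists (pickle (idx a, idx b)).
- move=> a b c d ga gb gc gd.
  case: (pselect (range g a /\ range g b)) => [_|[]//].
  case: (pselect (range g c /\ range g d)) => [_|[]//].
  move: ga gb gc gd => [i _ <-] [j _ <-] [k _ <-] [l _ <-].
  by rewrite !idxE => /gI/(pcan_inj pickleK)[-> ->].
- by move=> a b; case: (pselect (range g a /\ range g b)).
Qed.

(** Zorn's lemma gives a maximal set A with a pairing; its complement does not
    contain a copy of A, as the pairing could be extended to the union. *)
Lemma pairing_square : exists f : T -> T -> T, forall a b c d,
  f a b = f c d -> a = c /\ b = d.
Proof.
have [g [gI [f0 pf0]]] := pairing_nat.
pose S := {p : set T * (T -> T -> T) | range g `<=` p.1 /\ pairing p.1 p.2}.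
pose le (p q : S) := `[< (sval p).1 `<=` (sval q).1 /\
  forall a b, (sval p).1 a -> (sval p).1 b -> (sval p).2 a b = (sval q).2 a b >].
have [| | | |[[A f] /= [gA [fA fI fx0]]] Amax] := @Zorn S le.
- by move=> p; apply/asboolP; split.
- move=> q p r /asboolP[pq pqf] /asboolP[qr qrf]; apply/asboolP; split.
    exact: subset_trans pq qr.
  by move=> a b pa pb; rewrite pqf// qrf//; exact: pq.
- move=> [[A f] [/= gA [fA fI fx]]] [[B h] [/= gB [hB hI hx]]].
  move=> /asboolP[/= AB fh] /asboolP[/= BA hf]; apply: eq_exist => /=.
  have E : A = B by apply/seteqP.
  rewrite E in fA fI fx fh *; congr (_, _); apply/funext => a; apply/funext => b.
  have [[Ba Bb]|nab] := pselect (B a /\ B b); first exact: fh.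
  by rewrite (fx _ _ nab) (hx _ _ nab).
- move=> F Ftot; have [[p0 Fp0]|F0] := pselect (exists p, F p); last first.
    exists (exist _ (range g, f0) (conj (@subset_refl _ _) pf0)) => p Fp.
    by case: F0; exists p.
  pose U := [set a | exists2 p : S, F p & (sval p).1 a].
  have both (a b : T) : U a -> U b -> exists2 p : S, F p & (sval p).1 a /\ (sval p).1 b.
    move=> [p Fp pa] [q Fq qb]; have [/asboolP[pq _]|/asboolP[qp _]] := Ftot _ _ Fp Fq.
      by exists q => //; split=> //; exact: pq.
    by exists p => //; split=> //; exact: qp.
  have four a b c d : U a -> U b -> U c -> U d -> exists2 p : S, F p &
      [/\ (sval p).1 a, (sval p).1 b, (sval p).1 c & (sval p).1 d].
    move=> Ua Ub Uc Ud; have [p Fp [pa pb]] := both _ _ Ua Ub.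
    have [q Fq [qc qd]] := both _ _ Uc Ud.
    have [/asboolP[pq _]|/asboolP[qp _]] := Ftot _ _ Fp Fq.
      by exists q => //; split=> //; exact: pq.
    by exists p => //; split=> //; exact: qp.
  have same (p q : S) a b : F p -> F q -> (sval p).1 a -> (sval p).1 b ->
      (sval q).1 a -> (sval q).1 b -> (sval p).2 a b = (sval q).2 a b.
    move=> Fp Fq pa pb qa qb.
    have [/asboolP[_ h]|/asboolP[_ h]] := Ftot _ _ Fp Fq; first exact: h.
    by rewrite h.
  have hf a b : exists c, (U a /\ U b -> forall p : S, F p -> (sval p).1 a ->
      (sval p).1 b -> c = (sval p).2 a b) /\ (~ (U a /\ U b) -> c = x0).
    have [[Ua Ub]|nab] := pselect (U a /\ U b); last by exists x0; split.
    have [p Fp [pa pb]] := both _ _ Ua Ub; exists ((sval p).2 a b).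
    by split=> [_ q Fq qa qb|[]//]; exact: same.
  have [f2 f2P] := choice (fun p : T * T => hf p.1 p.2).
  pose f a b := f2 (a, b).
  have fP a b : (U a /\ U b -> forall p : S, F p -> (sval p).1 a ->
      (sval p).1 b -> f a b = (sval p).2 a b) /\ (~ (U a /\ U b) -> f a b = x0).
    exact: (f2P (a, b)).
  have fE (p : S) a b : F p -> (sval p).1 a -> (sval p).1 b -> f a b = (sval p).2 a b.
    move=> Fp pa pb; have [+ _] := fP a b; apply => //.
    by split; exists p.
  have Uprop : range g `<=` (U, f).1 /\ pairing (U, f).1 (U, f).2.
    split; first by move=> a ga; exists p0 => //; exact: (svalP p0).1.
    split=> /= [a b Ua Ub|a b c d Ua Ub Uc Ud|a b]; last exact: (fP a b).2.
      have [p Fp [pa pb]] := both _ _ Ua Ub; exists p => //; rewrite (fE p)//.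
      by have [_ [h _ _]] := svalP p; exact: h.
    have [p Fp [pa pb pc pd]] := four _ _ _ _ Ua Ub Uc Ud.
    by rewrite !(fE p)//; have [_ [_ h _]] := svalP p; exact: h.
  exists (exist _ (U, f) Uprop) => p Fp; apply/asboolP; split=> /= [a pa|a b pa pb].
    by exists p.
  by rewrite (fE p).
have Ag n : A (g n) by apply: (gA); exists n.
have [[h [hA hI]]|[h [hA hI]]] := inj_into_total A (~` A); last first.
  pose j x := if pselect (A x) then f (g 0%N) x else f (g 1%N) (h x).
  have jA x : A (j x).
    by rewrite /j; case: (pselect (A x)) => ? /=; apply: (fA) => //; exact: hA.
  have jI x y : j x = j y -> x = y.
    rewrite /j; case: (pselect (A x)) => Ax; case: (pselect (A y)) => Ay /=.
    - by move=> /fI[].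
    - by move=> /fI[//|//|//||/gI//]; exact: hA.
    - by move=> /fI[//||//|//|/gI//]; exact: hA.
    - move=> /fI[//||//||_ /hI]; [exact: hA|exact: hA|exact].
  exists (fun a b => f (j a) (j b)) => a b c d /fI[//|//|//|//|/jI-> /jI->//].
pose B := A `|` (h @` A).
have hu x : exists u, (A x -> u = x) /\ (~ A x -> (h @` A) x -> A u /\ h u = x).
  have [Ax|Ax] := pselect (A x); first by exists x; split.
  have [[u Au hu]|nx] := pselect ((h @` A) x); first by exists u; split.
  by exists x0; split.
have [u uP] := choice hu.
have uA x : B x -> A (u x).
  have [Ax|nAx] := pselect (A x); first by rewrite (uP x).1.
  by move=> [//|hx]; exact: ((uP x).2 nAx hx).1.
have uI x y : B x -> B y -> (A x <-> A y) -> u x = u y -> x = y.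
  move=> Bx By [AA AA']; have [Ax|nAx] := pselect (A x).
    by rewrite (uP x).1// (uP y).1//; exact: AA.
  have nAy : ~ A y by move=> /AA'.
  case: Bx => // hx; case: By => // hy uxy.
  by rewrite -((uP x).2 nAx hx).2 uxy ((uP y).2 nAy hy).2.
pose t x y := if pselect (A x) then (if pselect (A y) then g 0%N else g 1%N)
  else (if pselect (A y) then g 2%N else g 3%N).
have tA x y : A (t x y).
  by rewrite /t; case: (pselect (A x)) => ? /=; case: (pselect (A y)) => ? /=.
have tI x y x' y' : t x y = t x' y' -> (A x <-> A x') /\ (A y <-> A y').
  rewrite /t; case: (pselect (A x)) => ?; case: (pselect (A y)) => ?;
  by case: (pselect (A x')) => ?; case: (pselect (A y')) => ? /= /gI //; do 2!split.
pose k x y := f (f (t x y) (u x)) (u y).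
have kA x y : B x -> B y -> A (k x y) by move=> Bx By; do 2?apply: (fA) => //; exact: uA.
have kI x y x' y' : B x -> B y -> B x' -> B y' -> k x y = k x' y' -> x = x' /\ y = y'.
  move=> Bx By Bx' By' /fI[]; try by [exact: uA|apply: (fA) => //; exact: uA].
  move=> /fI[//||//||/tI[xx yy] uxx uyy]; try exact: uA.
  by split; apply: uI.
(* New pairs take their values in h(A), old pairs keep theirs in A. *)
pose f' x y := if pselect (A x /\ A y) then f x y else
  if pselect (B x /\ B y) then h (k x y) else x0.
have f'old x y : A x -> A y -> f' x y = f x y.
  by move=> Ax Ay; rewrite /f'; case: (pselect (A x /\ A y)) => // -[].
have f'new x y : ~ (A x /\ A y) -> B x -> B y -> f' x y = h (k x y).
  move=> nA Bx By; rewrite /f'; case: (pselect (A x /\ A y)) => //= _.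
  by case: (pselect (B x /\ B y)) => // -[].
have f'B : pairing B f'.
  split=> [x y Bx By|x y x' y' Bx By Bx' By'|x y nB].
  - have [[Ax Ay]|n] := pselect (A x /\ A y).
      by left; rewrite f'old//; exact: (fA).
    by right; rewrite f'new//; exists (k x y) => //; exact: kA.
  - have [[Ax Ay]|n] := pselect (A x /\ A y); have [[Ax' Ay']|n'] := pselect (A x' /\ A y').
    + by rewrite !f'old// => /fI; apply.
    + rewrite f'old// f'new// => E; have := fA _ _ Ax Ay; rewrite E => Ah.
      by case: (hA _ (kA _ _ Bx' By')).
    + rewrite [in RHS]f'old// f'new// => E; have := fA _ _ Ax' Ay'; rewrite -E => Ah.
      by case: (hA _ (kA _ _ Bx By)).
    + rewrite !f'new// => /hI E; apply: kI => //; apply: E; exact: kA.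
  - rewrite /f'; case: (pselect (A x /\ A y)) => [[Ax Ay]|_] /=.
      by case: nB; split; left.
    by case: (pselect (B x /\ B y)).
have Bprop : range g `<=` (B, f').1 /\ pairing (B, f').1 (B, f').2.
  by split=> // a ga; left; exact: (gA).
have BA : B = A.
  rewrite -[LHS]/(sval (exist _ (B, f') Bprop : S)).1 (Amax (exist _ (B, f') Bprop))//.
  by apply/asboolP; split=> /= [a Aa|a b Aa Ab]; [left|rewrite f'old].
have : B (h (g 0%N)) by right; exists (g 0%N).
by rewrite BA => Ahg; case: (hA _ (Ag 0%N)).
Qed.

End injections.

Lemma card_square (kappa : Type) : infinite_set [set: kappa] ->
  ([set: kappa * kappa] #<= [set: kappa])%card.
Proof.
move=> kinf; have [x0 _] := infinite_setN0 kinf.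
have [f fI] := pairing_square x0 kinf.
elim/Ppointed: kappa => kappa in x0 kinf f fI *; first by case: (no x0).
by apply/pcard_injP; exists (fun p => f p.1 p.2) => -[a b] [c d] _ _ /= /fI[-> ->].
Qed.

Lemma card_leX (S T U : Type) (u0 : U) (A : set S) (B : set T) :
  (A #<= [set: U])%card -> (B #<= [set: U])%card -> (A `*` B #<= [set: U * U])%card.
Proof.
elim/Ppointed: U => U in u0 *; first by case: (no u0).
move=> /pcard_injP[f fI] /pcard_injP[g gI].
apply/pcard_injP; exists (fun p => (f p.1, g p.2)) => -[a b] [c d].
rewrite !inE => -[/= Aa Bb] [/= Ac Bd] [fac gbd].
by congr (_, _); [apply: fI|apply: gI]; rewrite ?inE.
Qed.

(** * Big sides and the character *)

Section character.
Context (kappa : Type) (kinf : infinite_set [set: kappa]).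

Lemma big_side_limit {d} (L : orderType d) s (x : L) : big_side kappa s x -> side_limit s x.
Proof.
move=> bx; split.
  by have [|//|a ax _] := bx set0; [exact: card_ge0|exists a].
move=> a ax; have [|b ->//|b bx' ab] := bx [set a].
  by apply: countable_card_le => //; exact: countable1.
by exists b => //; exact: ab.
Qed.

(** Points of the members of a small base at x, chosen on a given side of x, are
    cofinal at that side. *)
Lemma character_big_line (L : compactLine) : character_le L kappa -> ~ big_line kappa L.
Proof.
move=> ch [s [x bx]]; have [B [Bnbhs Bbase] Bk] := ch x.
have sx := big_side_limit bx.
have PF := side_nbhs_proper sx.
have hb U : exists b : L, B U -> U b /\ slt s b x.
  have [BU|] := pselect (B U); last by exists x.
  have /open_nbhs_nbhs/(side_nbhs_le sx) : open_nbhs x U by exact: Bnbhs.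
  move=> [a ax aU]; have [y ay yx] := sx.2 _ ax.
  by exists y => _; split => //; exact: aU.
have [b bP] := choice hb.
have [||a ax aB] := bx (b @` B).
- exact: card_le_trans (card_image_le _ _) Bk.
- by move=> _ [U BU <-]; exact: (bP _ BU).2.
pose V := [set y : L | slt s a y].
have [U BU UV] : exists2 U, B U & U `<=` V.
  apply: Bbase; apply: open_nbhs_nbhs; split=> //; rewrite /V /slt.
  case: (s); first by have := rray_open a; rewrite set_itvE.
  by have := lray_open a; rewrite set_itvE.
have := aB (b U); rewrite (_ : slt s (b U) a = false).
  by move=> /(_ (imageP _ BU)).
by apply/negbTE/slt_asym/UV; exact: (bP _ BU).1.
Qed.

(** The intervals whose end points come from small cofinal sets at the two sides of
    x form a base at x; their number is at most the square of kappa. *)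
Lemma big_line_character (L : compactLine) : ~ big_line kappa L -> character_le L kappa.
Proof.
move=> nb x.
have hB s : exists B : set L, [/\ (B #<= [set: kappa])%card,
    forall b, B b -> slt s b x & forall a, slt s a x -> exists2 b, B b & ~~ slt s b a].
  have /existsNP[B /not_implyP[Bk /not_implyP[Bx Bcof]]] : ~ big_side kappa s x.
    by move=> bx; apply: nb; exists s, x.
  exists B; split=> // a ax; apply: contrapT => h; apply: Bcof; exists a => // b Bb.
  by apply/negP => /negP nba; apply: h; exists b => //; apply/negP.
have [B BP] := choice hB.
(* None stands for the absence of a bound on its side. *)
pose O s : set (option L) := Some @` B s `|` [set None].
have Ok s : (O s #<= [set: kappa])%card.
  apply: card_leU1 => //; apply: card_le_trans (card_image_le _ _) _.
  by have [] := BP s.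
pose U (p : option L * option L) : set L := [set y |
  (if p.1 is Some b then (b < y)%O else true) /\ (if p.2 is Some c then (y < c)%O else true)].
exists (U @` (O true `*` O false)); last first.
  apply: card_le_trans (card_image_le _ _) _.
  have [u0 _] := infinite_setN0 kinf.
  exact: card_le_trans (card_leX u0 (Ok true) (Ok false)) (card_square kinf).
split=> [_ [[ob oc] [/= Ob Oc] <-]|V].
  split; last first.
    split=> /=.
      by case: ob Ob => // b [[b' Bb [<-]]|//]; have [_ h _] := BP true; exact: h.
    by case: oc Oc => // c [[c' Bc [<-]]|//]; have [_ h _] := BP false; exact: h.
  have -> : U (ob, oc) = (if ob is Some b then `]b, +oo[%classic else setT) `&`
      (if oc is Some c then `]-oo, c[%classic else setT).
    rewrite /U; apply/seteqP; split=> y; case: ob {Ob} => [b|]; case: oc {Oc} => [c|];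
      by rewrite /setI /= ?in_itv /= ?andbT => -[h1 h2]; split.
  apply: openI.
    by case: ob {Ob} => [b|]; [exact: rray_open|exact: openT].
  by case: oc {Oc} => [c|]; [exact: lray_open|exact: openT].
rewrite itv_nbhsE => -[[l u] [/= oi]]; rewrite itv_boundlr => /andP[lx xu] iV.
have [ob Ob [bx bl]] : exists2 ob, O true ob & (if ob is Some b then (b < x)%O else true) /\
    forall y, (if ob is Some b then (b < y)%O else true) -> (l <= BLeft y)%O.
  case: l oi lx {iV} => [[] a|[]] oi lx //.
  - have [_ Bx cof] := BP true; have [|b Bb] := cof a; first by move: lx; rewrite bnd_simp.
    rewrite /slt -leNgt => ab; exists (Some b); first by left; exists b.
    split; first exact: Bx.
    by move=> y lty; rewrite bnd_simp (le_lt_trans ab).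
  - by exists None; [right|split].
have [oc Oc [xc cu]] : exists2 oc, O false oc & (if oc is Some c then (x < c)%O else true) /\
    forall y, (if oc is Some c then (y < c)%O else true) -> (BRight y <= u)%O.
  case: u oi xu {iV} => [[] a|[]] oi xu //.
  - have [_ Bx cof] := BP false; have [|b Bb] := cof a; first by move: xu; rewrite bnd_simp.
    rewrite /slt -leNgt => ab; exists (Some b); first by left; exists b.
    split; first exact: Bx.
    by move=> y lty; rewrite bnd_simp (lt_le_trans lty).
  - by move: oi => /itv_open_ends_rside.
  - by exists None; [right|split].
exists (U (ob, oc)); first by exists (ob, oc).
move=> y [/= yb yc]; apply: iV; rewrite /= itv_boundlr; apply/andP; split.
  by apply: bl; move: yb; clear; case: ob.
by apply: cu; move: yc; clear; case: oc.
Qed.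

End character.

(** * Limits along big sides *)

Section eventually_constant.
Context {R : realType} {kappa : Type} (kinf : infinite_set [set: kappa]).
Context {d : Order.disp_t} {L : orderType d} (s : bool) (x : L).
Hypothesis bx : big_side kappa s x.
Context (Y : completeNormedModType R).

Definition ev_const (g : L -> R) (r : R) :=
  exists2 a, slt s a x & forall b, slt s a b -> slt s b x -> g b = r.

Lemma ev_const_uniq g r r' : ev_const g r -> ev_const g r' -> r = r'.
Proof.
move=> [a ax ga] [b bx' gb].
have [c] := (big_side_limit kinf bx).2 _ (lt_smax ax bx').
by rewrite smax_lt => /andP[ac bc] cx; rewrite -(ga c)// (gb c).
Qed.

Lemma ev_const_lin k g h r r' : ev_const g r -> ev_const h r' ->
  ev_const (fun a => k * g a + h a) (k * r + r').
Proof.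
move=> [a ax ga] [b bx' hb]; exists (smax s a b); first exact: lt_smax.
by move=> c; rewrite smax_lt => /andP[ac bc] cx; rewrite ga// hb.
Qed.

Lemma ev_const_le g r M : ev_const g r -> (forall a, slt s a x -> `|g a| <= M) -> `|r| <= M.
Proof.
move=> [a ax ga] gM; have [b ab b_x] := (big_side_limit kinf bx).2 _ ax.
by rewrite -(ga b)// gM.
Qed.

(** For kappa many functionals there is an index beyond which all of them have
    taken their eventual values, since the side is big. *)
Lemma ev_const_kappa (u : L -> Y) M : (forall a, slt s a x -> `|u a| <= M) ->
  (forall q : dual Y, exists r, ev_const (fun a => q (u a)) r) ->
  exists F : kap kinf Y, forall q : dual Y, ev_const (fun a => q (u a)) (kval F q).
Proof.
move=> uM uev.
have [v vP] := choice uev.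
have lv : linear (v : dual Y -> R^o).
  move=> k p q; apply: (ev_const_uniq (vP _)).
  by have [a] := ev_const_lin k (vP p) (vP q); exists a.
have bv q : `|v q : R^o| <= M * `|q|.
  apply: (ev_const_le (vP q)) => a ax; rewrite (le_trans (dual_ub q _))// mulrC.
  by rewrite ler_wpM2r// uM.
have [G GE] := dual_mk lv bv.
have kG : kappa_set kappa G.
  have hc (q : dual Y) : exists a, slt s a x /\ forall b, slt s a b -> slt s b x -> q (u b) = v q.
    by have [a] := vP q; exists a.
  move=> A Ak; have [c cP] := choice hc.
  have [||a ax aA] := bx (B := c @` A).
  - exact: card_le_trans (card_image_le _ _) Ak.
  - by move=> _ [q _ <-]; exact: (cP q).1.
  have [b ab b_x] := (big_side_limit kinf bx).2 _ ax.
  exists (u b) => q Aq; rewrite GE; apply/esym/(cP q).2 => //.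
  by apply: slt_trans ab; apply: aA; exists q.
by exists (kap_mk kinf kG) => q; rewrite kap_mkE GE; exact: vP.
Qed.

End eventually_constant.

Section bumps.
Context {R : realType} {kappa : Type} (kinf : infinite_set [set: kappa]).
Context (L : compactLine) (s : bool) (x : L).
Hypothesis bx : big_side kappa s x.

(** The second component of the pair is a point before x at which the first one has
    already reached the value 1. *)
Lemma bump_exists (a : L) : exists p : (L -> R) * L, slt s a x ->
  [/\ continuous p.1, forall y, 0 <= p.1 y <= 1,
      slt s a p.2 /\ slt s p.2 x,
      forall y, ~~ slt s a y -> p.1 y = 0 & forall y, ~~ slt s y p.2 -> p.1 y = 1].
Proof.
have [ax|] := boolP (slt s a x); last by exists (fun=> 0, x).
have [c ac cx] := (big_side_limit kinf bx).2 _ ax.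
pose A := [set y : L | ~~ slt s a y]; pose B := [set y : L | ~~ slt s y c].
have cA : closed A.
  rewrite /A /slt; case: (s).
    rewrite (_ : [set _ | _] = `]-oo, a]%classic); first exact: lray_closed.
    by apply/seteqP; split=> y; rewrite /= in_itv/= -leNgt.
  rewrite (_ : [set _ | _] = `[a, +oo[%classic); first exact: rray_closed.
  by apply/seteqP; split=> y; rewrite /= in_itv/= andbT -leNgt.
have cB : closed B.
  rewrite /B /slt; case: (s).
    rewrite (_ : [set _ | _] = `[c, +oo[%classic); first exact: rray_closed.
    by apply/seteqP; split=> y; rewrite /= in_itv/= andbT -leNgt.
  rewrite (_ : [set _ | _] = `]-oo, c]%classic); first exact: lray_closed.
  by apply/seteqP; split=> y; rewrite /= in_itv/= -leNgt.
have AB : A `&` B = set0.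
  apply/seteqP; split=> // y [/= Ay By]; move/negP: Ay; apply.
  exact: slt_transN ac By.
have nL : normal_space L by apply: compact_normal; [exact: order_hausdorff|exact: line_compact].
have sep := normal_uniform_separator nL cA cB AB.
exists (Urysohn A B, c) => _; split=> //=.
- exact: Urysohn_continuous.
- move=> y; have /(_ (Urysohn A B y)) := @Urysohn_range L R A B.
  by rewrite /= in_itv/=; apply; exists y.
- by move=> y Ay; have := @Urysohn_sub0 L R A B sep; apply; exists y.
- by move=> y By; have := @Urysohn_sub1 L R A B sep; apply; exists y.
Qed.

End bumps.


(** * Continuous functions of some of the coordinates *)

Section dependent_functions.
Context {R : realType} {m : nat} (K : 'I_m -> compactLine).
Notation CK := (Cspace R (line_product_compact K)).

(** The continuous functions on the partial product over l, realized as functions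
    on the full product. *)
Definition dep_set (l : seq 'I_m) : set CK := [set f : CK |
  forall p q : line_product K, (forall j, j \in l -> p j = q j) -> f p = f q].

Lemma Cspace_dist (f g : CK) p e : `|f - g| < e -> `|f p - g p| <= e.
Proof. by move=> fg; have /le_trans := Cspace_ub (f - g) p; apply; exact: ltW. Qed.

Lemma dep_set0 l : dep_set l 0. Proof. by []. Qed.

Lemma dep_set_linear l a f g : dep_set l f -> dep_set l g -> dep_set l (a *: f + g).
Proof.
move=> hf hg p q pq.
by rewrite -[LHS]/(a * f p + g p) -[RHS]/(a * f q + g q) (hf p q)// (hg p q).
Qed.

Lemma dep_set_closed l : closed (dep_set l).
Proof.
move=> f cl p q pq; apply/eqP; rewrite -subr_eq0 -normr_eq0 eq_le normr_ge0 andbT.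
apply/ler_addgt0Pl => e e0; rewrite addr0; have e2 : 0 < e / 2 by rewrite divr_gt0.
have [g [hg]] := cl _ (nbhsx_ballx f _ e2); rewrite -ball_normE /= => fg.
have hp r : `|(f : CK) r - (g : CK) r| <= e / 2 by exact: Cspace_dist.
rewrite -(subrKA ((g : CK) p)) (le_trans (ler_normD _ _))// [e]splitr lerD ?hp//.
by rewrite (hg _ _ pq) distrC hp.
Qed.

Definition dep_sub l := ClosedSubmod (@dep_set0 l) (@dep_set_linear l) (@dep_set_closed l).

Definition dep l : completeNormedModType R := csub (dep_sub l).

Definition dep_val l (f : dep l) : CK := csub_val f.

Lemma dep_valP l (f : dep l) : dep_set l (dep_val f).
Proof. exact: (csub_valP (S := dep_sub l) f). Qed.

Lemma dep_mk l (f : CK) : dep_set l f -> {g : dep l | dep_val g = f}.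
Proof. by move=> hf; exists (Csub (mem_set hf : f \in csub_pred (dep_sub l))). Qed.

Lemma dep_norm_le l (f : dep l) M : 0 <= M -> (forall p, `|dep_val f p| <= M) -> `|f| <= M.
Proof. by move=> M0 fM; apply: supnorm_le => // p _; exact: fM. Qed.

Lemma dep_norm_ub l (f : dep l) p : `|dep_val f p| <= `|f|.
Proof. exact: Cspace_ub (dep_val f) p. Qed.

Lemma dep_ext l (f g : dep l) : (forall p, dep_val f p = dep_val g p) -> f = g.
Proof. by move=> fg; apply/val_inj/val_inj/funext => p; exact: fg. Qed.

Lemma dep_val_linear l : linear (@dep_val l). Proof. by []. Qed.

Lemma dep_valL l a (f g : dep l) p :
  dep_val (a *: f + g) p = a * dep_val f p + dep_val g p.
Proof. by rewrite dep_val_linear. Qed.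

Lemma dep_valB l (f g : dep l) p : dep_val (f - g) p = dep_val f p - dep_val g p.
Proof. by rewrite addrC -scaleN1r dep_valL mulN1r addrC. Qed.

Lemma dep_val_bounded l : exists M, forall f : dep l, `|dep_val f| <= M * `|f|.
Proof. by exists 1 => f; rewrite mul1r. Qed.

Definition dep_incl l : bop (dep l) CK := Bop (@dep_val_linear l) (@dep_val_bounded l).

Lemma emb_dep l : emb (dep l) CK.
Proof. by exists (dep_incl l), 1 => // f; rewrite mul1r. Qed.

Lemma dep_nontrivial l : ~ trivial_space (dep l).
Proof.
move=> h.
have c1 : (fun _ : line_product K => 1 : R^o) \in @continuous_pred R (line_product K).
  by apply/asboolP; exact: cst_continuous.
pose f : CK := ContFun c1.
have [|g gf] := @dep_mk l f; first by move=> p q _.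
pose p : line_product K := fun i => sval (cid (@line_nonempty (K i))).
have : dep_val g p = 1 by rewrite gf.
rewrite (h g) => /esym/eqP; rewrite -[dep_val 0 p]/(0 : R).
by rewrite oner_eq0.
Qed.

Section evaluation.
Context (l : seq 'I_m) (p : line_product K).

Lemma dep_eval_lin : linear (fun f : dep l => dep_val f p : R^o).
Proof. by move=> a f g; exact: dep_valL. Qed.

Lemma dep_eval_bd (f : dep l) : `|dep_val f p : R^o| <= 1 * `|f|.
Proof. by rewrite mul1r; exact: dep_norm_ub. Qed.

Lemma dep_eval_exists : exists e : dual (dep l), `|e| <= 1 /\ forall f, e f = dep_val f p.
Proof.
have [e eE] := dual_mk dep_eval_lin dep_eval_bd; exists e; split=> [|f]; last by rewrite eE.
by apply: dual_norm_le => // f; rewrite eE; exact: dep_eval_bd.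
Qed.

End evaluation.

End dependent_functions.

Arguments dep_val : simpl never.
(* Conversion would otherwise compare the functions themselves. *)
Opaque dep_val.

(** * The lower bound *)

Lemma sum_nat_recr (V : nmodType) (F : nat -> V) n :
  \sum_(0 <= k < n.+1) F k = \sum_(0 <= k < n) F k + F n.
Proof. exact: big_nat_recr. Qed.

Lemma side_nbhs_lt {d : Order.disp_t} (L : orderType d) s (x : L) :
  (exists a, slt s a x) -> side_nbhs s x [set y | slt s y x].
Proof. by move=> [a ax]; exists a => // y []. Qed.

Section lower_step.
Context {R : realType} {kappa : Type} (kinf : infinite_set [set: kappa]).
Context {m : nat} (K : 'I_m -> compactLine).
Context (i : 'I_m) (l : seq 'I_m) (il : i \notin l) (s : bool) (x : K i).
Hypothesis bx : big_side kappa s x.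
Context (phi : K i -> (K i -> R) * K i).
Notation c a := (phi a).2.
Hypothesis phiP : forall a, slt s a x ->
  [/\ continuous (phi a).1, forall y, 0 <= (phi a).1 y <= 1,
      slt s a (c a) /\ slt s (c a) x,
      forall y, ~~ slt s a y -> (phi a).1 y = 0 & forall y, ~~ slt s y (c a) -> (phi a).1 y = 1].
Notation D := (dep (R := R) K l).
Notation D' := (dep (R := R) K (i :: l)).

Lemma dep_mul (f : K i -> R) (v : D) : continuous f ->
  {g : D' | forall p, dep_val g p = f (p i) * dep_val v p}.
Proof.
move=> cf; pose h (p : line_product K) : R^o := f (p i) * dep_val v p.
have ch : h \in @continuous_pred R (line_product K).
  apply/asboolP => p.
  have cfi : f (q i) @[q --> p] --> f (p i).
    apply: (@cvg_comp _ _ _ (fun q : line_product K => q i) f _ (nbhs (p i))).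
      exact: line_product_proj.
    exact: cf.
  have cv : dep_val v q @[q --> p] --> dep_val v p by exact: Cspace_continuous.
  exact: (@cvgM _ _ _ (nbhs_filter p) _ _ _ _ cfi cv).
have [|g gE] := @dep_mk _ _ K (i :: l) (ContFun ch : Cspace R (line_product_compact K)).
  move=> p q pq; rewrite -[LHS]/(h p) -[RHS]/(h q) /h (pq i) ?mem_head//.
  by rewrite (dep_valP v (q := q))// => j jl; rewrite pq// in_cons jl orbT.
by exists g => p; rewrite gE.
Qed.

Section one_vector.
Context (v : D) (u : K i -> D').
Hypothesis uE : forall a, slt s a x -> forall p, dep_val (u a) p = (phi a).1 (p i) * dep_val v p.

Lemma bump_vector_norm a : slt s a x -> `|u a| <= `|v|.
Proof.
move=> ax; apply: dep_norm_le => // p; rewrite (uE ax) normrM.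
have [_ /(_ (p i))/andP[h0 h1] _ _ _] := phiP ax.
by rewrite (ger0_norm h0) (le_trans _ (dep_norm_ub v p))// ler_piMl.
Qed.

(** A difference of two bumps vanishes outside the interval between the foot of
    the first and the top of the second, and these intervals are disjoint. *)
Lemma bumps_sum_norm (a b : nat -> K i) (e : nat -> R) N :
  (forall n, [/\ slt s (a n) x, slt s (b n) x, ~~ slt s (b n) (c (a n)) & a n.+1 = c (b n)]) ->
  (forall n, `|e n| <= 1) -> `|\sum_(0 <= n < N) e n *: (u (a n) - u (b n))| <= `|v|.
Proof.
move=> ab e1; pose t n y := e n * ((phi (a n)).1 y - (phi (b n)).1 y).
have t1 n y : `|t n y| <= 1.
  have [ax b_x _ _] := ab n; have [_ /(_ y)/andP[? ?] _ _ _] := phiP ax.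
  have [_ /(_ y)/andP[? ?] _ _ _] := phiP b_x.
  rewrite /t normrM mulr_ile1//.
  by rewrite ler_norml; apply/andP; split; lra.
have tl n y : ~~ slt s (a n) y -> t n y = 0.
  move=> ay; have [ax b_x bc _] := ab n; have [_ _ [ac _] h0 _] := phiP ax.
  have [_ _ _ h0' _] := phiP b_x; rewrite /t h0// h0' ?subrr ?mulr0//.
  by apply: contra ay; apply: slt_trans; exact: slt_transN bc.
have tr n y : ~~ slt s y (a n.+1) -> t n y = 0.
  move=> ya; have [ax b_x bc aS] := ab n; have [_ _ _ _ h1] := phiP ax.
  have [_ _ [bcb _] _ h1'] := phiP b_x; rewrite aS in ya.
  rewrite /t h1 ?h1' ?subrr ?mulr0//.
  by apply: contra ya => yc; apply: slt_trans bcb; exact: slt_transN bc.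
have sum1 k y : `|\sum_(0 <= n < k) t n y| <= 1 /\ (~~ slt s y (a k) -> \sum_(0 <= n < k) t n y = 0).
  elim: k => [|k [ih1 ih0]]; first by rewrite big_geq// normr0; split.
  rewrite sum_nat_recr; have [ya|ya] := boolP (slt s y (a k)).
    rewrite (tl _ _ (slt_asym ya)) addr0; split=> // /negP[]; apply: slt_trans ya _.
    have [ax b_x bc ->] := ab k; have [_ _ [ac _] _ _] := phiP ax.
    have [_ _ [bcb _] _ _] := phiP b_x.
    by apply: slt_trans bcb; exact: slt_transN bc.
  by rewrite ih0// add0r; split=> // /tr.
apply: dep_norm_le => // p.
have -> : dep_val (\sum_(0 <= n < N) e n *: (u (a n) - u (b n))) p =
    (\sum_(0 <= n < N) t n (p i)) * dep_val v p.
  elim: N => [|k ih]; first by rewrite !big_geq// mul0r.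
  rewrite !sum_nat_recr mulrDl -ih; have [ax b_x _ _] := ab k.
  by rewrite /t -mulrA mulrBl -(uE ax) -(uE b_x) [in LHS]addrC dep_valL dep_valB [in RHS]addrC.
by rewrite normrM (le_trans _ (dep_norm_ub v p))// ler_piMl// (sum1 _ _).1.
Qed.

(** Otherwise any number N of disjoint differences of bumps on which q exceeds e
    could be added with signs without increasing the norm: N e <= |q| |v|. *)
Lemma bumps_oscillation (q : dual D') (e : R) : 0 < e -> exists2 a, slt s a x &
  forall b, ~~ slt s b (c a) -> slt s b x -> `|q (u a) - q (u b)| <= e.
Proof.
move=> e0; apply: contrapT => nex.
have hb a : exists b, slt s a x ->
    [/\ slt s b x, ~~ slt s b (c a) & e < `|q (u a) - q (u b)| ].
  have [ax|] := boolP (slt s a x); last by exists x.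
  apply: contrapT => nb; apply: nex; exists a => // b bc b_x; rewrite leNgt.
  by apply/negP => h; apply: nb; exists b.
have [b bP] := choice hb; have [a0 a0x] := (big_side_limit kinf bx).1.
pose a n := iter n (fun y => c (b y)) a0.
have ax n : slt s (a n) x.
  elim: n => //= n ih; have [b_x _ _] := bP _ ih.
  by have [_ _ [_]] := phiP b_x.
pose sg n : R := Num.sg (q (u (a n)) - q (u (b (a n)))).
have [N hN] : exists N : nat, `|q| * `|v| < N%:R * e.
  have h0 : 0 <= `|q| * `|v| / e by rewrite divr_ge0 ?mulr_ge0// ltW.
  by exists (Num.bound (`|q| * `|v| / e)); rewrite -ltr_pdivrMr// archi_boundP.
have := dual_ub q (\sum_(0 <= n < N) sg n *: (u (a n) - u (b (a n)))).
have -> : q (\sum_(0 <= n < N) sg n *: (u (a n) - u (b (a n)))) =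
    \sum_(0 <= n < N) `|q (u (a n)) - q (u (b (a n)))|.
  rewrite linear_sum; apply: eq_bigr => n _.
  by rewrite linearZ/= linearB/= normrEsg.
apply/negP; rewrite -ltNge; apply: (@le_lt_trans _ _ (`|q| * `|v|)).
  rewrite ler_wpM2l//; apply: (@bumps_sum_norm _ (fun n => b (a n))) => n.
    by have [? ? _] := bP _ (ax n); split.
  by rewrite normr_sg lern1 leq_b1.
apply: lt_le_trans hN _; rewrite (le_trans _ (ler_norm _))//.
rewrite mulr_natl -[N in _ *+ N]subn0 -sumr_const_nat ler_sum// => n _.
by have [_ _ /ltW] := bP _ (ax n).
Qed.

(** The countably many thresholds that belong to the errors 2^-n do not reach x,
    since the side is big. *)
Lemma bumps_ev_const (q : dual D') : exists r, ev_const s x (fun a => q (u a)) r.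
Proof.
have e0 n : (0 : R) < 2^-1 ^+ n by rewrite exprn_gt0// invr_gt0.
have ha n : exists a, slt s a x /\
    forall b, ~~ slt s b (c a) -> slt s b x -> `|q (u a) - q (u b)| <= 2^-1 ^+ n.
  by have [a] := bumps_oscillation q (e0 n); exists a.
have [a aP] := choice ha.
have [||z zx az] := bx (B := range (fun n => c (a n))).
- by apply: countable_card_le => //; exact: card_image_le.
- by move=> _ [n _ <-]; have [ax _] := aP n; have [_ _ [_]] := phiP ax.
have {}az n : ~~ slt s z (c (a n)) by apply: slt_asym; apply: az; exists n.
exists (q (u z)), z => // b zb b_x; apply/eqP; rewrite -subr_eq0 -normr_eq0.
rewrite eq_le normr_ge0 andbT; apply/ler_addgt0Pl => e ep; rewrite addr0.
have [n hn] := half_small ep.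
have h1 := (aP n).2 z (az n) zx.
have h2 : `|q (u (a n)) - q (u b)| <= 2^-1 ^+ n.
  by apply: (aP n).2 => //; apply: contra (az n); exact: slt_trans.
rewrite -(subrKA (q (u (a n)))) (le_trans (ler_normD _ _))//.
by rewrite (le_trans _ (ltW hn))// mulr_natl mulr2n lerD// distrC.
Qed.

End one_vector.

Lemma dep_dfwith (v : D) (p : line_product K) (y : K i) :
  dep_val v (dfwith p i y) = dep_val v p.
Proof.
apply: dep_valP => j jl; rewrite dfwithout//.
by apply: contraNneq il => ->.
Qed.

(** The vector v is mapped to the limit of its products with the bumps. Evaluations
    see this limit as v at x and as 0 before x; a continuous function h cannot
    jump at x, and therefore is at distance at least |v| / 2 from the limit. *)
Lemma emb_lower_bumps : emb D (SP kinf D').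
Proof.
have hT a (v : D) : exists g : D', slt s a x ->
    forall p, dep_val g p = (phi a).1 (p i) * dep_val v p.
  have [ax|] := boolP (slt s a x); last by exists 0.
  by have [/(dep_mul v)[g gE] _ _ _ _] := phiP ax; exists g.
have [T TE] := choice (fun av : K i * D => hT av.1 av.2).
have {}TE a v : slt s a x -> forall p, dep_val (T (a, v)) p = (phi a).1 (p i) * dep_val v p.
  exact: (TE (a, v)).
have hW (v : D) : exists F : kap kinf D', forall q : dual D',
    ev_const s x (fun a => q (T (a, v))) (kval F q).
  apply: (ev_const_kappa kinf bx (M := `|v|)) => [a|q].
    by apply: (bump_vector_norm (u := fun a => T (a, v))) => b; exact: TE.
  by apply: (bumps_ev_const (v := v) (u := fun a => T (a, v))) => b; exact: TE.
have [W WP] := choice hW.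
have lW : linear W.
  move=> k v w; apply: kval_ext => q; apply: (ev_const_uniq kinf bx (WP _ q)).
  rewrite kvalD kvalZ.
  have [a ax ha] := ev_const_lin k (WP v q) (WP w q); exists a => // b ab b_x.
  have -> : T (b, k *: v + w) = k *: T (b, v) + T (b, w).
    by apply: dep_ext => p; rewrite dep_valL !(TE b _ b_x) dep_valL mulrDr mulrCA.
  by rewrite -(ha b)// linearP.
have bW : exists M, forall v : D, `|W v| <= M * `|v|.
  exists 1 => v; rewrite mul1r; apply: kap_norm_le => // q.
  apply: (ev_const_le kinf bx (WP v q)) => a ax.
  rewrite (le_trans (dual_ub q _))// mulrC ler_wpM2r//.
  by apply: (bump_vector_norm (u := fun a => T (a, v)) _ ax) => b; exact: TE.
pose W' : bop D (kap kinf D') := Bop lW bW.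
exists (bop_comp (SPquot kinf D') W'), 2^-1; first by rewrite invr_gt0.
move=> v; rewrite -[bop_comp _ _ _]/(SPquot kinf D' (W v)).
rewrite mulrC ler_pdivrMr//; set t := `|SPquot _ _ _|.
apply/ler_addgt0Pl => e e0; have e2 : 0 < e / 2 by rewrite divr_gt0.
have [h hW'] : exists h, `|W v - kiota kinf D' h| < t + e / 2.
  by apply: SPquot_lt; rewrite ltrDl.
have t0 : 0 <= t by exact: normr_ge0.
apply: dep_norm_le => [|p]; first by rewrite addr_ge0 ?mulr_ge0 ?(ltW e0).
have hE y (r : R) : (forall E : dual D', (forall f, E f = dep_val f (dfwith p i y)) ->
    kval (W v) E = r) -> `|r - dep_val h (dfwith p i y)| <= t + e / 2.
  move=> rE; have [E [E1 EE]] := @dep_eval_exists R m K (i :: l) (dfwith p i y).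
  rewrite -(rE E EE) -EE -(kiotaE kinf) -kvalB (le_trans (kval_ub _ _))//.
  by rewrite (le_trans _ (ltW hW'))// ler_piMr.
have [a0 a0x] := (big_side_limit kinf bx).1.
have hx : `|dep_val v p - dep_val h (dfwith p i x)| <= t + e / 2.
  apply: hE => E EE; apply: (ev_const_uniq kinf bx (WP v E)); exists a0 => // a _ ax.
  rewrite EE TE// dep_dfwith dfwithin; have [_ _ [_ cx] _ ->] := phiP ax.
    by rewrite mul1r.
  exact: slt_asym.
have hy y : slt s y x -> `|dep_val h (dfwith p i y)| <= t + e / 2.
  move=> yx; rewrite -normrN -[- _]add0r; apply: hE => E EE.
  apply: (ev_const_uniq kinf bx (WP v E)); exists y => // a ya ax.
  rewrite EE TE// dfwithin; have [_ _ _ h0 _] := phiP ax.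
  by rewrite h0 ?mul0r//; exact: slt_asym.
have hxx : `|dep_val h (dfwith p i x)| <= t + e / 2.
  apply/ler_addgt0Pl => d d0.
  have PF := side_nbhs_proper (big_side_limit kinf bx).
  have cvh : dep_val h (dfwith p i y) @[y --> x] --> dep_val h (dfwith p i x).
    apply: (@cvg_comp _ _ _ (dfwith p i) (dep_val h) _ (nbhs (dfwith p i x : line_product K))).
      exact: (@dfwith_continuous _ (fun i => K i : topologicalType)).
    exact: Cspace_continuous.
  move/cvgrPdist_le : cvh => /(_ _ d0)/(side_nbhs_le (big_side_limit kinf bx)) near_d.
  have [y [hd /hy]] := filter_ex (filterI near_d (side_nbhs_lt (big_side_limit kinf bx).1)).
  move=> hyy; rewrite -(subrK (dep_val h (dfwith p i y)) (dep_val h (dfwith p i x))).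
  by rewrite (le_trans (ler_normD _ _))// lerD.
rewrite -(subrK (dep_val h (dfwith p i x)) (dep_val v p)) (le_trans (ler_normD _ _))//.
by rewrite (le_trans (lerD hx hxx))// addrACA -splitr -mulr2n mulr_natr [leRHS]addrC.
Qed.

End lower_step.

Section lower_bound.
Context {R : realType} {kappa : Type} (kinf : infinite_set [set: kappa]).
Context {m : nat} (K : 'I_m -> compactLine).

Lemma emb_lower i (l : seq 'I_m) : i \notin l -> big_line kappa (K i) ->
  emb (dep (R := R) K l) (SP kinf (dep K (i :: l))).
Proof.
move=> il [s [x bx]]; have [phi phiP] := choice (bump_exists (R := R) kinf bx).
exact: emb_lower_bumps phiP.
Qed.

Lemma emb_SP_iter j (X Y : completeNormedModType R) :
  emb X Y -> emb (SP_iter kinf j X) (SP_iter kinf j Y).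
Proof. by move=> XY; elim: j => //= j; exact: emb_SP. Qed.

(** Each further coordinate with a big side pays for one more derivative. *)
Lemma SP_iter_dep (l : seq 'I_m) : uniq l -> (forall i, i \in l -> big_line kappa (K i)) ->
  ~ trivial_space (SP_iter kinf (size l) (dep (R := R) K l)).
Proof.
elim: l => [_ _|i l ih /= /andP[il ul] big_l]; first exact: dep_nontrivial.
have big_l' j : j \in l -> big_line kappa (K j) by move=> jl; apply: big_l; rewrite in_cons jl orbT.
apply: contra_not (ih ul big_l') => h.
apply: (emb_trivial (emb_SP_iter (size l) (emb_lower il (big_l i (mem_head _ _))))).
by rewrite /SP_iter -iterSr.
Qed.

Lemma SP_iter_Cspace : ~ trivial_space
  (SP_iter kinf (count (fun i => `[< big_line kappa (K i) >]) (enum 'I_m))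
    (Cspace R (line_product_compact K))).
Proof.
set P := fun i => _; rewrite -size_filter.
apply: (@contra_not _ _ _ (@SP_iter_dep [seq i <- enum 'I_m | P i] _ _)).
- exact: emb_trivial (emb_SP_iter _ (emb_dep _ _)).
- exact/filter_uniq/enum_uniq.
- by move=> i; rewrite mem_filter => /andP[/asboolP].
Qed.

End lower_bound.

Theorem theorem5p2 (R : realType) (kappa : Type) (kinf : infinite_set [set: kappa])
  (n m : nat) (K : 'I_m -> compactLine) (hK : product_class K kappa n) :
  spdim kinf (Cspace R (line_product_compact K)) = n%:Z%:E.
Proof.
have big_count : count (fun i => `[< big_line kappa (K i) >]) (enum 'I_m) = n.
  case: hK => nm [s sP].
  have sbig i : `[< big_line kappa (K (s i)) >] = (i < n)%N.
    apply/asboolP/idP => [b|/sP nch].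
      by apply/sP => ch; exact: (character_big_line kinf ch).
    by apply: contrapT => nb; apply: nch; exact: big_line_character.
  rewrite -sum1_count big_enum_cond /= (reindex_inj (@perm_inj _ s)) /=.
  rewrite (eq_bigl (fun i : 'I_m => (i < n)%N)); last by move=> i; rewrite sbig.
  by rewrite -(big_ord_widen m (fun=> 1%N) nm) sum1_card card_ord.
apply: spdimP; last by rewrite -[X in SP_iter _ X]big_count; exact: SP_iter_Cspace.
have := @killed_Cspace R kappa kinf m K; rewrite big_count => /(_ (nseq n.+1 true)).
have app_SP j (X : completeNormedModType R) : app kinf (nseq j true) X = SP_iter kinf j X.
  by elim: j X => //= j ih X; rewrite ih /SP_iter -iterSr.
by rewrite /kills app_SP; apply; rewrite count_nseq mul1n.
Qed.
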